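(* Let $\nu>0$. The pointwise limit as $R\to+\infty$ of the weighted Bergman kernel $K^{\nu R^2}_{R,slice}$ of the slice hyperholomorphic Bergman space $A^{2,\nu R^2}_{slice}(\mathbb{B}_R)$ (i.e. with parameter $\alpha=\nu R^2$) is exactly the reproducing kernel of the slice hyperholomorphic Bargmann-Fock space $\mathcal{F}^{2,\nu}_{slice}(\mathbb{H})$. More precisely, for every fixed $(q,p)\in\mathbb{H}\times\mathbb{H}$, $$\lim_{R\to+\infty}K^{\nu R^2}_{R,slice}(q,p)=e_*^{[\nu q,\overline{p}]}:=\sum_{n=0}^{+\infty}\frac{\nu^nq^n\overline{p}^n}{n!}.$$
   Context: $\mathbb{H}$ is the algebra of quaternions, with conjugation $q\mapsto\overline q$ and modulus $|q|$; $\mathbb{S}=\{I\in\mathbb{H}: I^2=-1\}$; for $I\in\mathbb{S}$, $\mathbb{C}_I=\mathbb{R}+\mathbb{R}I$. For $R>0$, $\mathbb{B}_R=\{q\in\mathbb{H}:|q|<R\}$ and $\mathbb{B}_{R,I}=\mathbb{B}_R\cap\mathbb{C}_I$. For $\Omega=\mathbb{B}_R$ or $\Omega=\mathbb{H}$, a real differentiable function $f:\Omega\to\mathbb{H}$ is (left) slice regular if for every $I\in\mathbb{S}$ its restriction $f_I$ to $\Omega\cap\mathbb{C}_I$ has continuous partial derivatives and satisfies $\left(\frac{\partial}{\partial x}+I\frac{\partial}{\partial y}\right)f_I(x+yI)=0$. For $\alpha>0$, the slice hyperholomorphic Bergman space $A^{2,\alpha}_{slice}(\mathbb{B}_R)$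 is the right $\mathbb{H}$-vector space of slice regular functions $f$ on $\mathbb{B}_R$ whose restriction to $\mathbb{B}_{R,I}$ is square integrable with respect to $d\lambda^\alpha_{I,R}(x+yI)=\frac{\alpha}{\pi R^2}\left(1-\frac{|x+yI|^2}{R^2}\right)^{\alpha-1}dx\,dy$ (the space does not depend on $I\in\mathbb{S}$). It is a right quaternionic Hilbert space with scalar product $\int_{\mathbb{B}_{R,I}}\overline{f}\,g\,d\lambda^\alpha_{I,R}$, and its reproducing kernel (the weighted Bergman kernel) $K^{\alpha}_{R,slice}$ is the unique function on $\mathbb{B}_R\times\mathbb{B}_R$ such that $K^{\alpha}_{R,slice}(\cdot,p)\in A^{2,\alpha}_{slice}(\mathbb{B}_R)$ for each $p$, $\overline{K^{\alpha}_{R,slice}(q,p)}=K^{\alpha}_{R,slice}(p,q)$, and $f(q)=\int_{\mathbb{B}_{R,I}}K^{\alpha}_{R,slice}(q,z)f(z)\,d\lambda^\alpha_{I,R}(z)$ for all $f\in A^{2,\alpha}_{slice}(\mathbb{B}_R)$, $q\in\mathbb{B}_R$, $I\in\mathbb{S}$. For fixed $(q,p)$, $K^{\nu R^2}_{R,slice}(q,p)$ is defined for $R>\max(|q|,|p|)$. The slice hyperholomorphic Bargmann-Fock space $\mathcal{F}^{2,\nu}_{slice}(\mathbb{H})$ is the space of slice regular functions on $\mathbb{H}$ whose restriction to $\mathbb{C}_I$ is square integrable with respect to the Gaussian measure $\frac{\nu}{\pi}e^{-\nu|q|^2}dx\,dy$, $q=x+yI$ (independent of $I\in\mathbb{S}$),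 with scalar product $\int_{\mathbb{C}_I}\overline{f}\,g\,\frac{\nu}{\pi}e^{-\nu|q|^2}dx\,dy$; its reproducing kernel is the unique function $K$ on $\mathbb{H}\times\mathbb{H}$ such that $K(\cdot,p)\in\mathcal{F}^{2,\nu}_{slice}(\mathbb{H})$ for each $p\in\mathbb{H}$, $\overline{K(q,p)}=K(p,q)$ for all $q,p\in\mathbb{H}$, and $f(q)=\int_{\mathbb{C}_I}K(q,z)f(z)\,\frac{\nu}{\pi}e^{-\nu|z|^2}dx\,dy$ (with $z=x+yI$) for all $f\in\mathcal{F}^{2,\nu}_{slice}(\mathbb{H})$, $q\in\mathbb{H}$, $I\in\mathbb{S}$. *)

(* Defs.v *)
From HB Require Import structures.
From mathcomp Require Import all_boot all_order all_algebra.
From mathcomp Require Import all_classical all_reals all_analysis.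
From mathcomp Require Import ring lra.

Set Implicit Arguments.
Unset Strict Implicit.
Unset Printing Implicit Defensive.

Import Order.TTheory GRing.Theory Num.Theory.
Import numFieldNormedType.Exports.

Local Open Scope classical_set_scope.
Local Open Scope ring_scope.

(* [q 0 0], [q 0 1], [q 0 2], [q 0 3] are the coordinates of [q] on 1, i, j, k.
   The alias inherits the topology and the differentiable structure of R^4.
   Pitfall: the library norm [`|q|] is the sup norm of the coordinates; the
   quaternionic modulus is [qmod] below. *)
Definition quat (R : realType) : Type := 'rV[R]_4.

HB.instance Definition _ (R : realType) :=
  NormedModule.on (quat R).
HB.instance Definition _ (R : realType) := Complete.on (quat R).

Section Quaternion.
Context {R : realType}.
Implicit Types p q : quat R.

Definition mkquat (a b c d : R) : quat R :=
  \row_(l < 4) nth 0 [:: a; b; c; d] l.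

Definition qone : quat R := mkquat 1 0 0 0.

Definition qmul p q : quat R := mkquat
  (p 0 0 * q 0 0 - p 0 1 * q 0 1 - p 0 2 * q 0 2 - p 0 3 * q 0 3)
  (p 0 0 * q 0 1 + p 0 1 * q 0 0 + p 0 2 * q 0 3 - p 0 3 * q 0 2)
  (p 0 0 * q 0 2 - p 0 1 * q 0 3 + p 0 2 * q 0 0 + p 0 3 * q 0 1)
  (p 0 0 * q 0 3 + p 0 1 * q 0 2 - p 0 2 * q 0 1 + p 0 3 * q 0 0).

Definition qconj q : quat R :=
  mkquat (q 0 0) (- q 0 1) (- q 0 2) (- q 0 3).

Definition qmod q : R := Num.sqrt (\sum_(l < 4) q 0 l ^+ 2).

Lemma quatP p q : p 0 0 = q 0 0 -> p 0 1 = q 0 1 -> p 0 2 = q 0 2 ->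
  p 0 3 = q 0 3 -> p = q.
Proof.
move=> h0 h1 h2 h3; apply/rowP => -[[|[|[|[|//]]]] hl].
- by rewrite (_ : Ordinal hl = 0) //; apply/val_inj.
- by rewrite (_ : Ordinal hl = 1) //; apply/val_inj.
- by rewrite (_ : Ordinal hl = 2) //; apply/val_inj.
- by rewrite (_ : Ordinal hl = 3) //; apply/val_inj.
Qed.

Lemma mkquatE a b c d : (mkquat a b c d 0 0 = a) * (mkquat a b c d 0 1 = b) *
  (mkquat a b c d 0 2 = c) * (mkquat a b c d 0 3 = d).
Proof. by do !split; rewrite mxE. Qed.

Lemma qmulA : associative qmul.
Proof. by move=> x y z; apply: quatP; rewrite !mkquatE; ring. Qed.

Lemma qmul1 : left_id qone qmul.
Proof. by move=> x; apply: quatP; rewrite !mkquatE; ring. Qed.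

Lemma qmulr1 : right_id qone qmul.
Proof. by move=> x; apply: quatP; rewrite !mkquatE; ring. Qed.

Lemma qmulDl : left_distributive qmul +%R.
Proof. by move=> x y z; apply: quatP; rewrite !(mkquatE, mxE) /=; ring. Qed.

Lemma qmulDr : right_distributive qmul +%R.
Proof. by move=> x y z; apply: quatP; rewrite !(mkquatE, mxE) /=; ring. Qed.

Lemma qone_neq0 : qone != 0.
Proof.
by apply/eqP => /rowP/(_ 0); rewrite mkquatE mxE => /eqP; rewrite oner_eq0.
Qed.

HB.instance Definition _ := GRing.Zmodule_isNzRing.Build (quat R)
  qmulA qmul1 qmulr1 qmulDl qmulDr qone_neq0.

Lemma qscalerAl (a : R) p q : a *: (p * q) = (a *: p) * q.
Proof.
by apply: quatP; rewrite /GRing.mul /= !(mkquatE, mxE) /= /qmul;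
   rewrite ?(mkquatE, mxE) /=; ring.
Qed.

Lemma qscalerAr (a : R) p q : a *: (p * q) = p * (a *: q).
Proof.
by apply: quatP; rewrite /GRing.mul /= !(mkquatE, mxE) /= /qmul;
   rewrite ?(mkquatE, mxE) /=; ring.
Qed.

HB.instance Definition _ :=
  GRing.LSemiModule_isLSemiAlgebra.Build R (quat R) qscalerAl.
HB.instance Definition _ :=
  GRing.LSemiAlgebra_isSemiAlgebra.Build R (quat R) qscalerAr.

End Quaternion.

Section SliceRegular.
Context {R : realType}.

Definition imag_unit : set (quat R) := [set I | I * I = -1].

Definition slice (I : quat R) (z : R * R) : quat R := z.1%:A + z.2 *: I.

Definition qball (r : R) : set (quat R) := [set q | qmod q < r].

(* A function on [Om] is a total function considered on [Om] only; all the
   predicates below are insensitive to its values outside of the open set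
   [Om]. *)
Definition slice_regular (Om : set (quat R)) (f : quat R -> quat R) : Prop :=
  (forall q, Om q -> differentiable f q) /\
  forall I, imag_unit I -> forall z, Om (slice I z) ->
    let fI := f \o slice I in
    [/\ derivable fI z (1, 0),
        derivable fI z (0, 1),
        {for z, continuous ('D_(1, 0) fI)},
        {for z, continuous ('D_(0, 1) fI)} &
        'D_(1, 0) fI z + I * 'D_(0, 1) fI z = 0].

End SliceRegular.

Section Kernel.
Context {R : realType}.

Local Notation mu := ((@lebesgue_measure R \x @lebesgue_measure R)%E).

Definition qintegral (D : set (R * R)) (F : R * R -> quat R) : quat R :=
  \row_(l < 4) \int[mu]_(z in D) (F z 0 l).

Implicit Types (Om : set (quat R)) (rho : quat R -> R)
  (K : quat R -> quat R -> quat R).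

(* For the weights used here, square integrability on one slice is equivalent
   to square integrability on all of them, so no slice is singled out. *)
Definition slice_L2 Om rho : set (quat R -> quat R) :=
  [set f | slice_regular Om f /\
    forall I, imag_unit I ->
      mu.-integrable (slice I @^-1` Om)
        (fun z => (qmod (f (slice I z)) ^+ 2 * rho (slice I z))%:E)].

Definition reproducing_kernel_spec Om rho K : Prop :=
  [/\ forall p, Om p -> slice_L2 Om rho (K ^~ p),
      forall q p, Om q -> Om p -> qconj (K q p) = K p q &
      forall f, slice_L2 Om rho f ->
        forall q I, Om q -> imag_unit I ->
          f q = qintegral (slice I @^-1` Om)
            (fun z => rho (slice I z) *: (K q (slice I z) * f (slice I z)))].

(* Kernels are total functions, hence uniqueness is only meaningful on
   Om x Om. *)
Definition is_reproducing_kernel Om rho K : Prop :=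
  reproducing_kernel_spec Om rho K /\
  forall K', reproducing_kernel_spec Om rho K' ->
    forall q p, Om q -> Om p -> K' q p = K q p.

(* Junk value 0 if there is no reproducing kernel; meaningless outside of
   Om x Om. *)
Definition reproducing_kernel Om rho : quat R -> quat R -> quat R :=
  xget (fun _ _ => 0) [set K | is_reproducing_kernel Om rho K].

Definition bergman_weight (alpha r : R) (q : quat R) : R :=
  alpha / (pi * r ^+ 2) * (1 - qmod q ^+ 2 / r ^+ 2) `^ (alpha - 1).

Definition fock_weight (nu : R) (q : quat R) : R :=
  nu / pi * expR (- nu * qmod q ^+ 2).

Definition bergman_kernel (alpha r : R) :=
  reproducing_kernel (qball r) (bergman_weight alpha r).

Definition fock_kernel (nu : R) := reproducing_kernel setT (fock_weight nu).

Definition star_exp_term (nu : R) (q p : quat R) (n : nat) : quat R :=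
  (nu ^+ n / n`!%:R) *: (q ^+ n * qconj p ^+ n).

Definition star_exp (nu : R) (q p : quat R) : quat R :=
  limn (series (star_exp_term nu q p)).

End Kernel.

(* Main.v *)
Require Import Defs.
From HB Require Import structures.
From mathcomp Require Import all_boot all_order all_algebra.
From mathcomp Require Import all_classical all_reals all_analysis.
From mathcomp Require Import measurable_realfun ring lra.

(** Both families of spaces are one. For [kap >= 0] take the domain
    [kap * |q| ^ 2 < 1] with a radial weight [nu / pi * w (|q| ^ 2)], where
    [kap = r ^- 2] and [w t = (1 - kap * t) ^ (nu / kap - 1)] is the Bergman
    space and [kap = 0], [w t = exp (- nu * t)] is the Fock space. In both cases
    [v t = (1 - kap * t) * w t] satisfies [v' = - nu * w] ([radial_weight]).
    Integrating the derivative of [t ^ n * v t], the powers of the variable have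
    squared norms [(kcoef kap nu n)^-1] with
    [kcoef kap nu n = \prod_(1 <= j <= n) (nu + j * kap) / n`!]
    ([moment_rec], [wplane_moment]), and distinct powers are orthogonal on each
    disc of a slice by rotation invariance ([monomial_orthogonal]). So the kernel
    has to be [\sum_n kcoef kap nu n * q ^ n * qconj p ^ n] ([wkernel]).

    That this series is the reproducing kernel ([wkernel_is_reproducing])
    requires every slice regular function to have a Taylor expansion with
    coefficients on the right ([slice_regular_taylor]). It comes from a discrete
    Cauchy formula on each slice, a sum over roots of unity
    ([discrete_cauchy]), and from the uniqueness of the coefficients on the real
    axis, which is common to all slices. Conversely a power series is slice
    regular ([power_series_slice_regular]). The [n]-th coefficient of [f] is
    [kcoef kap nu n] times the integral of [qconj z ^ n * f z]
    ([taylor_plane]), and the kernel series may be integrated term by term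
    because it is dominated by a square integrable function
    ([wkernel_dominated]).

    At [kap = 0] the coefficients are [nu ^ n / n`!], so the Fock kernel is the
    star exponential ([star_expE]). Each [kcoef kap nu n] is a polynomial in
    [kap] with nonnegative coefficients, hence is convex on [[0, +oo[: for
    [0 <= t <= 1] its increment from [0] to [t * k] is at most [t] times its
    increment from [0] to [k] ([kcoef_chord]). As the series with parameter [k]
    converges absolutely, the Bergman and Fock kernels at a given point differ
    by O(r ^ - 2) ([wkernel_chord], [bergman_kernel_cvg]). *)

Set Implicit Arguments.
Unset Strict Implicit.
Unset Printing Implicit Defensive.

Import Order.TTheory GRing.Theory Num.Theory.
Import numFieldNormedType.Exports.

Local Open Scope classical_set_scope.
Local Open Scope ring_scope.

(** * Modulus, conjugation and slices of the quaternions *)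

Section QuaternionModulus.
Context {R : realType}.
Implicit Types (p q : quat R) (z : R * R).

Lemma quatE0 p q : (p * q) 0 0 =
  p 0 0 * q 0 0 - p 0 1 * q 0 1 - p 0 2 * q 0 2 - p 0 3 * q 0 3.
Proof. by rewrite {1}/GRing.mul /= mkquatE. Qed.
Lemma quatE1 p q : (p * q) 0 1 =
  p 0 0 * q 0 1 + p 0 1 * q 0 0 + p 0 2 * q 0 3 - p 0 3 * q 0 2.
Proof. by rewrite {1}/GRing.mul /= mkquatE. Qed.
Lemma quatE2 p q : (p * q) 0 2 =
  p 0 0 * q 0 2 - p 0 1 * q 0 3 + p 0 2 * q 0 0 + p 0 3 * q 0 1.
Proof. by rewrite {1}/GRing.mul /= mkquatE. Qed.
Lemma quatE3 p q : (p * q) 0 3 =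
  p 0 0 * q 0 3 + p 0 1 * q 0 2 - p 0 2 * q 0 1 + p 0 3 * q 0 0.
Proof. by rewrite {1}/GRing.mul /= mkquatE. Qed.

Lemma quat1E : ((1 : quat R) 0 0 = 1) * ((1 : quat R) 0 1 = 0) *
  ((1 : quat R) 0 2 = 0) * ((1 : quat R) 0 3 = 0).
Proof. by rewrite /GRing.one /= /qone !mkquatE. Qed.

Lemma quatDE p q l : (p + q) 0 l = p 0 l + q 0 l. Proof. by rewrite mxE. Qed.
Lemma quatNE p l : (- p) 0 l = - p 0 l. Proof. by rewrite mxE. Qed.
Lemma quatZE p (a : R) l : (a *: p) 0 l = a * p 0 l. Proof. by rewrite mxE. Qed.
Lemma quat0E l : (0 : quat R) 0 l = 0. Proof. by rewrite mxE. Qed.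

Definition quatE :=
  (quatDE, quatNE, quatZE, quat0E, quatE0, quatE1, quatE2, quatE3, quat1E,
   @mkquatE R).

Lemma qmodE q : qmod q ^+ 2 =
  q 0 0 ^+ 2 + q 0 1 ^+ 2 + q 0 2 ^+ 2 + q 0 3 ^+ 2.
Proof.
rewrite /qmod sqr_sqrtr; last by rewrite sumr_ge0// => i _; exact: sqr_ge0.
rewrite !big_ord_recr big_ord0 /= add0r; congr (_ + _ + _ + _);
  congr (q _ _ ^+ 2); exact/val_inj.
Qed.

Lemma qmod_ge0 q : 0 <= qmod q. Proof. exact: sqrtr_ge0. Qed.
Hint Resolve qmod_ge0 : core.

Lemma qmod_eqP (x : R) q : 0 <= x -> qmod q ^+ 2 = x ^+ 2 -> qmod q = x.
Proof. by move=> x0 /eqP; rewrite eqrXn2// => /eqP. Qed.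

Lemma qmodM p q : qmod (p * q) = qmod p * qmod q.
Proof.
apply: qmod_eqP; first by rewrite mulr_ge0.
by rewrite exprMn !qmodE !quatE; ring.
Qed.

Lemma qmodZ (a : R) q : qmod (a *: q) = `|a| * qmod q.
Proof.
apply: qmod_eqP; first by rewrite mulr_ge0.
by rewrite exprMn !qmodE !mxE real_normK ?num_real//; ring.
Qed.

Lemma qmod1 : qmod (1 : quat R) = 1.
Proof. by apply: qmod_eqP => //; rewrite !qmodE !quatE; ring. Qed.

Lemma qmod0 : qmod (0 : quat R) = 0.
Proof. by rewrite -(scale0r (0 : quat R)) qmodZ normr0 mul0r. Qed.

Lemma qmodN q : qmod (- q) = qmod q.
Proof. by rewrite -scaleN1r qmodZ normrN1 mul1r. Qed.

Lemma qmodX q n : qmod (q ^+ n) = qmod q ^+ n.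
Proof.
by elim: n => [|n ih]; rewrite ?expr0 ?qmod1// !exprS qmodM ih.
Qed.

Lemma qmod_conj q : qmod (qconj q) = qmod q.
Proof. by apply: qmod_eqP => //; rewrite !qmodE !quatE !sqrrN. Qed.

Lemma qcoord_le q l : `|q 0 l| <= qmod q.
Proof.
rewrite -(sqrtr_sqr (q 0 l)) /qmod ler_wsqrtr// (bigD1 l)//=.
by rewrite lerDl sumr_ge0// => i _; exact: sqr_ge0.
Qed.

(** The cross term is the real part of [p * qconj q], hence at most its
    modulus. *)
Lemma qmodD p q : qmod (p + q) <= qmod p + qmod q.
Proof.
rewrite -(@ler_pXn2r _ 2)// ?nnegrE ?addr_ge0//.
have := le_trans (ler_norm _) (qcoord_le (p * qconj q) 0).
rewrite sqrrD qmodM qmod_conj (qmodE (_ + _)) (qmodE p) (qmodE q) !quatE => h.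
lra.
Qed.

Lemma qmodB p q : qmod (p - q) <= qmod p + qmod q.
Proof. by rewrite -(qmodN q); exact: qmodD. Qed.

Lemma qmodC p q : qmod (p - q) = qmod (q - p).
Proof. by rewrite -qmodN opprB. Qed.

Lemma qmod_sum n (F : 'I_n -> quat R) :
  qmod (\sum_(i < n) F i) <= \sum_(i < n) qmod (F i).
Proof.
elim/big_ind2 : _ => [|x a y b xa yb|//]; first by rewrite qmod0.
by rewrite (le_trans (qmodD _ _))// lerD.
Qed.

Lemma qmod_gt0 q : q != 0 -> 0 < qmod q.
Proof.
move=> q0; rewrite lt_def qmod_ge0 andbT; apply: contra q0 => /eqP q0.
apply/eqP/rowP => l; rewrite mxE; apply/eqP; rewrite -normr_le0 -q0.
exact: qcoord_le.
Qed.

Lemma normq_le_qmod q : `|q| <= qmod q.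
Proof.
rewrite /Num.norm /= mx_normrE; apply: bigmax_le => // -[i j] _ /=.
by rewrite ord1; exact: qcoord_le.
Qed.

Lemma qcoord_le_norm q l : `|q 0 l| <= `|q|.
Proof.
rewrite [leRHS]/Num.norm /= mx_normrE.
exact: (le_bigmax _ (fun ij : 'I_1 * 'I_4 => `|q ij.1 ij.2|) (0, l)).
Qed.

Lemma qmod_le_norm q : qmod q <= 2 * `|q|.
Proof.
rewrite -(@ler_pXn2r _ 2)// ?nnegrE ?mulr_ge0// exprMn qmodE.
have h l : q 0 l ^+ 2 <= `|q| ^+ 2.
  by rewrite -(real_normK (num_real (q 0 l))) ler_pXn2r ?nnegrE// qcoord_le_norm.
by have := h 0; have := h 1; have := h 2; have := h 3; lra.
Qed.

Lemma qconjM p q : qconj (p * q) = qconj q * qconj p.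
Proof. by apply: quatP; rewrite !quatE; ring. Qed.

Lemma qconjZ (a : R) q : qconj (a *: q) = a *: qconj q.
Proof. by apply: quatP; rewrite !quatE; ring. Qed.

Lemma qconjD p q : qconj (p + q) = qconj p + qconj q.
Proof. by apply: quatP; rewrite !quatE; ring. Qed.

Lemma qconjK q : qconj (qconj q) = q.
Proof. by apply: quatP; rewrite !quatE ?opprK. Qed.

Lemma qconj1 : qconj 1 = 1 :> quat R.
Proof. by apply: quatP; rewrite !quatE ?oppr0. Qed.

Lemma qconjX q n : qconj (q ^+ n) = qconj q ^+ n.
Proof.
by elim: n => [|n ih]; rewrite ?expr0 ?qconj1// exprS exprSr qconjM ih.
Qed.

(** A nonzero [I 0 0] would make the other coordinates vanish, since those of
    [I * I] are [2 * I 0 0] times them; but a real square is not [-1]. *)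
Lemma imag_unitE (I : quat R) : imag_unit I ->
  I 0 0 = 0 /\ I 0 1 ^+ 2 + I 0 2 ^+ 2 + I 0 3 ^+ 2 = 1.
Proof.
rewrite /imag_unit /= => /rowP e.
have := e 0; have := e 1; have := e 2; have := e 3.
rewrite !quatE => e3 e2 e1 e0.
have I00 : I 0 0 = 0.
  have : I 0 0 * (I 0 1 ^+ 2 + I 0 2 ^+ 2 + I 0 3 ^+ 2) = 0.
    have i1 : I 0 0 * I 0 1 = 0 by lra.
    have i2 : I 0 0 * I 0 2 = 0 by lra.
    have i3 : I 0 0 * I 0 3 = 0 by lra.
    by rewrite !mulrDr !expr2 !mulrA i1 i2 i3 !mul0r !addr0.
  by nra.
by split=> //; rewrite I00 in e0; lra.
Qed.

Lemma qmod_slice (I : quat R) z : imag_unit I ->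
  qmod (slice I z) ^+ 2 = z.1 ^+ 2 + z.2 ^+ 2.
Proof.
move=> /imag_unitE[I0 I1]; rewrite qmodE /slice !quatE I0.
transitivity (z.1 ^+ 2 + z.2 ^+ 2 * (I 0 1 ^+ 2 + I 0 2 ^+ 2 + I 0 3 ^+ 2)).
  by ring.
by rewrite I1 mulr1.
Qed.

Lemma sliceM (I : quat R) z w : imag_unit I -> slice I z * slice I w =
  slice I (z.1 * w.1 - z.2 * w.2, z.1 * w.2 + z.2 * w.1).
Proof.
move=> hI; rewrite /slice mulrDl !mulrDr /= -!scalerAl -!scalerAr !mul1r !mulr1.
rewrite !scalerA hI scalerN scalerBl scalerDl addrA addrAC addrACA.
by rewrite -addrA [X in _ + X]addrC -!addrA; congr (_ + _); rewrite addrC !addrA.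
Qed.

Lemma slice_comm (I : quat R) z w : imag_unit I ->
  slice I z * slice I w = slice I w * slice I z.
Proof.
by move=> hI; rewrite !sliceM//; congr (slice I (_, _)); rewrite /=; ring.
Qed.

Lemma slice_conj (I : quat R) z : imag_unit I ->
  qconj (slice I z) = slice I (z.1, - z.2).
Proof.
move=> /imag_unitE[I0 _]; apply: quatP; rewrite /slice !(quatE, I0) /=; ring.
Qed.

Lemma slice1 (I : quat R) : slice I (1, 0) = 1.
Proof. by rewrite /slice /= scale1r scale0r addr0. Qed.

Lemma sliceD (I : quat R) z w : slice I (z + w) = slice I z + slice I w.
Proof. by rewrite /slice !scalerDl addrACA. Qed.

Lemma sliceZ (I : quat R) (a : R) z : slice I (a *: z) = a *: slice I z.
Proof. by rewrite /slice scalerDr !scalerA. Qed.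

Lemma sliceB (I : quat R) z w : slice I (z - w) = slice I z - slice I w.
Proof. by rewrite -[in LHS](scaleN1r w) sliceD sliceZ scaleN1r. Qed.

(** The imaginary part of [q] spans the slice; a real [q] lies in all of them. *)
Lemma slice_exists q : exists I z, imag_unit I /\ q = slice I z.
Proof.
pose y := Num.sqrt (q 0 1 ^+ 2 + q 0 2 ^+ 2 + q 0 3 ^+ 2).
have y2 : y ^+ 2 = q 0 1 ^+ 2 + q 0 2 ^+ 2 + q 0 3 ^+ 2.
  by rewrite sqr_sqrtr// !addr_ge0// sqr_ge0.
have [y0|y0] := eqVneq y 0.
- exists (mkquat 0 1 0 0), (q 0 0, 0); split.
    by apply: quatP; rewrite !quatE; ring.
  rewrite y0 expr0n /= in y2.
  have [q1 q2 q3] : [/\ q 0 1 = 0, q 0 2 = 0 & q 0 3 = 0].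
    by split; apply/eqP; rewrite -sqrf_eq0; apply/eqP; nra.
  by apply: quatP; rewrite /slice !quatE ?q1 ?q2 ?q3 /=; ring.
- exists (y^-1 *: mkquat 0 (q 0 1) (q 0 2) (q 0 3)), (q 0 0, y); split.
    rewrite /imag_unit /= -scalerAl -scalerAr scalerA -expr2.
    apply: quatP; rewrite !quatE; last 3 first.
    1-3: by move: (y^-1 ^+ 2) => u; rewrite oppr0; ring.
    transitivity (- (y^-1 ^+ 2 * y ^+ 2)); first by rewrite y2; move: (y^-1 ^+ 2) => u; ring.
    by rewrite exprVn mulVf// expf_neq0.
  by apply: quatP; rewrite /slice scalerA divff// !quatE /=; ring.
Qed.

End QuaternionModulus.
#[global] Hint Extern 0 (is_true (Order.le _ (qmod _))) =>
  solve [exact: qmod_ge0] : core.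

Section QuaternionTopology.
Context {R : realType}.
Implicit Types (p q : quat R).

Lemma qmod_diff p q : `|qmod p - qmod q| <= qmod (p - q).
Proof.
have h a b : qmod a - qmod b <= qmod (a - b).
  by rewrite lerBlDr (le_trans _ (qmodD _ _))// subrK.
by rewrite ler_norml h andbT lerNl opprB qmodC h.
Qed.

Lemma cvg_qmodP {T : Type} {F : set_system T} {FF : Filter F}
    (f : T -> quat R) l :
  (f x @[x --> F] --> l) <-> (qmod (f x - l) @[x --> F] --> 0).
Proof.
split=> [fl|fl].
- apply/cvgrPdist_lt => e e0; have e20 : 0 < e / 2 by rewrite divr_gt0.
  have /cvgrPdist_lt/(_ _ e20) := fl; apply: filterS => x.
  rewrite sub0r normrN (ger0_norm (qmod_ge0 _)) qmodC => h.
  by rewrite (le_lt_trans (qmod_le_norm _))// mulrC -ltr_pdivlMr.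
- apply/cvgrPdist_lt => e e0.
  have /cvgrPdist_lt/(_ _ e0) := fl; apply: filterS => x.
  rewrite sub0r normrN (ger0_norm (qmod_ge0 _)) qmodC; apply: le_lt_trans.
  exact: normq_le_qmod.
Qed.

Lemma cvg_qmod {T : Type} {F : set_system T} {FF : Filter F}
    (f : T -> quat R) l :
  (f x @[x --> F] --> l) -> qmod (f x) @[x --> F] --> qmod l.
Proof.
move=> /cvg_qmodP fl; apply/cvgrPdist_lt => e e0.
have /cvgrPdist_lt/(_ _ e0) := fl; apply: filterS => x.
rewrite sub0r normrN (ger0_norm (qmod_ge0 _)); apply: le_lt_trans.
by rewrite distrC; exact: qmod_diff.
Qed.

Lemma cvg_qcoord {T : Type} {F : set_system T} {FF : Filter F}
    (f : T -> quat R) q l :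
  (f x @[x --> F] --> q) -> f x 0 l @[x --> F] --> q 0 l.
Proof.
by move=> fl; exact: (continuous_cvg _ (@coord_continuous R 1 4 0 l q) fl).
Qed.

Lemma cvg_quatP {T : Type} {F : set_system T} {FF : Filter F}
    (f : T -> quat R) q :
  (forall l, f x 0 l @[x --> F] --> q 0 l) -> f x @[x --> F] --> q.
Proof.
move=> fl; apply/cvgrPdist_lt => e e0.
have : \forall x \near F, forall l, `|q 0 l - f x 0 l| < e.
  by apply: filter_forall => l; move/cvgrPdist_lt : (fl l); exact.
apply: filterS => x h; rewrite /Num.norm /= mx_normrE; apply: bigmax_lt => //.
by move=> [i j] _ /=; rewrite ord1 2!mxE; exact: h.
Qed.

Lemma cvg_qM {T : Type} {F : set_system T} {FF : Filter F}
    (f g : T -> quat R) p q :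
  (f x @[x --> F] --> p) -> (g x @[x --> F] --> q) ->
  f x * g x @[x --> F] --> p * q.
Proof.
move=> fp gq.
have fl l : f x 0 l @[x --> F] --> p 0 l by exact: cvg_qcoord.
have gl l : g x 0 l @[x --> F] --> q 0 l by exact: cvg_qcoord.
apply: cvg_quatP => -[[|[|[|[|//]]]] hl].
- rewrite (_ : Ordinal hl = 0); last exact/val_inj.
  under eq_fun do rewrite quatE; rewrite quatE.
  by apply: cvgB; [apply: cvgB; [apply: cvgB|]|]; exact: cvgM.
- rewrite (_ : Ordinal hl = 1); last exact/val_inj.
  under eq_fun do rewrite quatE; rewrite quatE.
  by apply: cvgB; [apply: cvgD; [apply: cvgD|]|]; exact: cvgM.
- rewrite (_ : Ordinal hl = 2); last exact/val_inj.
  under eq_fun do rewrite quatE; rewrite quatE.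
  by apply: cvgD; [apply: cvgD; [apply: cvgB|]|]; exact: cvgM.
- rewrite (_ : Ordinal hl = 3); last exact/val_inj.
  under eq_fun do rewrite quatE; rewrite quatE.
  by apply: cvgD; [apply: cvgB; [apply: cvgD|]|]; exact: cvgM.
Qed.

Lemma cvg_qconj {T : Type} {F : set_system T} {FF : Filter F}
    (f : T -> quat R) q :
  (f x @[x --> F] --> q) -> qconj (f x) @[x --> F] --> qconj q.
Proof.
move=> /cvg_qmodP fq; apply/cvg_qmodP.
rewrite [X in X @ F](_ : _ = fun x => qmod (f x - q)) //; apply/funext => x.
rewrite -(qmod_conj (f x - q)) qconjD.
by congr (qmod (_ + _)); apply: quatP; rewrite !quatE.
Qed.

Lemma slice_continuous (I : quat R) : continuous (slice I).
Proof.
move=> z; rewrite /slice; apply: cvgD.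
  by apply: cvgZr_tmp; exact: cvg_fst.
by apply: cvgZr_tmp; exact: cvg_snd.
Qed.

End QuaternionTopology.

(** * Derivatives along a slice *)

Section SliceDerivative.
Context {R : realType}.
Implicit Types (I : quat R) (z h : R * R) (f : quat R -> quat R).

Let slice_linear I : linear (slice I).
Proof. by move=> a z w; rewrite sliceD sliceZ. Qed.
HB.instance Definition _ I := GRing.isLinear.Build R (R * R)%type (quat R)
  *:%R (slice I) (slice_linear I).

Lemma slice_differentiable I z : differentiable (slice I) z.
Proof. by apply: linear_differentiable; exact: slice_continuous. Qed.

(** By the Cauchy--Riemann equation, this partial derivative determines the
    whole derivative of [f] on the slice: see [slice_regular_diff]. *)
Definition slice_deriv I f z : quat R := 'D_(1, 0) (f \o slice I) z.

Lemma slice_regular_diff (Om : set (quat R)) f I z h :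
  slice_regular Om f -> imag_unit I -> Om (slice I z) ->
  differentiable (f \o slice I) z /\
  'd (f \o slice I) z h = slice I h * slice_deriv I f z.
Proof.
move=> [df cr] hI Oz.
have dfI : differentiable (f \o slice I) z.
  by apply: differentiable_comp; [exact: slice_differentiable|exact: df].
split=> //; have [_ _ _ _] := cr I hI z Oz.
have -> : h = h.1 *: (1, 0) + h.2 *: (0, 1).
  by case: h => a b; congr pair; rewrite /= ?scaler0 ?addr0 ?add0r /GRing.scale /= mulr1.
rewrite linearD !linearZ /= -!deriveE// -/(slice_deriv I f z) => /eqP.
rewrite addr_eq0 => /eqP fx.
have -> : 'D_(0, 1) (f \o slice I) z = I * slice_deriv I f z.
  by rewrite fx mulrN mulrA hI mulN1r opprK.
rewrite sliceD !sliceZ slice1 mulrDl -scalerAl mul1r; congr (_ + _).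
by rewrite /slice /= scale0r add0r scale1r scalerAl.
Qed.

Lemma is_derive_slice_line (Om : set (quat R)) f I z h (t : R) l :
  slice_regular Om f -> imag_unit I -> Om (slice I (z + t *: h)) ->
  is_derive t 1 (fun u : R => f (slice I (z + u *: h)) 0 l)
    ((slice I h * slice_deriv I f (z + t *: h)) 0 l).
Proof.
move=> hf hI Ot; have [dfI dfE] := slice_regular_diff h hf hI Ot.
pose F u : 'rV[R]_4 := f (slice I (z + u *: h)).
have quotE : (fun u : R => u^-1 *: ((F \o shift t) (u *: 1) - F t)) =
    (fun u : R => u^-1 *: (((f \o slice I) \o shift (z + t *: h)) (u *: h)
                          - (f \o slice I) (z + t *: h))).
  apply/funext => u /=; rewrite /F /= [u *: 1]mulr1 scalerDl.
  by rewrite addrCA.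
have dF : derivable F t 1.
  rewrite /derivable quotE; exact: diff_derivable.
have DF : 'D_1 F t = slice I h * slice_deriv I f (z + t *: h).
  by rewrite -dfE -deriveE; [rewrite /derive quotE|exact: dfI].
split; first by have /derivable_mxP/(_ 0 l) := dF.
by rewrite -DF derive_mx// mxE.
Qed.

Definition cdisc (s : R) : set (R * R) := [set z | z.1 ^+ 2 + z.2 ^+ 2 <= s ^+ 2].

Lemma cdiscP I z s : imag_unit I -> 0 <= s ->
  cdisc s z <-> qmod (slice I z) <= s.
Proof.
by move=> hI s0; rewrite /cdisc /= -(qmod_slice _ hI) ler_pXn2r ?nnegrE//; split.
Qed.

Lemma cdisc_compact (s : R) : 0 <= s -> compact (cdisc s).
Proof.
move=> s0.
have cD : closed (cdisc s).
  rewrite (_ : cdisc s = (fun z : R * R => z.1 ^+ 2 + z.2 ^+ 2) @^-1` [set x | x <= s ^+ 2])//.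
  apply: closed_comp; last exact: closed_le.
  move=> z _; apply: cvgD.
    exact: (cvgM (cvg_fst (F := nbhs z.1)) (cvg_fst (F := nbhs z.1))).
  exact: (cvgM (cvg_snd (F := nbhs z.1)) (cvg_snd (F := nbhs z.1))).
apply: (subclosed_compact cD
  (compact_setX (segment_compact (a := - s) (b := s)) (segment_compact (a := - s) (b := s)))).
move=> z zs; have h (x y : R) : x ^+ 2 + y ^+ 2 <= s ^+ 2 -> x \in `[- s, s].
  move=> xy; rewrite in_itv /= -ler_norml.
  rewrite -(@ler_pXn2r _ 2) ?nnegrE// real_normK ?num_real//.
  by rewrite (le_trans _ xy)// lerDl sqr_ge0.
by split=> /=; [exact: h zs|apply: (h _ z.1); rewrite addrC; exact: zs].
Qed.

Lemma norm_le_qmod_slice I z : imag_unit I -> `|z| <= qmod (slice I z).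
Proof.
move=> hI; have h (x y : R) : `|x| <= Num.sqrt (x ^+ 2 + y ^+ 2).
  by rewrite -sqrtr_sqr ler_wsqrtr// lerDl sqr_ge0.
have -> : qmod (slice I z) = Num.sqrt (z.1 ^+ 2 + z.2 ^+ 2).
  by rewrite -(qmod_slice _ hI) sqrtr_sqr ger0_norm.
by rewrite /Num.norm /= ge_max h/= [X in Num.sqrt X]addrC h.
Qed.

Section UniformExpansion.
Variables (s0 : R) (f : quat R -> quat R) (I : quat R).
Hypotheses (hf : slice_regular (qball s0) f) (hI : imag_unit I).
Local Notation g' := (slice_deriv I f).

(** Continuity at every point of the compact disc, made uniform by Heine's
    argument; [y] is allowed to leave the disc. *)
Lemma slice_deriv_unif (s e : R) : 0 <= s < s0 -> 0 < e ->
  exists2 d, 0 < d & forall z y, cdisc s z -> `|y - z| < d ->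
    qmod (g' y - g' z) < e.
Proof.
move=> /andP[s_ge0 s0s] e0.
pose P (d : R) z := forall y, `|y - z| < d -> qmod (g' y - g' z) < e.
have : \forall d \near 0^'+, cdisc s `<=` P d.
  apply: ((compact_near_coveringP _).1 (cdisc_compact s_ge0) _ 0^'+ P).
  move=> x xs; have Ox : qball s0 (slice I x).
    by apply: le_lt_trans s0s; apply/(cdiscP _ hI s_ge0).
  have [_ _ cg _ _] := hf.2 I hI x Ox.
  have /cvg_qmodP/cvgrPdist_lt/(_ (e / 2)) := cg.
  rewrite divr_gt0// => /(_ isT) /nbhs_ballP[r /= r0 hr].
  have {}hr y : `|x - y| < r -> qmod (g' y - g' x) < e / 2.
    move=> xy; have := hr y; rewrite /= sub0r normrN ger0_norm//; apply.
    by rewrite -ball_normE.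
  near=> x' d => y yx'.
  have x'r : `|x - x'| < r / 2 by near: x'; apply: cvgr_dist_lt => //; rewrite divr_gt0.
  have dr : d < r / 2 by near: d; apply: nbhs_right_lt; rewrite divr_gt0.
  rewrite (_ : g' y - g' x' = (g' y - g' x) + (g' x - g' x')); last by rewrite addrA subrK.
  rewrite (le_lt_trans (qmodD _ _))// (splitr e) ltrD//.
    apply: hr; rewrite (_ : x - y = (x - x') - (y - x')); last by rewrite opprB addrA subrK.
    rewrite (le_lt_trans (ler_normB _ _))// (splitr r) ltrD//.
    exact: lt_trans dr.
  by rewrite qmodC hr// (lt_trans x'r)// ltr_pdivrMr// ltr_pMr// ltr1n.
move=> dP; have : \forall d \near 0^'+, (0 : R) < d /\ cdisc s `<=` P d.
  by apply: filterS2 (nbhs_right_gt (0 : R)) dP.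
move=> /filter_ex[d [d0 dP']]; exists d => // z y zs yz; exact: (dP' z zs y yz).
Unshelve. all: by end_near. Qed.

(** The mean value theorem on the segment from [z] to [z + h], coordinate by
    coordinate. *)
Lemma slice_expansion_unif (s e : R) : 0 <= s < s0 -> 0 < e ->
  exists2 d, 0 < d & forall z h, cdisc s z -> cdisc s (z + h) ->
    qmod (slice I h) < d ->
    qmod (f (slice I (z + h)) - f (slice I z) - slice I h * g' z) <=
      e * qmod (slice I h).
Proof.
move=> hs e0; have /andP[s_ge0 s0s] := hs.
have e20 : 0 < e / 2 by rewrite divr_gt0.
have [d d0 hd] := slice_deriv_unif hs e20; exists d => // z h zs zhs hlt.
apply: (le_trans (qmod_le_norm _)); rewrite mulrC -ler_pdivlMr// mulrAC.
rewrite /Num.norm /= mx_normrE; apply: bigmax_le => [|[i l] _ /=].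
  by rewrite mulr_ge0// ltW.
rewrite ord1.
have seg (t : R) : 0 <= t <= 1 -> qmod (slice I (z + t *: h)) <= s.
  move=> /andP[t0 t1]; rewrite (_ : z + t *: h = (1 - t) *: z + t *: (z + h)); last first.
    by rewrite scalerDr addrA -scalerDl subrK scale1r.
  rewrite sliceD !sliceZ (le_trans (qmodD _ _))// !qmodZ !ger0_norm ?subr_ge0//.
  move/(cdiscP _ hI s_ge0) : zs => zs; move/(cdiscP _ hI s_ge0) : zhs => zhs.
  rewrite -[leRHS](_ : (1 - t) * s + t * s = s); last by rewrite -mulrDl subrK mul1r.
  apply: lerD; last exact: ler_wpM2l.
  by apply: ler_wpM2l => //; rewrite subr_ge0.
pose F (t : R) := f (slice I (z + t *: h)) 0 l.
have dF (t : R) : t \in `[0, 1] ->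
    is_derive t 1 F ((slice I h * g' (z + t *: h)) 0 l).
  rewrite in_itv /= => /seg ht; apply: (@is_derive_slice_line (qball s0)) => //.
  exact: le_lt_trans ht s0s.
pose dfun (c : R) : R := (slice I h * g' (z + c *: h)) 0 l.
have [c c01] : exists2 c : R, c \in `[0, 1] & F 1 - F 0 = dfun c * (1 - 0).
  have d1 (x : R) : x \in `]0, 1[ -> is_derive x 1 F (dfun x).
    by move=> x01; apply: dF; exact: subset_itv_oo_cc x01.
  have d2 : {within `[0, 1], continuous F}.
    apply: derivable_within_continuous => x x01; have [dx _] := dF x x01.
    exact: dx.
  exact: MVT_segment ler01 d1 d2.
rewrite /dfun /F scale1r scale0r addr0 subr0 mulr1 => Fc.
have -> : (f (slice I (z + h)) - f (slice I z) - slice I h * g' z) 0 l =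
    (slice I h * (g' (z + c *: h) - g' z)) 0 l.
  by rewrite mulrBr quatDE [X in X + _]quatDE quatNE Fc !quatDE.
rewrite (le_trans (qcoord_le _ _))// qmodM mulrC ler_wpM2r// ltW// hd//.
rewrite [z + _]addrC addrK normrZ (le_lt_trans _ hlt)//.
rewrite (le_trans _ (norm_le_qmod_slice _ hI))// ler_piMl//.
by move: c01; rewrite in_itv /= => /andP[c0 c1]; rewrite ger0_norm.
Qed.

End UniformExpansion.
End SliceDerivative.

(** * Roots of unity in a slice *)

Section RootsOfUnity.
Context {R : realType}.
Implicit Types (I : quat R) (a : R).

Definition cis I a : quat R := slice I (cos a, sin a).

Lemma cis0 I : cis I 0 = 1.
Proof. by rewrite /cis cos0 sin0 slice1. Qed.

Lemma cisD I a b : imag_unit I -> cis I (a + b) = cis I a * cis I b.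
Proof.
by move=> hI; rewrite /cis sliceM//= cosD sinD; congr (slice I (_, _)); ring.
Qed.

Lemma cisMn I a n : imag_unit I -> cis I (a *+ n) = cis I a ^+ n.
Proof.
move=> hI; elim: n => [|n ih]; first by rewrite mulr0n cis0 expr0.
by rewrite mulrS cisD// ih exprS.
Qed.

Lemma qmod_cis I a : imag_unit I -> qmod (cis I a) = 1.
Proof.
by move=> hI; apply: qmod_eqP => //; rewrite qmod_slice//= cos2Dsin2 expr1n.
Qed.

Lemma cisNK I a : imag_unit I -> cis I a * cis I (- a) = 1.
Proof. by move=> hI; rewrite -cisD// subrr cis0. Qed.

Lemma cis_neq1 I a : imag_unit I -> 0 < a < pi *+ 2 -> cis I a != 1.
Proof.
move=> hI /andP[a0 a2]; apply/eqP => c1.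
have s0 : sin a = 0 /\ cos a = 1.
  have : qmod (slice I (cos a - 1, sin a)) ^+ 2 = 0.
    rewrite (_ : (_, _) = (cos a, sin a) + (-1) *: (1, 0)); last first.
      by congr pair; rewrite /= /GRing.scale /= ?mulr0 ?mulr1 ?addr0.
    by rewrite sliceD sliceZ slice1 scaleN1r -/(cis I a) c1 subrr qmod0 expr0n.
  rewrite qmod_slice//= => /eqP; rewrite paddr_eq0 ?sqr_ge0// !sqrf_eq0.
  by move=> /andP[/eqP c /eqP ->]; split => //; apply/eqP; rewrite -subr_eq0 c.
have [api|api|api] := ltgtP a pi.
- by have := sin_gt0_pi (introT andP (conj a0 api)); rewrite s0.1 ltxx.
- have : 0 < sin (a - pi).
    by apply: sin_gt0_pi; rewrite subr_gt0 api /= ltrBlDr -mulr2n.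
  by rewrite -opprB sinN sinB sinpi cospi s0.1 mul0r mulr0 subrr oppr0 ltxx.
- have := s0.2; rewrite api cospi => /eqP.
  by rewrite eq_sym -subr_eq0 opprK -mulr2n pnatr_eq0.
Qed.

Lemma sum_expr_root_unity (x : quat R) N : x ^+ N = 1 -> x != 1 ->
  \sum_(k < N) x ^+ k = 0.
Proof.
move=> xN x1; have := subrX1 x N; rewrite xN subrr => /(congr1 (@qmod R)).
rewrite qmod0 qmodM => /esym/eqP; rewrite mulf_eq0 gt_eqF/=; last first.
  by rewrite qmod_gt0// subr_eq0.
by move=> /eqP h; apply/eqP; apply: contraT => /qmod_gt0; rewrite h ltxx.
Qed.

Definition root_angle N : R := pi *+ 2 / N%:R.

Lemma root_angle_cvg0 : root_angle N @[N --> \oo] --> (0 : R).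
Proof.
rewrite -(mulr0 (pi *+ 2)); apply: cvgMr.
by apply/gtr0_cvgV0; [near=> n; rewrite ltr0n; near: n; exact: nbhs_infty_gt|exact: cvgr_idn].
Unshelve. all: by end_near. Qed.

Lemma root_angleMn N : (0 < N)%N -> root_angle N *+ N = pi *+ 2.
Proof. by move=> N0; rewrite /root_angle -[LHS]mulr_natr divfK// pnatr_eq0 -lt0n. Qed.

Lemma cisN_root I N : imag_unit I -> (0 < N)%N -> cis I (- root_angle N) ^+ N = 1.
Proof.
move=> hI N0; rewrite -cisMn// mulNrn root_angleMn// /cis cosN sinN cos2pi sin2pi.
by rewrite oppr0 slice1.
Qed.

Lemma cisN_rootX_neq1 I N n : imag_unit I -> (0 < n < N)%N ->
  cis I (- root_angle N) ^+ n != 1.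
Proof.
move=> hI /andP[n0 nN].
have N0 : (0 < N)%N by exact: leq_trans nN.
have : cis I (root_angle N *+ n) != 1.
  apply: cis_neq1 => //; rewrite /root_angle -[_ *+ n]mulr_natr.
  have p0 : 0 < (pi : R) *+ 2 by rewrite pmulrn_rgt0// pi_gt0.
  apply/andP; split; first by rewrite mulr_gt0// ?ltr0n// divr_gt0// ltr0n.
  by rewrite mulrAC ltr_pdivrMr ?ltr0n// ltr_pM2l// ltr_nat.
rewrite -cisMn// mulNrn; apply: contra => /eqP h.
by have := cisNK (root_angle N *+ n) hI; rewrite h mulr1 => ->.
Qed.

Lemma cis_root_cvg1 I : imag_unit I ->
  cis I (root_angle N) @[N --> \oo] --> (1 : quat R).
Proof.
move=> hI; rewrite -(cis0 I).
have cc : cos (root_angle N) @[N --> \oo] --> cos (0 : R).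
  exact: (continuous_cvg _ (@continuous_cos R 0) root_angle_cvg0).
have cs : sin (root_angle N) @[N --> \oo] --> sin (0 : R).
  exact: (continuous_cvg _ (@continuous_sin R 0) root_angle_cvg0).
have /= := @continuous_cvg _ _ _ \oo _ (fun N => (cos (root_angle N), sin (root_angle N)))
  (slice I) (cos 0, sin 0) (@slice_continuous _ I _) (cvg_pair cc cs).
exact.
Qed.

End RootsOfUnity.

(** * A discrete Cauchy formula *)

Section LinearCoordinates.
Context {R : realType}.

Lemma quat_linear_coord (L : quat R -> quat R) (q : quat R) l : linear L ->
  (L q) 0 l = \sum_(m < 4) q 0 m * (L (delta_mx 0 m)) 0 l.
Proof.
move=> hL.
have LD p p' : L (p + p') = L p + L p' by have := hL 1 p p'; rewrite !scale1r.
have L0 : L 0 = 0 by apply: (@addrI _ (L 0)); rewrite -LD !addr0.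
have LZ a p : L (a *: p) = a *: L p by have := hL a p 0; rewrite !addr0 L0 addr0.
have -> : L q = \sum_(m < 4) q 0 m *: L (delta_mx 0 m).
  rewrite {1}[q]row_sum_delta; elim/big_rec2 : _ => [//|m x y _ <-].
  by rewrite LD LZ.
by rewrite summxE; apply: eq_bigr => m _; rewrite mxE.
Qed.

Lemma linear_mulql (p : quat R) : linear (fun q : quat R => p * q).
Proof. by move=> a q q'; rewrite mulrDr scalerAr. Qed.

(** Stated by coordinates because the mean value theorem is for real functions. *)
Lemma is_derive_qmull (p : quat R) (F : R -> quat R) (dF : quat R) (t : R) :
  (forall l, is_derive t 1 (fun u => F u 0 l) (dF 0 l)) ->
  forall l, is_derive t 1 (fun u => (p * F u) 0 l) ((p * dF) 0 l).
Proof.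
move=> h l; rewrite (quat_linear_coord dF l (linear_mulql p)).
have -> : (fun u => (p * F u) 0 l) =
    \sum_(m < 4) (fun u => F u 0 m * (p * delta_mx 0 m) 0 l).
  apply/funext => u; rewrite (quat_linear_coord (F u) l (linear_mulql p)).
  by rewrite fct_sumE.
apply: is_derive_sum => m.
apply: (is_derive_eq (is_deriveM (h m) (is_derive_cst _ _ _))).
by rewrite scaler0 add0r /GRing.scale /= mulrC.
Qed.

End LinearCoordinates.

Section Cauchy.
Context {R : realType}.
Variables (s0 s : R) (f : quat R -> quat R) (I : quat R).
Hypotheses (hf : slice_regular (qball s0) f) (hI : imag_unit I).
Hypotheses (s_gt0 : 0 < s) (ss0 : s < s0).
Let s_ge0 : 0 <= s := ltW s_gt0.
Let hs : 0 <= s < s0. Proof. by rewrite s_ge0. Qed.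
Local Notation g' := (slice_deriv I f).

Let pt N k : R * R :=
  s *: (cos (root_angle N *+ k), sin (root_angle N *+ k)).

Let slice_pt N k : slice I (pt N k) = s *: cis I (root_angle N) ^+ k.
Proof. by rewrite /pt sliceZ -/(cis I _) cisMn. Qed.

(** The trapezoidal approximation, with [N] nodes on the circle of radius [s],
    of the [n]-th Taylor coefficient of [f]. *)
Definition dcoef N n : quat R := (s ^- n / N%:R) *:
  \sum_(k < N) cis I (- root_angle N) ^+ (k * n) *
     f (s *: cis I (root_angle N) ^+ k).

Section Center.
Variable (z0 : R * R).
Hypothesis (z0s : qmod (slice I z0) < s).
Let q0 := slice I z0.

(** The segments from [z0] to the nodes. *)
Let gam N k (t : R) : R * R := z0 + t *: (pt N k - z0).

Let qmod_gam N k t : 0 <= t <= 1 -> qmod (slice I (gam N k t)) <= s.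
Proof.
move=> /andP[t0 t1]; rewrite (_ : gam N k t = (1 - t) *: z0 + t *: pt N k); last first.
  by rewrite /gam scalerBr scalerBl scale1r addrA addrAC.
rewrite sliceD (sliceZ _ _ z0) (sliceZ _ _ (pt N k)) (le_trans (qmodD _ _))//.
rewrite qmodZ (qmodZ t) !ger0_norm ?subr_ge0// slice_pt qmodZ qmodX qmod_cis// expr1n mulr1 (ger0_norm s_ge0).
rewrite -[leRHS](_ : (1 - t) * s + t * s = s); last by rewrite -mulrDl subrK mul1r.
by rewrite lerD2r; apply: ler_wpM2l; [rewrite subr_ge0|exact: ltW].
Qed.

Let gam_cdisc N k t : 0 <= t <= 1 -> cdisc s (gam N k t).
Proof. by move=> t01; apply/(cdiscP _ hI s_ge0); exact: qmod_gam. Qed.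

Let gam_ball N k t : 0 <= t <= 1 -> qball s0 (slice I (gam N k t)).
Proof. by move=> t01; apply: le_lt_trans ss0; exact: qmod_gam. Qed.

(** Up to the error of the first order expansion, the increments of [f] along
    the polygon of the [gam N k t] are proportional to the terms of this sum,
    and they add up to zero. *)
Lemma deriv_mean_small (e : R) : 0 < e ->
  \forall N \near \oo, forall t : R, 0 < t <= 1 ->
    qmod (\sum_(k < N) cis I (root_angle N) ^+ k * g' (gam N k t)) <= N%:R * e.
Proof.
move=> e0; have [d d0 hd] := slice_expansion_unif hf hI hs e0.
have sd0 : 0 < d / s by rewrite divr_gt0.
have /cvg_qmodP/cvgrPdist_lt/(_ _ sd0) := cis_root_cvg1 hI.
move=> hw; near=> N => t /andP[t0 t1].
have N1 : (1 < N)%N by near: N; exact: nbhs_infty_gt.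
have N0 : (0 < N)%N by exact: ltnW.
have w1 : qmod (cis I (root_angle N) - 1) < d / s.
  by near: N; move: hw; apply: filterS => n; rewrite sub0r normrN ger0_norm.
set w := cis I (root_angle N) in w1 *.
have w_neq1 : 0 < qmod (w - 1).
  rewrite qmod_gt0// subr_eq0; apply: contraTneq (cisN_rootX_neq1 (n := 1) hI (introT andP (conj isT N1))).
  by rewrite expr1 negbK => w1e; have := cisNK (root_angle N) hI; rewrite -/w w1e mul1r => ->.
have t01 : 0 <= t <= 1 by rewrite t1 ltW.
pose F k := f (slice I (gam N k t)).
pose h k : R * R := t *: (pt N k.+1 - pt N k).
have gamS k : gam N k.+1 t = gam N k t + h k.
  rewrite /gam /h -addrA -scalerDr; congr (_ + _ *: _).
  by rewrite [RHS]addrC addrA subrK.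
have hE k : slice I (h k) = (t * s) *: (w ^+ k * (w - 1)).
  rewrite sliceZ -scalerA sliceB !slice_pt -/w; congr (_ *: _).
  by rewrite -scalerBr exprSr mulrBr mulr1.
have qh k : qmod (slice I (h k)) = t * s * qmod (w - 1).
  rewrite hE qmodZ qmodM qmodX qmod_cis// expr1n mul1r ger0_norm//.
  by rewrite mulr_ge0// ltW.
have Ferr k : qmod (F k.+1 - F k - slice I (h k) * g' (gam N k t)) <=
    e * (t * s * qmod (w - 1)).
  rewrite -(qh k) /F gamS; apply: hd.
  - exact: gam_cdisc.
  - by rewrite -gamS; exact: gam_cdisc.
  - rewrite qh (le_lt_trans _ (_ : s * qmod (w - 1) < d))//.
      by rewrite ler_wpM2r// ler_piMl.
    by rewrite mulrC -ltr_pdivlMr.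
have tele : \sum_(k < N) (F k.+1 - F k) = 0.
  have ptN : pt N N = pt N 0.
    by rewrite /pt root_angleMn// mulr0n cos2pi sin2pi cos0 sin0.
  rewrite -(big_mkord predT (fun k => F k.+1 - F k)) telescope_sumr//.
  by rewrite /F /gam ptN subrr.
set S := \sum_(k < N) _.
have tsw : 0 < t * s * qmod (w - 1) by rewrite !mulr_gt0.
have SE : (t * s) *: ((w - 1) * S) =
    - \sum_(k < N) (F k.+1 - F k - slice I (h k) * g' (gam N k t)).
  rewrite sumrB tele sub0r opprK /S mulr_sumr scaler_sumr.
  apply: eq_bigr => k _; rewrite hE -scalerAl mulrA; congr (_ *: (_ * _)).
  by rewrite mulrBl mulrBr mul1r mulr1 -exprSr -exprS.
rewrite -(ler_pM2l tsw) mulrCA.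
have -> : t * s * qmod (w - 1) * qmod S = qmod ((t * s) *: ((w - 1) * S)).
  by rewrite qmodZ qmodM ger0_norm ?mulr_ge0// ?(ltW t0)// mulrA.
rewrite SE qmodN (le_trans (qmod_sum _))//.
rewrite (le_trans (ler_sum _ (fun (k : 'I_N) _ => Ferr k)))//.
rewrite sumr_const card_ord -mulr_natl mulr1 le_eqVlt; apply/orP; left; apply/eqP.
by move: (qmod (w - 1)) => x; ring.
Unshelve. all: by end_near. Qed.

(** The truncated geometric series of the Cauchy kernel at the [k]-th node. *)
Let P N k : quat R :=
  \sum_(n < N) (s^-1 *: (q0 * cis I (- root_angle N) ^+ k)) ^+ n.

Let comm_q0_cis a n : q0 * cis I a ^+ n = cis I a ^+ n * q0.
Proof. by rewrite -cisMn// /q0 /cis slice_comm. Qed.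

Let P_expand N k : P N k =
  \sum_(n < N) s ^- n *: (q0 ^+ n * cis I (- root_angle N) ^+ (k * n)).
Proof.
apply: eq_bigr => n _; rewrite exprZn exprMn_comm ?exprVn -?exprM//.
Qed.

(** As in the scalar case, since [q0] and the nodes lie in the same slice. *)
Let P_mul N k : (0 < N)%N -> P N k * (s *: cis I (root_angle N) ^+ k - q0) =
  (1 - s ^- N *: q0 ^+ N) * (s *: cis I (root_angle N) ^+ k).
Proof.
move=> N0; set w := cis I _; set u := s^-1 *: (q0 * cis I (- root_angle N) ^+ k).
have uw : u * (s *: w ^+ k) = q0.
  rewrite /u -scalerAl -scalerAr scalerA mulVf ?gt_eqF// scale1r -mulrA.
  rewrite -!cisMn// -/w -cisD// mulNrn addNr cis0 mulr1//.
have -> : s *: w ^+ k - q0 = (1 - u) * (s *: w ^+ k).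
  by rewrite mulrBl mul1r uw.
rewrite mulrA; congr (_ * _).
have uN : u ^+ N = s ^- N *: q0 ^+ N.
  rewrite /u exprZn exprMn_comm; last exact: comm_q0_cis.
  by rewrite exprVn -exprM mulnC exprM cisN_root// expr1n mulr1.
rewrite -uN -(opprB u 1) mulrN -(opprB _ 1) subrX1; congr (- _).
rewrite -/(P N k) /P -/u mulr_suml mulr_sumr; apply: eq_bigr => n _.
by rewrite mulrBl mulrBr mul1r mulr1 -exprS -exprSr.
Qed.

Let sum_P N : (0 < N)%N -> \sum_(k < N) P N k = N%:R%:A.
Proof.
move=> N0; under eq_bigr do rewrite P_expand.
rewrite exchange_big /= (bigD1 (Ordinal N0))//= [X in _ + X]big1 ?addr0.
  under eq_bigr do rewrite muln0 expr0 expr0 mulr1 invr1 scale1r.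
  by rewrite sumr_const card_ord scaler_nat.
move=> n n0; rewrite -scaler_sumr -mulr_sumr.
under eq_bigr do rewrite mulnC exprM.
rewrite sum_expr_root_unity ?mulr0 ?scaler0//.
- by rewrite -exprM mulnC exprM cisN_root// expr1n.
- apply: cisN_rootX_neq1 => //; rewrite ltn_ord andbT lt0n.
  by apply: contra n0 => /eqP n0; exact/eqP/val_inj.
Qed.

(** Cauchy's integral formula, with the integral replaced by a sum over the
    [N]-th roots of unity. Contracting the circle to [z0], the sum of the
    [P N k * f (gam N k t)] is exactly [N * f q0] at [t = 0], is [N] times
    the polynomial with coefficients [dcoef] at [t = 1], and has in between a
    derivative that is small compared to [N]. *)
Lemma discrete_cauchy :
  \sum_(n < N) q0 ^+ n * dcoef N n @[N --> \oo] --> f q0.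
Proof.
apply/cvg_qmodP/cvgrPdist_le => e e0.
have e1 : 0 < e / (4 * s) by rewrite divr_gt0// mulr_gt0.
have hS := deriv_mean_small e1.
near=> N.
have N0 : (0 < N)%N by near: N; exact: nbhs_infty_gt.
have NR0 : 0 < N%:R :> R by rewrite ltr0n.
have hS' (t : R) : 0 < t <= 1 ->
    qmod (\sum_(k < N) cis I (root_angle N) ^+ k * g' (gam N k t)) <= N%:R * (e / (4 * s)).
  by move: t; near: N; exact: hS.
set w := cis I (root_angle N) in hS' *.
rewrite sub0r normrN ger0_norm//.
pose phi (t : R) : quat R := N%:R^-1 *: \sum_(k < N) P N k * f (slice I (gam N k t)).
have phi1 : phi 1 = \sum_(n < N) q0 ^+ n * dcoef N n.
  rewrite /phi; under eq_bigr => k _.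
    rewrite (_ : gam N k 1 = pt N k); last by rewrite /gam scale1r addrC subrK.
    rewrite slice_pt P_expand mulr_suml.
    over.
  rewrite exchange_big scaler_sumr /=; apply: eq_bigr => n _.
  rewrite /dcoef -scalerAr mulrC -scalerA; congr (_ *: _).
  rewrite mulr_sumr scaler_sumr; apply: eq_bigr => k _.
  by rewrite -scalerAl mulrA.
have phi0 : phi 0 = f q0.
  rewrite /phi; under eq_bigr => k _.
    rewrite (_ : gam N k 0 = z0); last by rewrite /gam scale0r addr0.
    over.
  by rewrite -mulr_suml sum_P// -scalerAl mul1r scalerA mulVf ?gt_eqF// scale1r.
pose dphi (t : R) : quat R := (1 - s ^- N *: q0 ^+ N) *
  ((s / N%:R) *: \sum_(k < N) w ^+ k * g' (gam N k t)).
have dphiP (t : R) l : t \in `[0, 1] ->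
    is_derive t 1 (fun u => phi u 0 l) (dphi t 0 l).
  rewrite in_itv /= => t01.
  have -> : (fun u => phi u 0 l) = N%:R^-1 \*: \sum_(k < N) (fun u => (P N k * f (slice I (gam N k u))) 0 l).
    by apply/funext => u; rewrite /phi mxE summxE /= fct_sumE.
  have -> : dphi t = N%:R^-1 *: \sum_(k < N)
      (P N k * (slice I (pt N k - z0) * g' (gam N k t))).
    rewrite /dphi.
    rewrite -scalerAr mulrC -scalerA; congr (_ *: _); rewrite mulr_sumr scaler_sumr.
    apply: eq_bigr => k _; rewrite mulrA.
    rewrite sliceB slice_pt -/q0 P_mul// -/w.
    by rewrite -scalerAr -scalerAl mulrA.
  rewrite quatZE summxE -[_^-1 * _]/(_^-1 *: _).
  apply: is_deriveZ; apply: is_derive_sum => k; apply: is_derive_qmull => m.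
  by apply: (is_derive_slice_line _ hf) => //; exact: gam_ball.
have q0N : qmod (1 - s ^- N *: q0 ^+ N) <= 2.
  rewrite (le_trans (qmodB _ _))// qmod1 qmodZ qmodX -[2]/(1 + 1) lerD2l.
  rewrite ger0_norm ?invr_ge0 ?exprn_ge0// mulrC ler_pdivrMr ?exprn_gt0// mul1r.
  by rewrite lerXn2r ?nnegrE// ltW.
have dphi_small (t : R) : 0 < t <= 1 -> qmod (dphi t) <= e / 2.
  move=> t01; rewrite /dphi qmodM qmodZ ger0_norm; last by rewrite divr_ge0// ltW.
  rewrite (_ : e / 2 = 2 * ((s / N%:R) * (N%:R * (e / (4 * s))))); last first.
    by field; rewrite !gt_eqF.
  apply: ler_pM => //; first by rewrite mulr_ge0// divr_ge0// ltW.
  by apply: ler_wpM2l; [rewrite divr_ge0// ltW|exact: hS'].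
rewrite -phi1 -phi0 (le_trans (qmod_le_norm _))// mulrC -ler_pdivlMr//.
rewrite /Num.norm /= mx_normrE; apply: bigmax_le => [|[i l] _ /=].
  by rewrite divr_ge0// ltW.
rewrite ord1.
have [c c01] : exists2 c : R, c \in `]0, 1[ & phi 1 0 l - phi 0 0 l = dphi c 0 l * (1 - 0).
  have d1 (x : R) : x \in `]0, 1[ -> is_derive x 1 (fun u => phi u 0 l) (dphi x 0 l).
    by move=> x01; apply: dphiP; exact: subset_itv_oo_cc x01.
  have d2 : {within `[0, 1], continuous (fun u : R => phi u 0 l)}.
    apply: derivable_within_continuous => x x01; have [dx _] := dphiP x l x01.
    exact: dx.
  exact: MVT ltr01 d1 d2.
rewrite subr0 mulr1 quatDE quatNE => ->; rewrite (le_trans (qcoord_le _ _))//.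
by apply: dphi_small; move: c01; rewrite in_itv /= => /andP[-> /ltW ->].
Unshelve. all: by end_near. Qed.

End Center.
End Cauchy.

(** * Taylor expansion of slice regular functions *)

(** Limits along an ultrafilter replace the extraction of a convergent
    subsequence for each coefficient. *)
Lemma ultra_fmap (T V : Type) (f : T -> V) (U : set_system T) :
  UltraFilter U -> UltraFilter (f @ U).
Proof.
move=> FU; split; first exact: fmap_proper_filter.
move=> G GF fUG; rewrite predeqE => A; split; last exact: fUG.
move=> GA; have [//|fA] := in_ultra_setVsetC (f @^-1` A) FU.
have GnA : G (~` A) by exact: fUG.
by have /filter_ex[? []] : G (A `&` ~` A) by exact: filterI.
Qed.

Lemma geometric_tail_le {R : realType} (x : R) K N : 0 <= x < 1 ->
  \sum_(K <= n < N) x ^+ n <= x ^+ K / (1 - x).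
Proof.
move=> /andP[x0 x1]; have x10 : 0 < 1 - x by rewrite subr_gt0.
rewrite ler_pdivlMr//; have [NK|KN] := leqP N K.
  by rewrite big_geq// mul0r exprn_ge0.
have -> : (\sum_(K <= n < N) x ^+ n) * (1 - x) = x ^+ K - x ^+ N.
  rewrite -[RHS]opprB -(telescope_sumr (fun n => x ^+ n))// 1?ltnW//.
  rewrite mulr_suml -sumrN; apply: eq_bigr => n _.
  by rewrite mulrBr mulr1 opprB -exprSr.
by rewrite gerBl exprn_ge0.
Qed.

Section TaylorSlice.
Context {R : realType}.
Variables (s0 s : R) (f : quat R -> quat R) (I : quat R).
Hypotheses (hf : slice_regular (qball s0) f) (hI : imag_unit I).
Hypotheses (s_gt0 : 0 < s) (ss0 : s < s0).

Lemma slice_bounded_cdisc : exists2 M, 0 <= M & forall z, cdisc s z ->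
  qmod (f (slice I z)) <= M.
Proof.
have s_ge0 := ltW s_gt0.
have cf : {within cdisc s, continuous (f \o slice I)}.
  apply: continuous_in_subspaceT => z; rewrite inE => /(cdiscP _ hI s_ge0) zs.
  apply: differentiable_continuous.
  by have [] := slice_regular_diff 0 hf hI (le_lt_trans zs ss0).
have [M hM] : exists M : R, forall q, ((f \o slice I) @` cdisc s) q -> `|q| <= M.
  have := compact_bounded (continuous_compact cf (cdisc_compact s_ge0)).
  by move=> [M [_ hM]]; exists (M + 1); apply: hM; rewrite ltrDl.
exists (2 * `|M|); first by rewrite mulr_ge0.
move=> z zs; apply: (le_trans (qmod_le_norm _)); rewrite ler_pM2l//.
apply: (le_trans _ (ler_norm M)); apply: hM; by exists z.
Qed.

(** The [dcoef s f I N n] satisfy Cauchy's estimates uniformly in [N], hence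
    converge to some [a n] along an ultrafilter finer than [\oo]. The estimates
    also bound the tails of the sums in [discrete_cauchy] by a geometric series,
    so that the limit can be taken under the sum. *)
Lemma taylor_slice : exists a : nat -> quat R, exists M : R,
  (forall n, qmod (a n) <= M * s ^- n) /\
  (forall z, qmod (slice I z) < s ->
    \sum_(n < K) slice I z ^+ n * a n @[K --> \oo] --> f (slice I z)).
Proof.
have s_ge0 := ltW s_gt0.
have [M M0 hM] := slice_bounded_cdisc.
have dM N n : qmod (dcoef s f I N n) <= M * s ^- n.
  have [->|N0] := posnP N.
    rewrite /dcoef big_ord0 scaler0 qmod0 mulr_ge0// invr_ge0 exprn_ge0//.
  have NR : 0 < N%:R :> R by rewrite ltr0n.
  rewrite /dcoef qmodZ ger0_norm ?divr_ge0// ?invr_ge0 ?exprn_ge0//.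
  rewrite [leRHS]mulrC -mulrA; apply: ler_wpM2l; first by rewrite invr_ge0 exprn_ge0.
  rewrite mulrC ler_pdivrMr// (le_trans (qmod_sum _))//.
  have h (k : 'I_N) : true -> qmod (cis I (- root_angle N) ^+ (k * n) *
      f (s *: cis I (root_angle N) ^+ k)) <= M.
    move=> _; rewrite qmodM qmodX qmod_cis// expr1n mul1r -cisMn// /cis -sliceZ.
    apply: hM; apply/(cdiscP _ hI s_ge0).
    by rewrite sliceZ -/(cis _ _) qmodZ qmod_cis// mulr1 ger0_norm.
  by rewrite (le_trans (ler_sum _ h))// sumr_const card_ord mulr_natr.
have [U [UU leU]] := ultraFilterLemma (F := \oo : set_system nat) _.
have PU : ProperFilter U := ultra_proper.
have /choice[a ha] : forall n, exists an : quat R, dcoef s f I N n @[N --> U] --> an.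
  move=> n; set B := [set q : 'rV[R]_4 | `|q| <= M * s ^- n].
  have cB : compact B.
    apply: bounded_closed_compact.
      exists (M * s ^- n); split; first exact: num_real.
      by move=> m /ltW ms q /= qs; exact: le_trans qs ms.
    rewrite (_ : B = closed_ball_ Num.Def.normr 0 (M * s ^- n)).
      exact: closed_closed_ball_.
    by apply/seteqP; split => q; rewrite /B /closed_ball_ /= sub0r normrN.
  have UF := ultra_fmap (fun N => dcoef s f I N n) UU.
  rewrite compact_ultra in cB.
  have [|p [_ hp]] := cB _ UF; last by exists p.
  have : \forall N \near U, B (dcoef s f I N n); last by [].
  apply: filterE => N; exact: le_trans (normq_le_qmod _) (dM _ _).
have aM n : qmod (a n) <= M * s ^- n.
  by apply: cvgr_to_le (cvg_qmod (ha n)) _; apply: nearW.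
exists a, M; split=> // z zs; set q := slice I z.
pose x := qmod q / s.
have x01 : 0 <= x < 1 by rewrite divr_ge0//= ltr_pdivrMr// mul1r.
have fq := discrete_cauchy hf hI s_gt0 ss0 zs.
have tail K : qmod (f q - \sum_(n < K) q ^+ n * a n) <= M * (x ^+ K / (1 - x)).
  have cU : qmod (\sum_(n < N) q ^+ n * dcoef s f I N n -
      \sum_(n < K) q ^+ n * dcoef s f I N n) @[N --> U] -->
      qmod (f q - \sum_(n < K) q ^+ n * a n).
    apply: cvg_qmod; apply: cvgB; first exact: cvg_trans (cvg_app _ leU) fq.
    apply: cvg_big => [|n _]; first exact: add_continuous.
    by apply: cvg_qM; [exact: cvg_cst|exact: ha].
  apply: cvgr_to_le cU _; apply: leU; near=> N.
  have KN : (K <= N)%N by near: N; exact: nbhs_infty_ge.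
  rewrite -(big_mkord predT (fun n => q ^+ n * dcoef s f I N n)).
  rewrite (big_cat_nat _ KN)//= big_mkord addrAC subrr add0r.
  apply: (@le_trans _ _ (\sum_(K <= n < N) M * x ^+ n)).
    elim/big_ind2 : _ => [|u v u' v' h h'|n _]; first by rewrite qmod0.
      by rewrite (le_trans (qmodD _ _))// lerD.
    rewrite qmodM qmodX /x expr_div_n mulrCA.
    by apply: ler_wpM2l; [rewrite exprn_ge0|exact: dM].
  rewrite -mulr_sumr; apply: ler_wpM2l => //; exact: geometric_tail_le.
apply/cvg_qmodP.
apply: (@squeeze_cvgr _ _ _ _ (cst 0) (fun K => M * (x ^+ K / (1 - x)))).
- by near=> K; rewrite /= qmod_ge0 qmodC tail.
- exact: cvg_cst.
- rewrite -(mulr0 M) -[X in _ --> M * X](mul0r (1 - x)^-1).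
  apply: cvgMl_tmp; apply: cvgMr_tmp; apply: cvg_expr.
  by move: x01 => /andP[x0 x1]; rewrite ger0_norm.
Unshelve. all: by end_near. Qed.

End TaylorSlice.

Section Taylor.
Context {R : realType}.
Implicit Types (a b c : nat -> quat R) (f : quat R -> quat R).

(** At a small positive [x], the first nonzero term would dominate the
    geometrically small tail. *)
Lemma power_coef_eq0 c (C r d : R) : 0 < r -> 0 < d ->
  (forall n, qmod (c n) <= C * r ^- n) ->
  (forall x : R, 0 < x < d -> \sum_(n < K) x ^+ n *: c n @[K --> \oo] --> (0 : quat R)) ->
  forall n, c n = 0.
Proof.
move=> r0 d0 hC h0 n; have [k] := ubnP n; elim: k n => // k ih n nk.
have C0 : 0 <= C by have := le_trans (qmod_ge0 _) (hC 0); rewrite expr0 invr1 mulr1.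
have {}ih m : (m < n)%N -> c m = 0 by move=> mn; apply: ih; exact: leq_trans mn nk.
have key x : 0 < x < Num.min d (r / 2) -> qmod (c n) <= x * (2 * C * r ^- n.+1).
  move=> /andP[x0]; rewrite lt_min => /andP[xd xr].
  have x01 : 0 <= x / r < 1.
    rewrite divr_ge0 ?ltW//= ltr_pdivrMr// mul1r (lt_trans xr)//.
    by rewrite ltr_pdivrMr// ltr_pMr// ltr1n.
  have xr2 : (1 - x / r)^-1 <= 2.
    rewrite -[2]invrK lef_pV2 ?posrE ?invr_gt0//; last first.
      by rewrite subr_gt0; case/andP: x01.
    by rewrite lerBrDr -lerBrDl ler_pdivrMr//; move: xr; lra.
  have xn0 : 0 < x ^+ n by rewrite exprn_gt0.
  have hx : qmod (\sum_(m < K) x ^+ m *: c m) @[K --> \oo] --> qmod (0 : quat R).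
    by apply: cvg_qmod; apply: h0; rewrite x0 xd.
  rewrite qmod0 in hx.
  have : x ^+ n * qmod (c n) - 2 * C * (x / r) ^+ n.+1 <= 0.
    apply: (cvgr_to_ge hx); near=> K.
    have nK : (n < K)%N by near: K; exact: nbhs_infty_gt.
    rewrite lerBlDr -(big_mkord predT (fun m => x ^+ m *: c m)).
    rewrite (big_cat_nat _ (ltnW nK))//= big_nat big1 ?add0r; last first.
      by move=> m /andP[_ /ih ->]; rewrite scaler0.
    rewrite big_ltn//; set T := \sum_(n.+1 <= i < K) _.
    have hT : qmod T <= 2 * C * (x / r) ^+ n.+1.
      apply: (@le_trans _ _ (\sum_(n.+1 <= m < K) C * (x / r) ^+ m)).
        rewrite /T; elim/big_ind2 : _ => [|u v u' v' h h'|m _]; first by rewrite qmod0.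
          by rewrite (le_trans (qmodD _ _))// lerD.
        rewrite qmodZ ger0_norm ?exprn_ge0 ?(ltW x0)// expr_div_n mulrCA.
        by apply: ler_wpM2l; [rewrite exprn_ge0// ltW|exact: hC].
      rewrite -mulr_sumr -mulrA mulrCA; apply: ler_wpM2l => //.
      rewrite (le_trans (geometric_tail_le _ _ x01))// mulrC.
      apply: ler_wpM2r => //; rewrite exprn_ge0//; by case/andP: x01.
    have -> : x ^+ n * qmod (c n) = qmod (x ^+ n *: c n).
      by rewrite qmodZ ger0_norm// ltW.
    rewrite -{1}(addrK T (x ^+ n *: c n)) (le_trans (qmodB _ _))//.
    by rewrite lerD2l.
  rewrite subr_le0 => hh; rewrite -(ler_pM2l xn0) (le_trans hh)//.
  rewrite expr_div_n [x ^+ n.+1]exprS; move: (r ^- n.+1) (x ^+ n) => u v.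
  by rewrite le_eqVlt; apply/orP; left; apply/eqP; ring.
apply/eqP/negPn/negP => /qmod_gt0 cn0.
have /filter_ex : \forall x \near 0^'+, (0 : R) < x < Num.min d (r / 2) /\
    x * (2 * C * r ^- n.+1) < qmod (c n).
  near=> x; split.
    apply/andP; split; first by near: x; exact: nbhs_right_gt.
    by near: x; apply: nbhs_right_lt; rewrite lt_min d0 divr_gt0.
  near: x; apply: (@cvgr_lt _ _ _ _ (fun x : R => x * (2 * C * r ^- n.+1)) 0) => //.
  rewrite -[X in _ --> X](mul0r (2 * C * r ^- n.+1)); apply: cvgMr_tmp.
  by apply: cvg_at_right_filter; exact: cvg_id.
by move=> [x [hx]]; rewrite ltNge key.
Unshelve. all: by end_near. Qed.

(** The coefficients are determined by the values on the real axis, which lies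
    in every slice. *)
Theorem slice_regular_taylor (Om : set (quat R)) f :
  (exists2 r, 0 < r & qball r `<=` Om) ->
  (forall q, Om q -> exists2 r, qmod q < r & qball r `<=` Om) ->
  slice_regular Om f ->
  exists a, forall q, Om q -> series (fun n => q ^+ n * a n) @ \oo --> f q.
Proof.
move=> [r0 r0_gt0 hr0] hOm hf.
have sub r : qball r `<=` Om -> slice_regular (qball r) f.
  by move=> hr; split=> [q /hr/hf.1//|I hI z /hr]; exact: hf.2.
have real_pow (J : quat R) (x : R) n q : slice J (x, 0) ^+ n * q = x ^+ n *: q.
  by rewrite /slice /= scale0r addr0 exprZn expr1n -scalerAl mul1r.
have real_cvg a s J : imag_unit J -> 0 < s ->
    (forall z, qmod (slice J z) < s ->
      \sum_(n < K) slice J z ^+ n * a n @[K --> \oo] --> f (slice J z)) ->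
    forall x : R, 0 < x < s -> \sum_(n < K) x ^+ n *: a n @[K --> \oo] --> f (x *: 1).
  move=> hJ s0 ha x /andP[x0 xs].
  have := ha (x, 0); rewrite /slice /= scale0r addr0 qmodZ qmod1 mulr1 gtr0_norm// => /(_ xs).
  under eq_fun do under eq_bigr do rewrite exprZn expr1n -scalerAl mul1r.
  by [].
pose I0 : quat R := mkquat 0 1 0 0.
have hI0 : imag_unit I0 by apply: quatP; rewrite !quatE; ring.
pose s1 := r0 / 2; have s1_gt0 : 0 < s1 by rewrite divr_gt0.
have s1r0 : s1 < r0 by rewrite ltr_pdivrMr// ltr_pMr// ltr1n.
have [a [M [aM ha]]] := taylor_slice (sub _ hr0) hI0 s1_gt0 s1r0.
exists a => q Oq; have [r qr hr] := hOm q Oq.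
have [J [z [hJ qE]]] := slice_exists q.
pose s := (qmod q + r) / 2.
have r_gt0 : 0 < r by exact: le_lt_trans qr.
have s_gt0 : 0 < s by rewrite divr_gt0// ltr_wpDl.
have sr : s < r by rewrite ltr_pdivrMr// mulr_natr mulr2n ltrD2r.
have qs : qmod q < s by rewrite ltr_pdivlMr// mulr_natr mulr2n ltrD2l.
have [b [M' [bM hb]]] := taylor_slice (sub _ hr) hJ s_gt0 sr.
pose m := Num.min s1 s; have m0 : 0 < m by rewrite lt_min s1_gt0.
have ab n : a n - b n = 0.
  apply: (@power_coef_eq0 (fun n => a n - b n) (`|M| + `|M'|) m m m0 m0) => [k|x].
    rewrite (le_trans (qmodB _ _))// mulrDl.
    have inv_le t : 0 < t -> m <= t -> t ^- k <= m ^- k.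
      by move=> t0 mt; rewrite lef_pV2 ?posrE ?exprn_gt0// lerXn2r// nnegrE ltW.
    have le_abs t (u : R) : 0 < t -> m <= t -> u * t ^- k <= `|u| * m ^- k.
      move=> t0 mt; apply: (@le_trans _ _ (`|u| * t ^- k)).
        by apply: ler_wpM2r (ler_norm _); rewrite invr_ge0 exprn_ge0// ltW.
      by apply: ler_wpM2l => //; exact: inv_le.
    by apply: lerD; [apply: le_trans (aM k) _|apply: le_trans (bM k) _];
      apply: le_abs => //; rewrite ge_min lexx ?orbT.
  move=> /andP[x0]; rewrite lt_min => /andP[xs1 xs].
  rewrite [X in X @ _](_ : _ = fun K => \sum_(n < K) x ^+ n *: a n - \sum_(n < K) x ^+ n *: b n); last first.
    by apply/funext => K; rewrite -sumrB; apply: eq_bigr => i _; rewrite scalerBr.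
  rewrite -[X in _ --> X](subrr (f (x *: 1))).
  by apply: cvgB; [apply: (real_cvg _ _ _ hI0 s1_gt0 ha)|
    apply: (real_cvg _ _ _ hJ s_gt0 hb)]; rewrite x0.
have := hb z; rewrite -qE => /(_ qs).
move=> hbz; rewrite /series /=.
have -> : a = b by apply/funext => n; apply/eqP; rewrite -subr_eq0 ab.
by under eq_fun do rewrite big_mkord.
Qed.
End Taylor.

(** * Power series are slice regular *)

Section PowerSeries.
Context {R : realType}.
Implicit Types (b : nat -> quat R) (q h : quat R).

Definition power_series b q : quat R := limn (series (fun n => q ^+ n * b n)).

Lemma qmod_cvg_series (u : nat -> quat R) (v : nat -> R) :
  (forall n, qmod (u n) <= v n) -> cvgn (series v) -> cvgn (series u).
Proof.
move=> uv cv; apply: normed_cvg.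
apply: (@series_le_cvg _ _ v) => // n; rewrite /=.
- exact: normr_ge0.
- by apply: le_trans (uv n).
- exact: le_trans (normq_le_qmod _) (uv n).
Qed.

Lemma qmod_lim_series (u : nat -> quat R) (v : nat -> R) :
  (forall n, qmod (u n) <= v n) -> cvgn (series v) ->
  qmod (limn (series u)) <= limn (series v).
Proof.
move=> uv cv; have cu := qmod_cvg_series uv cv.
apply: ler_cvg_to (cvg_qmod cu) cv _; near=> n.
rewrite /series /=; elim/big_ind2 : _ => [|x a y c xa yc|i _]; rewrite ?qmod0//.
by rewrite (le_trans (qmodD _ _))// lerD.
Unshelve. all: by end_near. Qed.

Lemma natmul_expr_le (x y : R) n : 0 <= x < y ->
  n%:R * x ^+ n <= y / (y - x) * y ^+ n.
Proof.
move=> /andP[x0 xy]; have y0 : 0 < y by exact: le_lt_trans xy.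
have r01 : 0 <= x / y < 1.
  by rewrite divr_ge0 ?(ltW y0)//= ltr_pdivrMr// mul1r.
have -> : y / (y - x) = (1 - x / y)^-1.
  by field; rewrite !gt_eqF// ?subr_gt0.
have h : n%:R * (x / y) ^+ n <= (1 - x / y)^-1.
  have := @geometric_tail_le R _ 0 n r01; rewrite expr0 mul1r; apply: le_trans.
  rewrite big_mkord mulr_natl -[n in _ *+ n]card_ord -sumr_const.
  apply: ler_sum => i _; apply: ler_wiXn2l => //; first by case/andP: r01.
    by case/andP: r01 => _ /ltW.
  exact: ltnW.
have yn : 0 < y ^+ n by rewrite exprn_gt0.
by rewrite -ler_pdivrMr// -mulrA -expr_div_n.
Qed.

Section Bounded.
Variables (b : nat -> quat R) (rho M : R).
Hypothesis bM : forall n, qmod (b n) * rho ^+ n <= M.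

Lemma cvg_weighted_series (t : R) : 0 < t < rho ->
  cvgn (series (fun n => (n%:R ^+ 2 * t ^+ n) * qmod (b n))).
Proof.
move=> /andP[t0 trho].
have [t1 [tt1 t1rho]] : exists t1, t < t1 /\ t1 < rho.
  by exists ((t + rho) / 2); split; lra.
have [t2 [t12 t2rho]] : exists t2, t1 < t2 /\ t2 < rho.
  by exists ((t1 + rho) / 2); split; lra.
have t10 := lt_trans t0 tt1; have t20 := lt_trans t10 t12.
have rho0 := lt_trans t20 t2rho.
pose C := t1 / (t1 - t) * (t2 / (t2 - t1)).
have C0 : 0 <= C by rewrite mulr_ge0// divr_ge0// ?subr_ge0 ltW.
have M0 : 0 <= M by apply: le_trans (bM 0); rewrite expr0 mulr1.
have Cn n : n%:R ^+ 2 * t ^+ n <= C * t2 ^+ n.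
  rewrite expr2 -mulrA.
  have h1 : n%:R * t ^+ n <= t1 / (t1 - t) * t1 ^+ n.
    by apply: natmul_expr_le; rewrite tt1 ltW.
  have h2 : n%:R * t1 ^+ n <= t2 / (t2 - t1) * t2 ^+ n.
    by apply: natmul_expr_le; rewrite t12 ltW.
  rewrite (le_trans (ler_wpM2l _ h1))// mulrCA /C -mulrA.
  by apply: ler_wpM2l => //; rewrite divr_ge0// ?subr_ge0 ltW.
clearbody C; have x01 : `|t2 / rho| < 1.
  by rewrite ger0_norm ?ltr_pdivrMr ?mul1r//; apply: divr_ge0 => //; exact: ltW.
apply: (@series_le_cvg _ _ (geometric (C * M) (t2 / rho))) => [n|n|n|] /=.
- by rewrite !mulr_ge0// ?sqr_ge0// exprn_ge0// ltW.
- apply: mulr_ge0; first exact: mulr_ge0.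
  by apply: exprn_ge0; apply: divr_ge0; exact: ltW.
- rewrite (le_trans (ler_wpM2r _ (Cn n)))// -!mulrA.
  have M' : qmod (b n) <= M / rho ^+ n by rewrite ler_pdivlMr// exprn_gt0.
  rewrite expr_div_n [t2 ^+ n / _]mulrC [M * _]mulrA.
  rewrite [t2 ^+ n * _]mulrC; apply: ler_wpM2l => //.
  by apply: ler_wpM2r => //; apply: exprn_ge0; exact: ltW.
- exact: (is_cvg_geometric_series x01).
Qed.

Lemma cvg_power_series q : qmod q < rho ->
  cvgn (series (fun n => q ^+ n * b n)).
Proof.
move=> qrho; have rho0 := le_lt_trans (qmod_ge0 q) qrho.
have x01 : `|qmod q / rho| < 1.
  by rewrite ger0_norm ?ltr_pdivrMr ?mul1r//; apply: divr_ge0 => //; exact: ltW.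
apply: (qmod_cvg_series _ (is_cvg_geometric_series (a := M) x01)) => n.
rewrite /geometric /= qmodM qmodX expr_div_n mulrCA; apply: ler_wpM2l.
  by rewrite exprn_ge0.
by rewrite ler_pdivlMr// exprn_gt0.
Qed.

End Bounded.

(** The derivative of [q ^+ n] in the direction [h], by the Leibniz rule. *)
Fixpoint dpow q n h : quat R :=
  if n is m.+1 then dpow q m h * q + q ^+ m * h else 0.

Lemma dpow_linear q n : linear (dpow q n).
Proof.
elim: n => [|n ih] a h h' /=; first by rewrite scaler0 addr0.
by rewrite ih mulrDl mulrDr scalerDr -scalerAl -scalerAr addrACA.
Qed.

Lemma dpow_le q n h (t : R) : 0 < t -> qmod q <= t ->
  qmod (dpow q n h) <= n%:R * t ^+ n * (qmod h / t).
Proof.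
move=> t0 qt; elim: n => [|n ih] /=; first by rewrite qmod0 !mul0r.
rewrite (le_trans (qmodD _ _))// !qmodM qmodX.
have h1 : qmod (dpow q n h) * qmod q <= n%:R * t ^+ n * (qmod h / t) * t.
  by apply: ler_pM.
have h2 : qmod q ^+ n * qmod h <= t ^+ n * qmod h.
  by apply: ler_wpM2r => //; apply: lerXn2r; rewrite ?nnegrE// ltW.
rewrite (le_trans (lerD h1 h2))// le_eqVlt; apply/orP; left; apply/eqP.
by rewrite exprS -natr1; field; rewrite gt_eqF.
Qed.

Lemma pow_diffS q h n : (q + h) ^+ n.+1 - q ^+ n.+1 =
  ((q + h) ^+ n - q ^+ n) * (q + h) + q ^+ n * h.
Proof. by rewrite !exprSr mulrBl (mulrDr (q ^+ n)) opprD addrA subrK. Qed.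

Lemma pow_diff_le q h n (t : R) : 0 < t -> qmod q <= t -> qmod (q + h) <= t ->
  qmod ((q + h) ^+ n - q ^+ n) <= n%:R * t ^+ n * (qmod h / t).
Proof.
move=> t0 qt qht; elim: n => [|n ih]; first by rewrite !expr0 subrr qmod0 !mul0r.
rewrite pow_diffS (le_trans (qmodD _ _))// !qmodM qmodX.
have h1 : qmod ((q + h) ^+ n - q ^+ n) * qmod (q + h) <= n%:R * t ^+ n * (qmod h / t) * t.
  by apply: ler_pM.
have h2 : qmod q ^+ n * qmod h <= t ^+ n * qmod h.
  by apply: ler_wpM2r => //; apply: lerXn2r; rewrite ?nnegrE// ltW.
rewrite (le_trans (lerD h1 h2))// le_eqVlt; apply/orP; left; apply/eqP.
by rewrite exprS -natr1; field; rewrite gt_eqF.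
Qed.

(** The remainder is quadratic in [h], with a factor [n ^ 2] which a power
    series absorbs by shrinking its radius ([cvg_weighted_series]). *)
Lemma pow_taylor_le q h n (t : R) : 0 < t -> qmod q <= t -> qmod (q + h) <= t ->
  qmod ((q + h) ^+ n - q ^+ n - dpow q n h) <=
    n%:R ^+ 2 * t ^+ n * (qmod h / t) ^+ 2.
Proof.
move=> t0 qt qht; elim: n => [|n ih].
  by rewrite !expr0 subrr subr0 qmod0 expr0n /= !mul0r.
have -> : (q + h) ^+ n.+1 - q ^+ n.+1 - dpow q n.+1 h =
    ((q + h) ^+ n - q ^+ n - dpow q n h) * q + ((q + h) ^+ n - q ^+ n) * h.
  rewrite pow_diffS /= [dpow _ _ _ * _ + _]addrC opprD addrA addrK.
  by rewrite mulrDr [in RHS]mulrBl addrAC.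
rewrite (le_trans (qmodD _ _))// !qmodM.
have h1 : qmod ((q + h) ^+ n - q ^+ n - dpow q n h) * qmod q <=
    n%:R ^+ 2 * t ^+ n * (qmod h / t) ^+ 2 * t.
  by apply: ler_pM.
have h2 : qmod ((q + h) ^+ n - q ^+ n) * qmod h <=
    n%:R * t ^+ n * (qmod h / t) * qmod h.
  by apply: ler_wpM2r => //; exact: pow_diff_le.
rewrite (le_trans (lerD h1 h2))//.
have -> : n%:R ^+ 2 * t ^+ n * (qmod h / t) ^+ 2 * t + n%:R * t ^+ n * (qmod h / t) * qmod h
   = (n%:R ^+ 2 + n%:R) * (t ^+ n.+1 * (qmod h / t) ^+ 2).
  by rewrite [t ^+ n.+1]exprS; field; rewrite gt_eqF.
rewrite -mulrA; apply: ler_wpM2r.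
  by rewrite mulr_ge0// ?sqr_ge0// exprn_ge0// ltW.
by rewrite -natr1; have := ler0n R n; move: (n%:R) => x; nra.
Qed.


Section Differential.
Variables (b : nat -> quat R) (rho M : R).
Hypothesis bM : forall n, qmod (b n) * rho ^+ n <= M.

Definition dpower_series q h : quat R :=
  limn (series (fun n => dpow q n h * b n)).

Section At.
Variable q : quat R.
Hypothesis qrho : qmod q < rho.
Let t := (qmod q + rho) / 2.
Let t_bounds : [/\ 0 < t, qmod q < t & t < rho].
Proof.
have := qmod_ge0 q; rewrite /t => q0; split; first by move: qrho q0; lra.
  by move: qrho; lra.
by move: qrho; lra.
Qed.
Let t0 : 0 < t. Proof. by case: t_bounds. Qed.
Let qt : qmod q < t. Proof. by case: t_bounds. Qed.
Let cW : cvgn (series (fun n => (n%:R ^+ 2 * t ^+ n) * qmod (b n))).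
Proof. by apply: (cvg_weighted_series bM); case: t_bounds => -> _ ->. Qed.
Let W := limn (series (fun n => (n%:R ^+ 2 * t ^+ n) * qmod (b n))).

Let W0 : 0 <= W.
Proof.
apply: limr_ge cW _; apply: nearW => n; rewrite /series /= sumr_ge0// => i _.
by rewrite !mulr_ge0// ?sqr_ge0// exprn_ge0// ltW.
Qed.

Let cWZ (k : R) : series (fun n => k * ((n%:R ^+ 2 * t ^+ n) * qmod (b n))) @ \oo --> k * W.
Proof.
have -> : series (fun n => k * ((n%:R ^+ 2 * t ^+ n) * qmod (b n))) =
    k \*: series (fun n => (n%:R ^+ 2 * t ^+ n) * qmod (b n)).
  by apply/funext => n; rewrite /series /= scaler_sumr.
exact: cvgZl_tmp cW.
Qed.

Let dpow_term_le h n : qmod (dpow q n h * b n) <=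
  (qmod h / t) * ((n%:R ^+ 2 * t ^+ n) * qmod (b n)).
Proof.
rewrite qmodM mulrA; apply: ler_wpM2r => //; rewrite mulrC.
apply: (le_trans (dpow_le n h t0 (ltW qt))).
apply: ler_wpM2r; first by rewrite divr_ge0// ltW.
apply: ler_wpM2r; first by rewrite exprn_ge0// ltW.
case: n => [|n]; first by rewrite expr0n.
by rewrite expr2 ler_peMl// ler1n.
Qed.

Lemma cvg_dpower_series h : series (fun n => dpow q n h * b n) @ \oo --> dpower_series q h.
Proof. by apply: qmod_cvg_series (dpow_term_le h) _; apply/cvg_ex; eexists; exact: cWZ. Qed.

Let dpower_series_linear : linear (dpower_series q).
Proof.
move=> a h h'; apply: cvg_lim => //.
have -> : series (fun n => dpow q n (a *: h + h') * b n) =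
    (fun k => a *: series (fun n => dpow q n h * b n) k + series (fun n => dpow q n h' * b n) k).
  apply/funext => k; rewrite /series /= scaler_sumr -big_split /=.
  by apply: eq_bigr => n _; rewrite dpow_linear mulrDl scalerAl.
apply: cvgD; last exact: cvg_dpower_series.
by apply: cvgZl_tmp; exact: cvg_dpower_series.
Qed.
HB.instance Definition _ := GRing.isLinear.Build R (quat R) (quat R)
  *:%R (dpower_series q) dpower_series_linear.

Let dpower_series_le h : qmod (dpower_series q h) <= qmod h / t * W.
Proof.
have c : cvgn (series (fun n => (qmod h / t) * ((n%:R ^+ 2 * t ^+ n) * qmod (b n)))).
  by apply/cvg_ex; eexists; exact: cWZ.
rewrite -(cvg_lim _ (cWZ (k := qmod h / t)))//; exact: qmod_lim_series (dpow_term_le h) c.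
Qed.

Let dpower_series_continuous : continuous (dpower_series q).
Proof.
apply: bounded_linear_continuous; exists (2 * 1 / t * W); split; first exact: num_real.
move=> m hm; near=> h; rewrite /= (le_trans (normq_le_qmod _))//.
rewrite (le_trans _ (ltW hm))// (le_trans (dpower_series_le h))//.
apply: ler_wpM2r => //; apply: ler_wpM2r; first by rewrite invr_ge0 ltW.
rewrite (le_trans (qmod_le_norm _))// ler_pM2l//.
Unshelve. all: by end_near. Qed.

Let power_series_taylor h : qmod (q + h) <= t ->
  qmod (power_series b (q + h) - power_series b q - dpower_series q h) <=
    (qmod h / t) ^+ 2 * W.
Proof.
move=> qht.
have trho : t < rho by case: t_bounds.
have c1 := cvg_power_series bM (le_lt_trans qht trho).
have c2 := cvg_power_series bM qrho.
have c3 : qmod (series (fun n => (q + h) ^+ n * b n) k - series (fun n => q ^+ n * b n) k -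
    series (fun n => dpow q n h * b n) k) @[k --> \oo] -->
    qmod (power_series b (q + h) - power_series b q - dpower_series q h).
  apply: cvg_qmod; apply: cvgB (cvg_dpower_series (h := h)).
  by apply: cvgB; [exact: c1|exact: c2].
apply: ler_cvg_to c3 (cWZ (k := (qmod h / t) ^+ 2)) _.
near=> k; rewrite /series /= -!sumrB.
elim/big_ind2 : _ => [|x a y c xa yc|n _]; first by rewrite qmod0.
  by rewrite (le_trans (qmodD _ _))// lerD.
rewrite -!mulrBl qmodM mulrA; apply: ler_wpM2r => //; rewrite mulrC.
exact: pow_taylor_le (ltW qt) qht.
Unshelve. all: by end_near. Qed.

Lemma power_series_diff : differentiable (power_series b) q /\
  'd (power_series b) q = dpower_series q :> (quat R -> quat R).
Proof.
suff H : power_series b \o shift q = cst (power_series b q) + dpower_series q +o_ 0 id.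
  have dE := diff_unique dpower_series_continuous H.
  by split=> //; apply/diff_locallyP; rewrite dE; split.
apply/eqaddoP => e e0.
pose d := e * t ^+ 2 / (4 * (W + 1)).
have d0 : 0 < d by rewrite divr_gt0// mulr_gt0// ?exprn_gt0// ltr_wpDl.
have e2 : 0 < (t - qmod q) / 2 by rewrite divr_gt0// subr_gt0.
near=> h.
have hd : `|h| <= d by near: h; exact: (nbhs0_le (V := quat R) d0).
have ht : `|h| <= (t - qmod q) / 2.
  by near: h; exact: (nbhs0_le (V := quat R) e2).
have qht : qmod (q + h) <= t.
  rewrite (le_trans (qmodD _ _))// -lerBrDl (le_trans (qmod_le_norm _))//.
  by rewrite mulrC -ler_pdivlMr.
rewrite /= !fctE /cst [h + q]addrC opprD addrA (le_trans (normq_le_qmod _))//.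
rewrite (le_trans (power_series_taylor qht))//.
have h2 : (qmod h / t) ^+ 2 <= (2 * `|h| / t) ^+ 2.
  apply: lerXn2r; rewrite ?nnegrE.
  - by apply: divr_ge0 => //; exact: ltW.
  - by apply: divr_ge0; [exact: mulr_ge0|exact: ltW].
  - by apply: ler_wpM2r; [rewrite invr_ge0 ltW|exact: qmod_le_norm].
rewrite (le_trans (ler_wpM2r W0 h2))//.
have -> : (2 * `|h| / t) ^+ 2 * W = `|h| * (`|h| * (4 * W / t ^+ 2)).
  by field; rewrite gt_eqF.
rewrite mulrC; apply: ler_wpM2r => //.
have k0 : 0 <= 4 * W / t ^+ 2 by apply: divr_ge0; [exact: mulr_ge0|apply: exprn_ge0; exact: ltW].
rewrite (le_trans (ler_wpM2r k0 hd))//.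
have -> : d * (4 * W / t ^+ 2) = e * (W / (W + 1)).
  by rewrite /d; field; rewrite !gt_eqF// ltr_wpDl.
rewrite ler_piMr ?(ltW e0)// ler_pdivrMr ?ltr_wpDl// mul1r.
by rewrite lerDl.
Unshelve. all: by end_near. Qed.

End At.

(** Along the slice of [q] the direction commutes with [q]. *)
Lemma dpow_comm q h n : q * h = h * q -> dpow q n h = h * (n%:R *: q ^+ n.-1).
Proof.
move=> qh; have qhn m : q ^+ m * h = h * q ^+ m.
  by elim: m => [|m ih]; rewrite ?expr0 ?mulr1 ?mul1r// exprS -mulrA ih mulrA qh mulrA.
elim: n => [|n ih]; first by rewrite scale0r mulr0.
rewrite /= ih qhn; case: n {ih} => [|n] /=.
  by rewrite scale0r mulr0 mul0r add0r scale1r.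
by rewrite -mulrA -scalerAl -exprSr -mulrDr -[X in _ + X]scale1r -scalerDl natr1.
Qed.

End Differential.

Lemma shift_series_lim (V : normedModType R) (u : nat -> V) (l : V) : u 0 = 0 ->
  series u @ \oo --> l -> series (fun n => u n.+1) @ \oo --> l.
Proof.
move=> u0 ul; have -> : series (fun n => u n.+1) = (fun n => series u n.+1).
  apply/funext => n; rewrite /series /= big_nat_recl// u0 add0r.
  by [].
by move: ul; rewrite -cvg_shiftS.
Qed.

Section SliceRegular.
Variables (b : nat -> quat R) (Om : set (quat R)).
Hypothesis openOm : open Om.
Hypothesis bOm : forall q, Om q -> exists rho M : R,
  qmod q < rho /\ forall n, qmod (b n) * rho ^+ n <= M.

Let b' n : quat R := n.+1%:R *: b n.+1.

(** A smaller radius absorbs the factor [n.+1]. *)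
Let b'_bounded q : Om q -> exists rho M : R,
  qmod q < rho /\ forall n, qmod (b' n) * rho ^+ n <= M.
Proof.
move=> /bOm[rho [M [qr bM]]].
pose t := (qmod q + rho) / 2.
have q0 := qmod_ge0 q.
have [t0 qt tr] : [/\ 0 < t, qmod q < t & t < rho] by rewrite /t; split; lra.
have rho0 := lt_trans t0 tr.
exists t, (rho / (rho - t) / t * M); split=> // n.
rewrite /b' qmodZ ger0_norm// mulrAC.
have -> : n.+1%:R * t ^+ n = t^-1 * (n.+1%:R * t ^+ n.+1).
  by rewrite exprS mulrCA; congr (_ * _); rewrite mulrA mulVf ?mul1r// gt_eqF.
have h : n.+1%:R * t ^+ n.+1 <= rho / (rho - t) * rho ^+ n.+1.
  by apply: natmul_expr_le; rewrite tr ltW.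
have h' : n.+1%:R * t ^+ n.+1 * qmod (b n.+1) <= rho / (rho - t) * M.
  apply: (le_trans (ler_wpM2r (qmod_ge0 _) h)); rewrite -[leLHS]mulrA.
  apply: ler_wpM2l; first by rewrite divr_ge0 ?subr_ge0 ?(ltW tr) ?(ltW rho0).
  by rewrite mulrC; exact: bM.
have -> : rho / (rho - t) / t * M = t^-1 * (rho / (rho - t) * M).
  by rewrite mulrA [t^-1 * _]mulrC.
by rewrite -[leLHS]mulrA; apply: ler_wpM2l h'; rewrite invr_ge0 ltW.
Qed.

Lemma dpower_series_slice q h : Om q -> q * h = h * q ->
  dpower_series b q h = h * power_series b' q.
Proof.
move=> Oq qh; have [rho [M [qr bM]]] := bOm Oq.
have [rho' [M' [qr' bM']]] := b'_bounded Oq.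
have c := cvg_dpower_series bM qr (h := h).
have c' := cvg_power_series bM' qr'.
have := shift_series_lim _ c; rewrite /= mul0r => /(_ erefl) {}c.
have c2 : series (fun n => dpow q n.+1 h * b n.+1) @ \oo --> h * power_series b' q.
  have -> : series (fun n => dpow q n.+1 h * b n.+1) = (fun k => h * series (fun n => q ^+ n * b' n) k).
    apply/funext => k; rewrite /series /= mulr_sumr; apply: eq_bigr => n _.
    rewrite -[_ * q + _]/(dpow q n.+1 h) dpow_comm// /b' -mulrA; congr (_ * _).
    by rewrite -scalerAl -scalerAr.
  by apply: cvg_qM; [exact: cvg_cst|exact: c'].
by rewrite -(cvg_lim _ c)// -(cvg_lim _ c2).
Qed.

(** Along a slice the derivative of the series at [q] in the direction [h] is
    [h] times the formal derivative, whence the Cauchy--Riemann equation. *)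
Theorem power_series_slice_regular : slice_regular Om (power_series b).
Proof.
have dP q : Om q -> differentiable (power_series b) q /\
    'd (power_series b) q = dpower_series b q :> (quat R -> quat R).
  by move=> /bOm[rho [M [qr bM]]]; have := power_series_diff bM qr; exact.
split=> [q /dP[]//|I hI z Oz].
have nearOm : \forall y \near z, Om (slice I y).
  by apply: (slice_continuous (I := I)); apply: open_nbhs_nbhs.
have fd y : Om (slice I y) -> differentiable (power_series b \o slice I) y.
  move=> Oy; apply: differentiable_comp; first exact: slice_differentiable.
  by have [] := dP _ Oy.
have DE y v : Om (slice I y) -> 'D_v (power_series b \o slice I) y =
    slice I v * power_series b' (slice I y).
  move=> Oy; have [df dE] := dP _ Oy.
  rewrite deriveE; last exact: fd.
  rewrite diff_comp//; last exact: slice_differentiable.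
  rewrite /= dE diff_lin; last exact: slice_continuous.
  by rewrite dpower_series_slice//= slice_comm.
have cD v : {for z, continuous ('D_v (power_series b \o slice I))}.
  have db' : differentiable (power_series b') (slice I z).
    by have [rho [M [qr bM]]] := b'_bounded Oz; have [] := power_series_diff bM qr.
  rewrite /prop_for /continuous_at DE//.
  apply: cvg_trans (_ : slice I v * power_series b' (slice I y) @[y --> z] --> _).
    apply: near_eq_cvg; apply: filterS nearOm => y Oy; by rewrite DE.
  apply: cvg_qM; first exact: cvg_cst.
  have cI : slice I y @[y --> z] --> slice I z by exact: slice_continuous.
  exact: (continuous_cvg _ (differentiable_continuous db') cI).
split=> //.
- exact: diff_derivable (fd _ Oz).
- exact: diff_derivable (fd _ Oz).
- rewrite !DE// slice1 mul1r /slice /= scale0r add0r scale1r mulrA hI.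
  by rewrite mulN1r subrr.
Qed.

End SliceRegular.
End PowerSeries.

(** * Rotation invariance of the plane measure *)

Section PlaneMeasure.
Context {R : realType}.
Local Notation lam := (@lebesgue_measure R).
Local Notation mu := ((lam \x lam)%E).

Definition measure_preserving d (T : measurableType d) (m : set T -> \bar R)
  (phi : T -> T) := measurable_fun setT phi /\
  forall A, measurable A -> m (phi @^-1` A) = m A.

Lemma lebesgue_translation (c : R) (A : set R) : measurable A ->
  lam ((fun x => x + c) @^-1` A) = lam A.
Proof.
move=> mA; pose phi (x : R) : measurableTypeR R := x + c.
have mphi : measurable_fun setT phi by exact: measurable_funD.
pose m := measure_function_pushforward__canonical__measure_function_Measure lam mphi.
suff h X : ocitv X -> lam X = m X by exact: (esym (lebesgue_measure_unique h mA)).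
move=> [[a b] _ <-]; rewrite /m /= /pushforward /=.
have -> : (fun x : R => x + c) @^-1` `]a, b]%classic = `]a - c, b - c]%classic.
  by apply/seteqP; split => x /=; rewrite !in_itv /= ltrBlDr lerBrDr.
rewrite !lebesgue_measure_itv /= !lte_fin ltrD2r.
by case: ifP => // _; rewrite -!EFinB; congr (_%:E); ring.
Qed.

Lemma preserving_comp d (T : measurableType d) (m : set T -> \bar R) phi psi :
  measure_preserving m phi -> measure_preserving m psi ->
  measure_preserving m (psi \o phi).
Proof.
move=> [mphi hphi] [mpsi hpsi]; split; first exact: measurableT_comp.
move=> A mA; rewrite comp_preimage hphi ?hpsi//.
by rewrite -(setTI (_ @^-1` _)); exact: mpsi.
Qed.

(** Fubini for sets: a horizontal shear is a translation of each horizontal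
    section, while the product measure is defined by vertical sections. *)
Lemma plane_measure_swap A : measurable A -> mu A = (lam \x^ lam)%E A.
Proof.
move=> mA; apply: product_measure_unique => // X Y mX mY.
exact: product_measure2E.
Qed.

Lemma shear1_preserving (c : R) :
  measure_preserving mu (fun z : R * R => (z.1 + c * z.2, z.2)).
Proof.
have mphi : measurable_fun setT (fun z : R * R => (z.1 + c * z.2, z.2)).
  apply: measurable_fun_pair; last exact: measurable_snd.
  apply: measurable_funD; first exact: measurable_fst.
  by apply: measurable_funM; [exact: measurable_cst|exact: measurable_snd].
split=> // A mA; have mA' : measurable ((fun z : R * R => (z.1 + c * z.2, z.2)) @^-1` A).
  by rewrite -(setTI (_ @^-1` _)); exact: mphi.
rewrite !plane_measure_swap//; apply: eq_integral => y _ /=.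
rewrite -[in RHS](lebesgue_translation (c * y)); last exact: measurable_ysection.
by congr (lam _); apply/seteqP; split=> x; rewrite /ysection /= !inE.
Qed.

Lemma shear2_preserving (c : R) :
  measure_preserving mu (fun z : R * R => (z.1, z.2 + c * z.1)).
Proof.
have mphi : measurable_fun setT (fun z : R * R => (z.1, z.2 + c * z.1)).
  apply: measurable_fun_pair; first exact: measurable_fst.
  apply: measurable_funD; first exact: measurable_snd.
  by apply: measurable_funM; [exact: measurable_cst|exact: measurable_fst].
split=> // A mA; apply: eq_integral => x _ /=.
rewrite -[in RHS](lebesgue_translation (c * x)); last exact: measurable_xsection.
by congr (lam _); apply/seteqP; split=> y; rewrite /xsection /= !inE.
Qed.

Definition rotation (c s : R) (z : R * R) : R * R :=
  (c * z.1 - s * z.2, s * z.1 + c * z.2).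

(** A rotation is a composition of three shears. *)
Lemma rotation_preserving (c s : R) : c ^+ 2 + s ^+ 2 = 1 -> c != -1 ->
  measure_preserving mu (rotation c s).
Proof.
move=> cs c1; pose t := - (s / (1 + c)).
have c10 : 1 + c != 0 by rewrite addrC -[X in _ + X]opprK subr_eq0.
have -> : rotation c s = (fun z : R * R => (z.1 + t * z.2, z.2)) \o
    ((fun z : R * R => (z.1, z.2 + s * z.1)) \o (fun z : R * R => (z.1 + t * z.2, z.2))).
  have hc : 1 + t * s = c.
    rewrite /t; apply: (mulIf c10); rewrite mulrDl mulNr mulrAC mulNr divfK//.
    by rewrite -[s * s]expr2; move: cs; lra.
  have hs : t + t * (1 + s * t) = - s.
    have -> : t + t * (1 + s * t) = t * (1 + (1 + t * s)) by ring.
    by rewrite hc /t mulNr divfK.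
  apply/funext => -[x y]; rewrite /rotation /=; congr pair.
    have -> : x + t * y + t * (y + s * (x + t * y)) = (1 + t * s) * x + (t + t * (1 + s * t)) * y by ring.
    by rewrite hc hs mulNr.
  have -> : y + s * (x + t * y) = s * x + (1 + t * s) * y by ring.
  by rewrite hc.
apply: preserving_comp; last exact: shear1_preserving.
by apply: preserving_comp; [exact: shear1_preserving|exact: shear2_preserving].
Qed.

End PlaneMeasure.

(** * Integration of radial functions *)

Section DiscArea.
Context {R : realType}.
Local Notation lam := (@lebesgue_measure R).
Local Notation mu := ((lam \x lam)%E).

Definition sqnorm (z : R * R) : R := z.1 ^+ 2 + z.2 ^+ 2.

Lemma measurable_sqnorm : measurable_fun setT sqnorm.
Proof.
by apply: measurable_funD; apply: measurable_funX;
  [exact: measurable_fst|exact: measurable_snd].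
Qed.

(** The half-angle form [2 * atan (x / (r + sqrt (r ^+ 2 - x ^+ 2)))] of
    [asin (x / r)] is continuous up to the end points. *)
Definition half_disc_primitive (r x : R) : R :=
  x * Num.sqrt (r ^+ 2 - x ^+ 2) +
  r ^+ 2 * (2 * atan (x / (r + Num.sqrt (r ^+ 2 - x ^+ 2)))).

Let is_derive_sqrt_circle (r x : R) : 0 < r ^+ 2 - x ^+ 2 ->
  is_derive x 1 (fun x => Num.sqrt (r ^+ 2 - x ^+ 2)) (- x / Num.sqrt (r ^+ 2 - x ^+ 2)).
Proof.
move=> h; have h1 : is_derive x 1 (fun x : R => r ^+ 2 - x ^+ 2) (- (2 * x)).
  by apply: is_derive_eq; rewrite /GRing.scale /=; ring.
have h2 := @is_derive1_comp R Num.sqrt _ x _ _ (is_derive1_sqrt h) h1.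
apply: (is_derive_eq h2).
by field; rewrite gt_eqF// sqrtr_gt0.
Qed.

Lemma half_disc_primitive_derive (r x : R) : 0 < r -> `|x| < r ->
  is_derive x 1 (half_disc_primitive r) (2 * Num.sqrt (r ^+ 2 - x ^+ 2)).
Proof.
move=> r0 xr; have h : 0 < r ^+ 2 - x ^+ 2.
  by rewrite subr_gt0 -(real_normK (num_real x)) ltrXn2r// ?nnegrE// ltW.
have hs := is_derive_sqrt_circle h.
set s := Num.sqrt (r ^+ 2 - x ^+ 2) in hs *.
have s0 : 0 < s by rewrite sqrtr_gt0.
have s2 : s ^+ 2 = r ^+ 2 - x ^+ 2 by rewrite sqr_sqrtr// ltW.
have rs0 : 0 < r + s by rewrite addr_gt0.
have hd : is_derive x 1 (fun x => r + Num.sqrt (r ^+ 2 - x ^+ 2)) (- x / s).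
  by apply: (is_derive_eq (is_deriveD (is_derive_cst r x 1) hs)); rewrite add0r.
have hq : is_derive x 1 (fun x => x / (r + Num.sqrt (r ^+ 2 - x ^+ 2)))
    ((r + s + x ^+ 2 / s) / (r + s) ^+ 2).
  have hV := @is_deriveV R (fun x => r + Num.sqrt (r ^+ 2 - x ^+ 2)) x _ 1 (lt0r_neq0 rs0) hd.
  apply: (is_derive_eq (is_deriveM (is_derive_id x 1) hV)).
  rewrite /GRing.scale /= -/s mulr1; field; rewrite !gt_eqF//.
have ha := @is_derive1_comp R atan _ x _ _ (is_derive1_atan _) hq.
have hP := is_deriveD (is_deriveM (is_derive_id x (1 : R)) hs)
  (is_deriveM (is_derive_cst (r ^+ 2) x (1 : R)) (is_deriveM (is_derive_cst (2 : R) x (1 : R)) ha)).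
have -> : half_disc_primitive r = (id * (fun x => Num.sqrt (r ^+ 2 - x ^+ 2))) +
    (cst (r ^+ 2) * (cst 2 * (atan \o (fun x => x / (r + Num.sqrt (r ^+ 2 - x ^+ 2)))))).
  by apply/funext => y.
apply: (is_derive_eq hP).
rewrite /GRing.scale /= -/s !mulr1 !mulr0 !addr0.
have x2 : x ^+ 2 = r ^+ 2 - s ^+ 2 by rewrite s2; ring.
have den : 1 + (x / (r + s)) ^+ 2 = 2 * r / (r + s).
  by rewrite expr_div_n x2; field; rewrite gt_eqF.
rewrite den.
have -> : x * (- x / s) = - (r ^+ 2 - s ^+ 2) / s by rewrite -x2; field; rewrite gt_eqF.
by rewrite x2; field; rewrite !gt_eqF.
Qed.

Let sqrt_circle_continuous (r : R) : continuous (fun x : R => Num.sqrt (r ^+ 2 - x ^+ 2)).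
Proof.
move=> x; apply: (continuous_cvg _ (@sqrt_continuous R _)).
apply: cvgB; first exact: cvg_cst.
exact: (@exprn_continuous R 2 x).
Qed.

Lemma half_disc_primitive_continuous (r : R) : 0 < r ->
  continuous (half_disc_primitive r).
Proof.
move=> r0 x; have cs := @sqrt_circle_continuous r x.
have rs0 : r + Num.sqrt (r ^+ 2 - x ^+ 2) != 0.
  by rewrite gt_eqF// ltr_wpDr// sqrtr_ge0.
apply: cvgD; first by apply: cvgM; [exact: cvg_id|exact: cs].
apply: cvgM; first exact: cvg_cst.
apply: cvgM; first exact: cvg_cst.
apply: (continuous_cvg _ (@continuous_atan R _)).
apply: cvgM; first exact: cvg_id.
by apply: cvgV => //; apply: cvgD; [exact: cvg_cst|exact: cs].
Qed.

Lemma half_disc_integral (r : R) : 0 < r ->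
  (\int[lam]_(x in `[(- r)%R, r]) (2 * Num.sqrt (r ^+ 2 - x ^+ 2))%:E = (pi * r ^+ 2)%:E)%E.
Proof.
move=> r0; have cF := half_disc_primitive_continuous r0.
have dF x : x \in `](- r), r[ -> is_derive x 1 (half_disc_primitive r) (2 * Num.sqrt (r ^+ 2 - x ^+ 2)).
  by rewrite in_itv /= => xr; apply: half_disc_primitive_derive => //; rewrite ltr_norml.
rewrite (@continuous_FTC2 R _ (half_disc_primitive r)).
- rewrite /half_disc_primitive sqrrN subrr sqrtr0 addr0 !mulr0 !add0r mulNr divff ?gt_eqF//.
  by rewrite atanN atan1 -EFinB; congr (_%:E); field.
- by rewrite gtrN.
- apply: continuous_subspaceT => x; apply: cvgM; first exact: cvg_cst.
  exact: sqrt_circle_continuous.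
- split.
  + by move=> x /dF[].
  + by apply: cvg_at_right_filter; exact: cF.
  + by apply: cvg_at_left_filter; exact: cF.
- by move=> x xr; rewrite derive1E; have [_ ->] := dF x xr.
Qed.

Lemma measurable_disc (t : R) : measurable [set z | sqnorm z <= t].
Proof.
rewrite (_ : [set z | _] = sqnorm @^-1` `]-oo, t]%classic).
  by rewrite -(setTI (_ @^-1` _)); exact: measurable_sqnorm.
by apply/seteqP; split => z /=; rewrite in_itv.
Qed.

Lemma disc_area (t : R) : mu [set z | sqnorm z <= t] = (pi * Num.max 0 t)%:E.
Proof.
have [t0|t0] := ltP t 0.
  rewrite mulr0 (_ : [set z | _] = set0) ?measure0//.
  apply/seteqP; split => // z /=; rewrite leNgt => /negP[].
  by rewrite (lt_le_trans t0)// addr_ge0// sqr_ge0.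
have secE (x : R) : lam (xsection [set z | sqnorm z <= t] x) =
    (2 * Num.sqrt (t - x ^+ 2))%:E.
  rewrite (_ : xsection _ x = [set y | y ^+ 2 <= t - x ^+ 2]); last first.
    by apply/seteqP; split => y; rewrite /xsection /sqnorm /= inE /= lerBrDl.
  have [h|h] := leP 0 (t - x ^+ 2); last first.
    rewrite ler0_sqrtr ?ltW// mulr0 (_ : [set y | _] = set0) ?measure0//.
    apply/seteqP; split => // y /=; rewrite leNgt => /negP[].
    exact: lt_le_trans h (sqr_ge0 y).
  set s := Num.sqrt _; have s0 : 0 <= s by exact: sqrtr_ge0.
  have -> : [set y | y ^+ 2 <= t - x ^+ 2] = `[- s, s]%classic.
    apply/seteqP; split => y /=;
      rewrite in_itv /= -ler_norml -[`|y| <= s](@ler_pXn2r _ 2) ?nnegrE//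
        real_normK ?num_real// sqr_sqrtr//.
  rewrite lebesgue_measure_itv /= lte_fin; case: ltP => [_|hs].
    by rewrite -EFinB; congr (_%:E); ring.
  by have -> : s = 0; [lra|rewrite mulr0].
transitivity (\int[lam]_x (2 * Num.sqrt (t - x ^+ 2))%:E)%E.
  by apply: eq_integral => x _; rewrite /= secE.
have [t00|tn0] := eqVneq t 0.
  rewrite t00 mulr0; apply: integral0_eq => x _.
  by rewrite sub0r ler0_sqrtr ?mulr0// oppr_le0 sqr_ge0.
have t_gt0 : 0 < t by rewrite lt_def tn0.
pose r := Num.sqrt t; have r0 : 0 < r by rewrite sqrtr_gt0.
have r2 : r ^+ 2 = t by rewrite sqr_sqrtr.
rewrite -r2 -half_disc_integral// [RHS]integral_mkcond.
apply: eq_integral => x _; rewrite patchE.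
rewrite mem_setE in_itv /= -ler_norml; case: ifPn => // /negP xr.
rewrite ler0_sqrtr ?mulr0// subr_le0 -(real_normK (num_real x)).
by rewrite lerXn2r// ?nnegrE ?ltW// ltNge; exact/negP.
Qed.

Let mN : @measurable_fun _ _ (measurableTypeR R * measurableTypeR R)%type
  (measurableTypeR R) setT sqnorm.
Proof. exact: measurable_sqnorm. Qed.

Let annulus_area (a b : R) : a <= b ->
  mu (sqnorm @^-1` `]a, b]%classic) = (pi * Num.max 0 b - pi * Num.max 0 a)%:E.
Proof.
move=> ab; have fin_b : (mu [set z | sqnorm z <= b]%R < +oo)%E.
  by rewrite disc_area ltry.
rewrite (_ : _ @^-1` _ = [set z | sqnorm z <= b] `\` [set z | sqnorm z <= a]).
  rewrite measureD; [|exact: measurable_disc|exact: measurable_disc|].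
    rewrite (_ : _ `&` _ = [set z | sqnorm z <= a]).
      exact: (congr2 (fun u v => u - v)%E (disc_area b) (disc_area a)).
    by apply/seteqP; split => z /=; [case|move=> za; split=> //; exact: le_trans ab].
  exact: fin_b.
apply/seteqP; split => z /=; rewrite in_itv /= ltNge; first by move=> /andP[/negP].
by move=> [-> /negP ->].
Qed.

(** On half-open intervals [lam] agrees with the sum of [pi^-1] times the
    distribution of [sqnorm] and of the restriction of [lam] to the negative
    half line, where that distribution vanishes. *)
Lemma sqnorm_distribution (A : set R) : measurable A -> A `<=` `[0, +oo[ ->
  mu (sqnorm @^-1` A) = (pi%:E * lam A)%E.
Proof.
move=> mA A0; have pi0 : 0 <= (pi : R)^-1 by rewrite invr_ge0 pi_ge0.
pose k : {nonneg R} := NngNum pi0.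
pose m1 := measure_function_pushforward__canonical__measure_function_Measure mu mN.
have mneg : @measurable _ (measurableTypeR R) `]-oo, 0[%classic by exact: measurable_itv.
pose m : {measure set (measurableTypeR R) -> \bar R} := measure_add (mscale k m1) (mrestr lam mneg).
have mE X : m X = ((pi^-1)%:E * mu (sqnorm @^-1` X) + lam (X `&` `]-oo, 0%R[%classic))%E.
  exact: (measure_addE (mscale k m1) (mrestr lam mneg) X).
have h X : ocitv X -> lam X = m X.
  move=> [[a b] _ <-]; have [ba|ab] := leP b a.
    by rewrite set_itv_ge ?measure0// -leNgt.
  rewrite mE /= (annulus_area (ltW ab)) lebesgue_measure_itv /= lte_fin ab.
  rewrite -EFinM mulrBr !mulKf ?gt_eqF ?pi_gt0//.
  have [b0|b0] := ltP b 0.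
    rewrite setIidl; last first.
      by move=> x /=; rewrite !in_itv /= => /andP[_ xb]; exact: le_lt_trans b0.
    rewrite lebesgue_measure_itv /= lte_fin ab max_l; last by rewrite ltW// (lt_trans ab).
    by rewrite subrr add0e.
  have -> : (`]a, b] `&` `]-oo, 0[)%classic = `]a, 0[%classic.
    apply/seteqP; split => x /=; rewrite !in_itv /=.
      by move=> [/andP[-> _] ->].
    by move=> /andP[-> x0]; rewrite x0 (le_trans (ltW x0) b0).
  rewrite lebesgue_measure_itv /= lte_fin; have [a0|a0] := ltP a 0.
    by rewrite -!EFinB -EFinD; congr (_%:E); ring.
  by rewrite adde0.
have /= := lebesgue_measure_unique h mA; rewrite mE => ->.
rewrite (_ : A `&` _ = set0); last first.
  apply/seteqP; split => // x /= [/A0/=]; rewrite !in_itv /= andbT => x0.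
  by rewrite ltNge x0.
rewrite measure0 adde0 muleA -EFinM mulfV ?gt_eqF ?pi_gt0// mul1e.
by [].
Qed.

(** Polar coordinates, as a change of variables along the distribution of
    [sqnorm]. *)
Lemma radial_integral (A : set R) (phi : R -> \bar R) :
  measurable A -> A `<=` `[0, +oo[ -> measurable_fun A phi ->
  (forall t, A t -> (0 <= phi t)%E) ->
  (\int[mu]_(z in sqnorm @^-1` A) phi (sqnorm z) = pi%:E * \int[lam]_(t in A) phi t)%E.
Proof.
move=> mA A0 mphi phi0.
have pi0 : 0 <= (pi : R) by exact: pi_ge0.
pose k : {nonneg R} := NngNum pi0.
rewrite -(@ge0_integral_mscale _ _ _ lam A mA k)//.
rewrite -(ge0_integral_pushforward mN)//; last first.
  by move=> y /[!inE]; exact: phi0.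
apply: eq_measure_integral => B mB BA.
by rewrite /= /pushforward sqnorm_distribution//; exact: subset_trans BA A0.
Qed.

End DiscArea.

(** * Kernel coefficients and moments of the weights *)

Section KernelCoefficients.
Context {R : realType}.
Variables (kap nu : R).
Hypotheses (kap0 : 0 <= kap) (nu0 : 0 < nu).

(** The inverse squared norm of the [n]-th power of the variable. *)
Definition kcoef n : R := (\prod_(j < n) (nu + j.+1%:R * kap)) / n`!%:R.

Lemma kcoef0 : kcoef 0 = 1.
Proof. by rewrite /kcoef big_ord0 divr1. Qed.

Lemma kcoefS n : kcoef n.+1 = kcoef n * ((nu + n.+1%:R * kap) / n.+1%:R).
Proof.
rewrite /kcoef big_ord_recr /= factS natrM invfM.
by rewrite [n.+1%:R^-1 * _]mulrC !mulrA; congr (_ * _); rewrite mulrAC.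
Qed.

Let num_gt0 n : 0 < nu + n.+1%:R * kap.
Proof. by rewrite ltr_wpDr// mulr_ge0. Qed.

Lemma kcoef_gt0 n : 0 < kcoef n.
Proof. by rewrite divr_gt0 ?ltr0n ?fact_gt0// prodr_gt0. Qed.

(** The ratio of consecutive terms tends to [kap * x]. *)
Lemma kcoef_geometric (x : R) : 0 <= x -> kap * x < 1 ->
  exists y M : R, [/\ 0 < y, y < 1 & forall n, kcoef n * x ^+ n <= M * y ^+ n].
Proof.
move=> x0 kx; pose y := (1 + kap * x) / 2.
have kx0 : 0 <= kap * x by rewrite mulr_ge0.
have y0 : 0 < y by rewrite divr_gt0// ltr_wpDr.
have y1 : y < 1 by rewrite /y; lra.
have ky : kap * x < y by rewrite /y; lra.
pose N := (Num.truncn (nu * x / (y - kap * x))).+1.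
have hN n : (N <= n)%N -> (nu + n.+1%:R * kap) / n.+1%:R * x <= y.
  move=> Nn; have n0 : 0 < n.+1%:R :> R by rewrite ltr0n.
  rewrite mulrAC ler_pdivrMr// mulrDl -lerBrDr.
  have -> : y * n.+1%:R - n.+1%:R * kap * x = (y - kap * x) * n.+1%:R by ring.
  rewrite [leRHS]mulrC -ler_pdivrMr ?subr_gt0//; apply: ltW.
  apply: (@lt_le_trans _ _ N%:R); first exact: Num.Theory.truncnS_gt.
  by rewrite ler_nat ltnW.
exists y, (\sum_(i < N.+1) kcoef i * x ^+ i / y ^+ i); split => // n.
have pos i : 0 <= kcoef i * x ^+ i / y ^+ i.
  apply: divr_ge0; last by rewrite exprn_ge0// ltW.
  by apply: mulr_ge0; [exact: ltW (kcoef_gt0 i)|exact: exprn_ge0].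
have small i : (i <= N)%N -> kcoef i * x ^+ i <=
    (\sum_(i < N.+1) kcoef i * x ^+ i / y ^+ i) * y ^+ i.
  move=> iN; rewrite -ler_pdivrMr ?exprn_gt0//.
  have iN' : (i < N.+1)%N by [].
  by rewrite (bigD1 (Ordinal iN'))//= lerDl sumr_ge0.
elim: n => [|n ih]; first exact: small.
have [/small//|Nn] := leqP n.+1 N.
rewrite kcoefS [x ^+ _]exprS [y ^+ _]exprS.
have -> : kcoef n * ((nu + n.+1%:R * kap) / n.+1%:R) * (x * x ^+ n) =
    ((nu + n.+1%:R * kap) / n.+1%:R * x) * (kcoef n * x ^+ n).
  by move: (_ / n.+1%:R) => u; ring.
rewrite [leRHS]mulrCA; apply: ler_pM ih; [| |exact: hN].
- by apply: mulr_ge0 => //; apply: divr_ge0 => //; exact: ltW (num_gt0 n).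
- by apply: mulr_ge0; [exact: ltW (kcoef_gt0 n)|exact: exprn_ge0].
Qed.

Lemma cvg_kcoef_series (x : R) : 0 <= x -> kap * x < 1 ->
  cvgn (series (fun n => kcoef n * x ^+ n)).
Proof.
move=> x0 kx; have [y [M [y0 y1 hM]]] := kcoef_geometric x0 kx.
apply: (@series_le_cvg _ _ (geometric M y)) => [n|n|n|] /=.
- by apply: mulr_ge0; [exact: ltW (kcoef_gt0 n)|exact: exprn_ge0].
- apply: le_trans (hM n).
  by apply: mulr_ge0; [exact: ltW (kcoef_gt0 n)|exact: exprn_ge0].
- exact: hM.
- by apply: is_cvg_geometric_series; rewrite gtr0_norm.
Qed.

End KernelCoefficients.

(** The two families of weights at once: [kap] is the inverse square of the
    radius of the ball, or [0] for the whole space, and [w] is the weight as a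
    function of the squared modulus. The function [v], a primitive of
    [- nu * w] that is also a multiple of [w], yields the recursion for the
    moments of [w]. *)
Record radial_weight {R : realType} (kap nu : R) (w v : R -> R) : Prop := {
  rw_kap : 0 <= kap;
  rw_nu : 0 < nu;
  rw_measurable : measurable_fun setT w;
  rw_ge0 : forall t, 0 <= w t;
  rw_continuous : forall t, kap * t < 1 -> {for t, continuous w};
  rw_derive : forall t : R, kap * t < 1 -> is_derive t (1 : R) v (- nu * w t);
  rw_prim : forall t, kap * t < 1 -> v t = (1 - kap * t) * w t;
  rw_init : v 0 = 1;
  rw_end : forall n, ((kap + j.+1%:R^-1)^-1) ^+ n * v ((kap + j.+1%:R^-1)^-1)
    @[j --> \oo] --> (0 : R) }.

Section Moments.
Context {R : realType}.
Local Notation lam := (@lebesgue_measure R).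
Variables (kap nu : R) (w v : R -> R).
Hypothesis hw : radial_weight kap nu w v.
Let kap0 := rw_kap hw.
Let nu0 := rw_nu hw.

(** Squared radii of discs that exhaust the domain, whether or not it is
    bounded. *)
Definition exh_radius (j : nat) : R := (kap + j.+1%:R^-1)^-1.

Lemma exh_radius_gt0 j : 0 < exh_radius j.
Proof. by rewrite invr_gt0 ltr_wpDl// invr_gt0 ltr0n. Qed.

Lemma exh_radius_dom j t : t <= exh_radius j -> kap * t < 1.
Proof.
move=> tT; have d0 : 0 < kap + j.+1%:R^-1 by rewrite ltr_wpDl// invr_gt0 ltr0n.
rewrite (le_lt_trans (ler_wpM2l kap0 tT))// /exh_radius ltr_pdivrMr// mul1r.
by rewrite ltrDl invr_gt0 ltr0n.
Qed.

Lemma exh_radius_near t : kap * t < 1 -> \forall j \near \oo, t < exh_radius j.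
Proof.
move=> kt; have [t0|t0] := leP t 0.
  by apply: nearW => j; exact: le_lt_trans (exh_radius_gt0 j).
have : \forall j \near \oo, (j.+1%:R^-1 : R) < t^-1 - kap.
  have h : 0 < t^-1 - kap by rewrite subr_gt0 -[t^-1]mul1r ltr_pdivlMr.
  exact: (cvgr_lt _ cvg_harmonic).
apply: filterS => j hj; rewrite -[t]invrK ltf_pV2 ?posrE ?invr_gt0//.
  by rewrite -ltrBrDl.
by rewrite ltr_wpDl// invr_gt0 ltr0n.
Qed.

Lemma exh_radius_nd i j : (i <= j)%N -> exh_radius i <= exh_radius j.
Proof.
move=> ij; rewrite lef_pV2 ?posrE ?ltr_wpDl ?invr_gt0 ?ltr0n//.
by rewrite lerD2l lef_pV2 ?posrE ?ltr0n// ler_nat.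
Qed.

Definition moment n (T : R) : R := (\int[lam]_(t in `[0%R, T]) (t ^+ n * w t))%R.

Lemma moment_integrable n (T : R) : kap * T < 1 ->
  lam.-integrable `[0, T] (EFin \o (fun t => t ^+ n * w t)).
Proof.
move=> kT; apply: continuous_compact_integrable; first exact: segment_compact.
apply: continuous_in_subspaceT => t; rewrite inE /= in_itv /= => /andP[t0 tT].
apply: cvgM; first exact: exprn_continuous.
by apply: rw_continuous hw _ _; apply: le_lt_trans kT; exact: ler_wpM2l.
Qed.

(** The fundamental theorem of calculus for [t ^+ n * v t]. *)
Lemma moment_rec n (T : R) : 0 < T -> kap * T < 1 ->
  (nu + n%:R * kap) * moment n T =
    n%:R * moment n.-1 T + (n == 0%N)%:R - T ^+ n * v T.
Proof.
move=> T0 kT; pose F (t : R) := t ^+ n * v t.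
pose g t := n%:R * (t ^+ n.-1 * w t) - (nu + n%:R * kap) * (t ^+ n * w t).
have dom t : t <= T -> kap * t < 1.
  by move=> tT; apply: le_lt_trans kT; exact: ler_wpM2l.
have dF (t : R) : t <= T -> is_derive t (1 : R) F (g t).
  move=> /dom kt.
  have h0 : is_derive t (1 : R) (@GRing.exp R ^~ n) (n%:R *: t ^+ n.-1 *: (1 : R)).
    by apply: DeriveDef; [exact: exprn_derivable|exact: exp_derive].
  apply: (is_derive_eq (is_deriveM h0 (rw_derive hw kt))).
  rewrite (rw_prim hw kt) /g /GRing.scale /= mulr1.
  have hn : n%:R * t ^+ n = n%:R * (t ^+ n.-1 * t).
    by case: (n) => [|m]; rewrite ?mul0r// -exprSr.
  have := congr1 (fun u => kap * w t * u) hn.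
  by move: (t ^+ n) (t ^+ n.-1) (n%:R : R) => x y z; lra.
have cF (t : R) : t <= T -> {for t, continuous F}.
  by move=> /dF[dFt _]; apply: differentiable_continuous; exact/derivable1_diffP.
have cg : {within `[0, T], continuous g}.
  apply: continuous_in_subspaceT => t; rewrite inE /= in_itv /= => /andP[_ /dom kt].
  by apply: cvgB; apply: cvgM; [exact: cvg_cst| |exact: cvg_cst|];
    (apply: cvgM; [exact: exprn_continuous|exact: rw_continuous hw _ kt]).
have := continuous_FTC2 (f := g) (F := F) T0 cg.
have FT : derivable_oo_LRcontinuous F 0 T.
  split.
  - by move=> t; rewrite in_itv /= => /andP[_ /ltW/dF[]].
  - by apply: cvg_at_right_filter; apply: cF; exact: ltW.
  - by apply: cvg_at_left_filter; apply: cF.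
have Fg : {in `]0, T[, derive1 F =1 g}.
  by move=> t; rewrite in_itv /= => /andP[_ /ltW/dF[_ Dt]]; rewrite derive1E.
move=> /(_ FT Fg) /(congr1 fine); rewrite -EFinB /=.
have -> : fine (\int[lam]_(t in `[0%R, T]) (g t)%:E)%E =
    n%:R * moment n.-1 T - (nu + n%:R * kap) * moment n T.
  rewrite -[LHS]/(\int[lam]_(t in `[0%R, T]) g t)%R.
  have mI : @measurable _ (measurableTypeR R) `[0, T]%classic by exact: measurable_itv.
  rewrite RintegralB//; last 2 first.
  - exact: (integrableZl mI n%:R (moment_integrable n.-1 kT)).
  - exact: (integrableZl mI (nu + n%:R * kap) (moment_integrable n kT)).
  by rewrite !RintegralZl//; exact: moment_integrable.
rewrite {2}/F (rw_init hw) mulr1 expr0n => e.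
by rewrite /F in e; move: e; lra.
Qed.

(** The boundary term of [moment_rec] vanishes in the limit, which leaves the
    recursion of the inverses of the [kcoef]. *)
Lemma moment_cvg n :
  nu * moment n (exh_radius j) @[j --> \oo] --> (kcoef kap nu n)^-1.
Proof.
elim: n => [|n ih].
  rewrite kcoef0 invr1.
  have -> : (fun j => nu * moment 0 (exh_radius j)) =
      (fun j => 1 - exh_radius j ^+ 0 * v (exh_radius j)).
    apply/funext => j; have := moment_rec 0 (exh_radius_gt0 j) (exh_radius_dom (lexx _)).
    by rewrite !mul0r addr0 add0r.
  rewrite -[X in _ --> X](subr0 1); apply: cvgB; first exact: cvg_cst.
  exact: rw_end hw 0%N.
have d0 : nu + n.+1%:R * kap != 0 by rewrite gt_eqF// ltr_wpDr// mulr_ge0.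
have -> : (fun j => nu * moment n.+1 (exh_radius j)) = (fun j =>
   n.+1%:R / (nu + n.+1%:R * kap) * (nu * moment n (exh_radius j)) -
   nu / (nu + n.+1%:R * kap) * (exh_radius j ^+ n.+1 * v (exh_radius j))).
  apply/funext => j; have := moment_rec n.+1 (exh_radius_gt0 j) (exh_radius_dom (lexx _)).
  rewrite /= addr0 => h; apply: (mulfI d0); rewrite mulrCA h; field.
  by rewrite [1 + _]addrC natr1.
have -> : (kcoef kap nu n.+1)^-1 = n.+1%:R / (nu + n.+1%:R * kap) * (kcoef kap nu n)^-1
    - nu / (nu + n.+1%:R * kap) * 0.
  by rewrite mulr0 subr0 kcoefS invfM mulrC; congr (_ * _); exact: invf_div.
apply: cvgB; apply: cvgMl_tmp => //; exact: (rw_end hw n.+1).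
Qed.

End Moments.

(** * Integrals of quaternion-valued functions *)

Section QuaternionIntegral.
Context {R : realType}.
Local Notation plane := (measurableTypeR R * measurableTypeR R)%type.
Local Notation mu := ((@lebesgue_measure R \x @lebesgue_measure R)%E).
Implicit Types (D : set plane) (F G : R * R -> quat R) (g : R * R -> R).

Definition qmeasurable D F := forall l, measurable_fun D (fun z : plane => F z 0 l).

Definition qintegrable D F := forall l, mu.-integrable D (EFin \o (fun z => F z 0 l)).

Lemma forall_ord4 (P : 'I_4 -> Prop) : P 0 -> P 1 -> P 2 -> P 3 -> forall l, P l.
Proof.
move=> p0 p1 p2 p3 [[|[|[|[|//]]]] hl].
- by rewrite (_ : Ordinal hl = 0) //; exact/val_inj.
- by rewrite (_ : Ordinal hl = 1) //; exact/val_inj.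
- by rewrite (_ : Ordinal hl = 2) //; exact/val_inj.
- by rewrite (_ : Ordinal hl = 3) //; exact/val_inj.
Qed.

Lemma qmeasurable_cst D (a : quat R) : qmeasurable D (fun=> a).
Proof. by move=> l; exact: measurable_cst. Qed.

Lemma qmeasurableD D F G : qmeasurable D F -> qmeasurable D G ->
  qmeasurable D (fun z => F z + G z).
Proof.
move=> mF mG l; under eq_fun do rewrite quatDE.
exact: measurable_funD (mF l) (mG l).
Qed.

Lemma qmeasurableZ D g F : measurable_fun D (g : plane -> R) -> qmeasurable D F ->
  qmeasurable D (fun z => g z *: F z).
Proof.
move=> mg mF l; under eq_fun do rewrite quatZE.
exact: measurable_funM mg (mF l).
Qed.

Lemma qmeasurableM D F G : qmeasurable D F -> qmeasurable D G ->
  qmeasurable D (fun z => F z * G z).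
Proof.
move=> mF mG; have mm i j : measurable_fun D (fun z : plane => F z 0 i * G z 0 j).
  exact: measurable_funM (mF i) (mG j).
apply: forall_ord4.
- under eq_fun do rewrite quatE0.
  exact: measurable_funB (measurable_funB (measurable_funB (mm _ _) (mm _ _)) (mm _ _)) (mm _ _).
- under eq_fun do rewrite quatE1.
  exact: measurable_funB (measurable_funD (measurable_funD (mm _ _) (mm _ _)) (mm _ _)) (mm _ _).
- under eq_fun do rewrite quatE2.
  exact: measurable_funD (measurable_funD (measurable_funB (mm _ _) (mm _ _)) (mm _ _)) (mm _ _).
- under eq_fun do rewrite quatE3.
  exact: measurable_funD (measurable_funB (measurable_funD (mm _ _) (mm _ _)) (mm _ _)) (mm _ _).
Qed.

Lemma qmeasurableX D F n : qmeasurable D F -> qmeasurable D (fun z => F z ^+ n).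
Proof.
move=> mF; elim: n => [|n ih].
  by under eq_fun do rewrite expr0; exact: qmeasurable_cst.
by under eq_fun do rewrite exprS; exact: qmeasurableM.
Qed.

Lemma qmeasurable_conj D F : qmeasurable D F -> qmeasurable D (fun z => qconj (F z)).
Proof.
move=> mF; apply: forall_ord4; under eq_fun do rewrite quatE; first exact: mF.
- exact: measurable_funN (mF 1).
- exact: measurable_funN (mF 2).
- exact: measurable_funN (mF 3).
Qed.

Lemma qmeasurable_slice D (I : quat R) : qmeasurable D (slice I).
Proof.
apply: qmeasurableD; apply: qmeasurableZ; try exact: qmeasurable_cst.
  exact: measurable_funTS measurable_fst.
exact: measurable_funTS measurable_snd.
Qed.

Lemma qmeasurable_cvg D (F_ : nat -> R * R -> quat R) F :
  (forall n, qmeasurable D (F_ n)) -> (forall z, D z -> F_ n z @[n --> \oo] --> F z) ->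
  qmeasurable D F.
Proof.
move=> mF cF l; apply: (@measurable_fun_cvg _ _ _ _ (fun n z => F_ n z 0 l)).
  by move=> n; exact: mF.
by move=> z Dz; apply: cvg_qcoord; exact: cF.
Qed.

Lemma qmeasurable_sum D n (F_ : nat -> R * R -> quat R) :
  (forall i, qmeasurable D (F_ i)) -> qmeasurable D (fun z => \sum_(i < n) F_ i z).
Proof.
move=> mF; elim: n => [|n ih].
  by under eq_fun do rewrite big_ord0; exact: qmeasurable_cst.
by under eq_fun do rewrite big_ord_recr; exact: qmeasurableD.
Qed.

Lemma measurable_qmod2 D F : qmeasurable D F ->
  measurable_fun D (fun z : plane => qmod (F z) ^+ 2).
Proof.
move=> mF; under eq_fun do rewrite qmodE.
by do 3 (apply: measurable_funD; last by apply: measurable_funX; exact: mF);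
  apply: measurable_funX; exact: mF.
Qed.

Lemma qintegrable_le D F g : measurable D -> qmeasurable D F ->
  mu.-integrable D (EFin \o g) -> (forall z, D z -> qmod (F z) <= g z) ->
  qintegrable D F.
Proof.
move=> mD mF ig Fg l; apply: (le_integrable mD _ _ ig).
  by apply/measurable_EFinP; exact: mF.
move=> z Dz /=; rewrite lee_fin (le_trans (qcoord_le _ _))//.
by rewrite (le_trans (Fg _ Dz))// ler_norm.
Qed.

Let qintegral_linear_aux D F (L : quat R -> quat R) : measurable D -> linear L ->
  qintegrable D F -> qintegrable D (L \o F) /\ qintegral D (L \o F) = L (qintegral D F).
Proof.
move=> mD hL iF.
have intE l (s : seq 'I_4) : mu.-integrable D
      (EFin \o (fun z => \sum_(m <- s) F z 0 m * L (delta_mx 0 m) 0 l)) /\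
    (\int[mu]_(z in D) (\sum_(m <- s) F z 0 m * L (delta_mx 0 m) 0 l) =
     \sum_(m <- s) (qintegral D F) 0 m * L (delta_mx 0 m) 0 l)%R.
  elim: s => [|m s [ih1 ih2]].
    split.
      by under eq_fun do rewrite big_nil; exact: integrable0.
    by rewrite big_nil; under eq_Rintegral do rewrite big_nil; rewrite /Rintegral integral0.
  have im : mu.-integrable D (EFin \o (fun z => F z 0 m * L (delta_mx 0 m) 0 l)).
    exact: (integrableZr mD (L (delta_mx 0 m) 0 l) (iF m)).
  split.
    under eq_fun do rewrite big_cons.
    exact: (integrableD mD im ih1).
  rewrite big_cons -ih2; under eq_Rintegral do rewrite big_cons.
  rewrite (RintegralD mD im ih1); congr (_ + _).
  by rewrite (RintegralZr _ mD (iF m)) mxE.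
split=> [l|].
  under eq_fun do rewrite /= (quat_linear_coord _ _ hL).
  exact: (intE l _).1.
apply/rowP => l; rewrite (quat_linear_coord _ _ hL) mxE -(intE l _).2.
by apply: eq_Rintegral => z _ /=; exact: quat_linear_coord.
Qed.

Lemma qintegrable_linear D F (L : quat R -> quat R) : measurable D -> linear L ->
  qintegrable D F -> qintegrable D (L \o F).
Proof. by move=> mD hL /(qintegral_linear_aux mD hL)[]. Qed.

Lemma qintegral_linear D F (L : quat R -> quat R) : measurable D -> linear L ->
  qintegrable D F -> qintegral D (L \o F) = L (qintegral D F).
Proof. by move=> mD hL /(qintegral_linear_aux mD hL)[]. Qed.

Lemma qintegralD D F G : measurable D -> qintegrable D F -> qintegrable D G ->
  qintegrable D (fun z => F z + G z) /\
  qintegral D (fun z => F z + G z) = qintegral D F + qintegral D G.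
Proof.
move=> mD iF iG; split=> [l|].
  under eq_fun do rewrite quatDE.
  exact: (integrableD mD (iF l) (iG l)).
apply/rowP => l; rewrite !mxE; under eq_Rintegral do rewrite quatDE.
exact: RintegralD (iF l) (iG l).
Qed.

Lemma qintegral_sum D n (F_ : nat -> R * R -> quat R) : measurable D ->
  (forall i, qintegrable D (F_ i)) ->
  qintegral D (fun z => \sum_(i < n) F_ i z) = \sum_(i < n) qintegral D (F_ i).
Proof.
move=> mD iF.
suff : qintegrable D (fun z => \sum_(i < n) F_ i z) /\
  qintegral D (fun z => \sum_(i < n) F_ i z) = \sum_(i < n) qintegral D (F_ i) by case.
elim: n => [|n [ih1 ih2]].
  have -> : (fun z => \sum_(i < 0) F_ i z) = (fun=> 0).
    by apply/funext => z; rewrite big_ord0.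
  rewrite big_ord0; split => [l|].
    have -> : EFin \o (fun=> (0 : quat R) 0 l) = cst 0%E :> (plane -> \bar R).
      by apply/funext => z; rewrite /= mxE.
    exact: integrable0.
  apply/rowP => l; rewrite !mxE /Rintegral integral0_eq//.
under eq_fun do rewrite big_ord_recr; rewrite big_ord_recr /= -ih2.
exact: qintegralD.
Qed.

Lemma eq_qintegral D F G : (forall z, D z -> F z = G z) ->
  qintegral D F = qintegral D G.
Proof.
move=> FG; apply/rowP => l; rewrite !mxE; apply: eq_Rintegral => z /[!inE] Dz.
by rewrite FG.
Qed.

Lemma qintegral_cvg D (F_ : nat -> R * R -> quat R) F g : measurable D ->
  (forall n, qmeasurable D (F_ n)) ->
  (forall z, D z -> F_ n z @[n --> \oo] --> F z) ->
  mu.-integrable D (EFin \o g) ->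
  (forall n z, D z -> qmod (F_ n z) <= g z) ->
  qintegral D (F_ n) @[n --> \oo] --> qintegral D F.
Proof.
move=> mD mF cF ig Fg; apply: cvg_quatP => l.
under eq_fun do rewrite mxE; rewrite mxE.
have mFl : measurable_fun D (fun z : plane => F z 0 l) by exact: qmeasurable_cvg mF cF l.
have [] := @dominated_convergence _ _ R mu D mD
  (fun n z => (F_ n z 0 l)%:E) (fun z => (F z 0 l)%:E) (EFin \o g).
- by move=> n; apply/measurable_EFinP; exact: mF.
- exact/measurable_EFinP.
- apply: aeW => z Dz; apply: cvg_EFin; first exact: nearW.
  by apply: cvg_qcoord; exact: cF.
- exact: ig.
- apply: aeW => z n Dz /=; rewrite lee_fin (le_trans (qcoord_le _ _))//.
  exact: Fg.
move=> iF _ cv; rewrite -(fineK (integrable_fin_num mD iF)) in cv.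
exact: fine_cvg cv.
Qed.

Lemma qintegral_preserving D F (phi : R * R -> R * R) : measurable D ->
  measure_preserving mu (phi : plane -> plane) -> phi @^-1` D = D ->
  qmeasurable setT F -> qintegrable D (F \o phi) ->
  qintegral D (F \o phi) = qintegral D F.
Proof.
move=> mD [mphi hphi] phiD mF iF; apply/rowP => l; rewrite !mxE /Rintegral; congr fine.
have h := @integral_pushforward _ _ plane plane R phi mphi mu D (EFin \o (fun z => F z 0 l)).
rewrite phiD in h; have mF' : measurable_fun setT (EFin \o (fun z : plane => F z 0 l)).
  by apply/measurable_EFinP; exact: mF.
have := h mF' (iF l) mD => <-.
by apply: eq_measure_integral => A mA _; exact: hphi.
Qed.

End QuaternionIntegral.

(** * Radial weights on a slice *)

Section Weighted.
Context {R : realType}.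
Local Notation plane := (measurableTypeR R * measurableTypeR R)%type.
Local Notation lam := (@lebesgue_measure R).
Local Notation mu := ((lam \x lam)%E).
Variables (kap nu : R) (w v : R -> R).
Hypothesis hw : radial_weight kap nu w v.
Let kap0 := rw_kap hw.
Let nu0 := rw_nu hw.
Local Notation T := (exh_radius kap).
Local Notation c := (kcoef kap nu).

(** The ball of squared radius [kap^-1], or the whole space when [kap] is 0;
    [wplane] is its trace on a slice. *)
Definition wdomain : set (quat R) := [set q | kap * qmod q ^+ 2 < 1].
Definition wplane : set plane := [set z | kap * sqnorm z < 1].
Definition wdisc j : set plane := [set z | sqnorm z <= T j].
Definition wdensity (z : R * R) : R := nu / pi * w (sqnorm z).

Lemma slice_wdomain (I : quat R) : imag_unit I -> slice I @^-1` wdomain = wplane.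
Proof.
by move=> hI; apply/seteqP; split => z; rewrite /wdomain /wplane /= qmod_slice.
Qed.

Lemma sqnorm_ge0 (z : R * R) : 0 <= sqnorm z.
Proof. by rewrite addr_ge0// sqr_ge0. Qed.

Lemma wdensity_ge0 z : 0 <= wdensity z.
Proof.
apply: mulr_ge0; last exact: (rw_ge0 hw).
by apply: divr_ge0; [exact: ltW|exact: pi_ge0].
Qed.

Lemma measurable_wdensity D : measurable_fun D (wdensity : plane -> R).
Proof.
apply: measurable_funTS; apply: measurable_funM; first exact: measurable_cst.
exact: measurableT_comp (rw_measurable hw) measurable_sqnorm.
Qed.

Lemma measurable_wdisc j : measurable (wdisc j).
Proof. exact: measurable_disc. Qed.

Lemma wplane_bigcup : wplane = \bigcup_j wdisc j.
Proof.
apply/seteqP; split => z.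
  move=> /(exh_radius_near hw)[j _ hj]; exists j => //.
  by apply: ltW; apply: hj => /=.
by move=> [j _ zj]; apply: (exh_radius_dom hw (j := j)); exact: zj.
Qed.

Lemma wdisc_sub j : wdisc j `<=` wplane.
Proof. by rewrite wplane_bigcup; exact: bigcup_sup. Qed.

Lemma measurable_wplane : measurable wplane.
Proof. by rewrite wplane_bigcup; apply: bigcup_measurable => j _; exact: measurable_wdisc. Qed.

Lemma wdisc_nd : nondecreasing_seq wdisc.
Proof.
move=> i j ij; apply/subsetPset => z; rewrite /wdisc /= => /le_trans; apply.
exact: (exh_radius_nd hw).
Qed.

Lemma measurable_moment_fun D n :
  measurable_fun D (fun z : plane => sqnorm z ^+ n * wdensity z).
Proof.
apply: measurable_funM; last exact: measurable_wdensity.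
by apply: measurable_funX; apply: measurable_funTS; exact: measurable_sqnorm.
Qed.

Lemma moment_fun_ge0 n z : 0 <= sqnorm z ^+ n * wdensity z.
Proof. by rewrite mulr_ge0 ?wdensity_ge0// exprn_ge0// sqnorm_ge0. Qed.

Lemma wdisc_moment n j : (\int[mu]_(z in wdisc j) (sqnorm z ^+ n * wdensity z)%:E =
  (nu * moment w n (T j))%:E)%E.
Proof.
have Tdom : kap * T j < 1 by exact: (exh_radius_dom hw (lexx _)).
have -> : wdisc j = sqnorm @^-1` `[0, T j]%classic.
  by apply/seteqP; split => z; rewrite /wdisc /= in_itv /= sqnorm_ge0.
have pi0 : 0 < (pi : R) by exact: pi_gt0.
have mI : @measurable _ (measurableTypeR R) `[0, T j]%classic by exact: measurable_itv.
have im := moment_integrable hw n Tdom.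
have np0 : 0 <= nu / pi :> R by apply: divr_ge0; exact: ltW.
transitivity (\int[mu]_(z in sqnorm @^-1` `[0%R, T j]%classic)
    ((fun t : R => (nu / pi)%:E * (t ^+ n * w t)%:E) (sqnorm z)))%E.
  by apply: eq_integral => z _; rewrite -EFinM /wdensity; congr (_%:E); ring.
rewrite (@radial_integral R `[0, T j]%classic (fun t : R => (nu / pi)%:E * (t ^+ n * w t)%:E)%E)//.
- rewrite integralZl//.
  have -> : (\int[lam]_(t in `[0%R, T j]) (t ^+ n * w t)%:E = (moment w n (T j))%:E)%E.
    by rewrite /moment /Rintegral fineK//; have := integrable_fin_num mI im.
  by rewrite -!EFinM mulrA [pi * _]mulrC divfK// gt_eqF.
- by move=> t /=; rewrite !in_itv /= andbT => /andP[].
- apply/measurable_EFinP; apply: measurable_funM; first exact: measurable_cst.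
  by apply: measurable_funM; [exact: measurable_funX|exact: measurable_funTS (rw_measurable hw)].
- move=> t /=; rewrite in_itv /= => /andP[t0 _].
  rewrite -EFinM lee_fin; apply: mulr_ge0 => //; apply: mulr_ge0; first exact: exprn_ge0.
  exact: (rw_ge0 hw).
Qed.

Lemma wplane_moment n : (\int[mu]_(z in wplane) (sqnorm z ^+ n * wdensity z)%:E =
  ((c n)^-1)%:E)%E.
Proof.
have h : (\int[mu]_(z in wdisc j) (sqnorm z ^+ n * wdensity z)%:E)%E @[j --> \oo] -->
    (\int[mu]_(z in \bigcup_j wdisc j) (sqnorm z ^+ n * wdensity z)%:E)%E.
  apply: ge0_nondecreasing_set_cvg_integral.
  - exact: wdisc_nd.
  - exact: measurable_wdisc.
  - by move=> i; apply/measurable_EFinP; exact: measurable_moment_fun.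
  - by move=> i z _; rewrite lee_fin moment_fun_ge0.
rewrite wplane_bigcup; apply: (cvg_unique _ h) => //.
have -> : (fun j => \int[mu]_(z in wdisc j) (sqnorm z ^+ n * wdensity z)%:E)%E =
    (fun j => (nu * moment w n (T j))%:E).
  by apply/funext => j; exact: wdisc_moment.
apply: cvg_EFin; first exact: nearW.
exact: moment_cvg hw n.
Qed.

Lemma wplane_moment_integrable n :
  mu.-integrable wplane (EFin \o (fun z => sqnorm z ^+ n * wdensity z)).
Proof.
apply/integrableP; split; first by apply/measurable_EFinP; exact: measurable_moment_fun.
under eq_integral do rewrite /= ger0_norm ?moment_fun_ge0//.
by rewrite wplane_moment ltry.
Qed.

End Weighted.

(** * Orthogonality of the powers *)

Section Orthogonality.
Context {R : realType}.
Local Notation plane := (measurableTypeR R * measurableTypeR R)%type.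
Local Notation mu := ((@lebesgue_measure R \x @lebesgue_measure R)%E).
Variables (kap nu : R) (w v : R -> R).
Hypothesis hw : radial_weight kap nu w v.
Local Notation T := (exh_radius kap).
Local Notation c := (kcoef kap nu).
Local Notation dens := (wdensity nu w).
Local Notation disc := (wdisc kap).
Local Notation dom := (wplane kap).
Variable I : quat R.
Hypothesis hI : imag_unit I.
Local Notation sl := (slice I).

Lemma qmod_slice_sqnorm z : qmod (sl z) ^+ 2 = sqnorm z.
Proof. exact: qmod_slice. Qed.

Lemma conj_slice_comm z u : GRing.comm (qconj (sl z)) (sl u).
Proof. by rewrite /GRing.comm slice_conj// slice_comm. Qed.

Lemma conj_slice_mul z : qconj (sl z) * sl z = (sqnorm z)%:A.
Proof.
rewrite slice_conj// sliceM//= /slice /=.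
have -> : z.1 * z.2 + - z.2 * z.1 = 0 by ring.
by rewrite scale0r addr0 /sqnorm !expr2 mulNr opprK.
Qed.

Lemma qintegrable_wdisc j (F : R * R -> quat R) (B : R) : qmeasurable (disc j) F ->
  (forall z, disc j z -> qmod (F z) <= B) ->
  qintegrable (disc j) (fun z => dens z *: F z).
Proof.
move=> mF FB; apply: (qintegrable_le (g := fun z => sqnorm z ^+ 0 * dens z * B)).
- exact: measurable_wdisc.
- by apply: qmeasurableZ => //; exact: (measurable_wdensity hw).
- apply: (integrableZr (measurable_wdisc _ _) B (f := EFin \o (fun z => sqnorm z ^+ 0 * dens z))).
  apply: (integrableS (measurable_wplane hw) (measurable_wdisc _ _) (wdisc_sub hw (j := j))).
  exact: (wplane_moment_integrable hw 0).
- move=> z zj; rewrite expr0 mul1r qmodZ ger0_norm ?(wdensity_ge0 hw)//.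
  by apply: ler_wpM2l; [exact: (wdensity_ge0 hw)|exact: FB].
Qed.

Lemma qmod_slice_wdisc j z : disc j z -> qmod (sl z) <= Num.sqrt (T j).
Proof.
move=> zj; rewrite -(ger0_norm (qmod_ge0 (sl z))) -sqrtr_sqr ler_wsqrtr//.
by rewrite qmod_slice_sqnorm.
Qed.

Definition monomial_pair n m (z : R * R) : quat R := qconj (sl z) ^+ n * sl z ^+ m.

Lemma qmeasurable_monomial_pair D n m : qmeasurable D (monomial_pair n m).
Proof.
apply: qmeasurableM; apply: qmeasurableX; last exact: qmeasurable_slice.
by apply: qmeasurable_conj; exact: qmeasurable_slice.
Qed.

Lemma qmod_monomial_pair n m z : qmod (monomial_pair n m z) = qmod (sl z) ^+ (n + m).
Proof. by rewrite qmodM !qmodX qmod_conj exprD. Qed.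

Lemma qintegrable_monomial_pair j n m :
  qintegrable (disc j) (fun z => dens z *: monomial_pair n m z).
Proof.
apply: (@qintegrable_wdisc _ _ (Num.sqrt (T j) ^+ (n + m))).
  exact: qmeasurable_monomial_pair.
move=> z zj; rewrite qmod_monomial_pair lerXn2r// ?nnegrE ?sqrtr_ge0//.
exact: qmod_slice_wdisc.
Qed.

Lemma slice_rotation a z : sl (rotation (cos a) (sin a) z) = cis I a * sl z.
Proof. by rewrite /cis sliceM//= /rotation; congr (slice I (_, _)); ring. Qed.

Lemma sqnorm_rotation a z : sqnorm (rotation (cos a) (sin a) z) = sqnorm z :> R.
Proof.
rewrite -!(qmod_slice_sqnorm) slice_rotation qmodM qmod_cis//; by rewrite mul1r.
Qed.

Lemma monomial_pair_rotation a n m z :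
  monomial_pair n m (rotation (cos a) (sin a) z) =
  cis I (a *+ m - a *+ n) * monomial_pair n m z.
Proof.
have cE : qconj (cis I a) = cis I (- a).
  by rewrite /cis slice_conj//= cosN sinN.
rewrite /monomial_pair slice_rotation qconjM cE.
have ez : cis I a * sl z = sl z * cis I a by rewrite /cis slice_comm.
have e1 : GRing.comm (qconj (sl z)) (cis I (- a)) by exact: conj_slice_comm.
rewrite (exprMn_comm _ e1) (exprMn_comm _ ez) -!cisMn// mulNrn.
have e2 b : qconj (sl z) ^+ n * cis I b = cis I b * qconj (sl z) ^+ n.
  have : GRing.comm (cis I b) (qconj (sl z) ^+ n); last by move=> ->.
  by apply: commrX; apply: commr_sym; exact: conj_slice_comm.
by rewrite e2 -mulrA [qconj _ ^+ n * (_ * _)]mulrA e2 !mulrA -cisD// addrC.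
Qed.

(** The rotation by a suitable angle multiplies the integrand by a unit
    complex number other than 1. *)
Lemma monomial_orthogonal j n m : n != m ->
  qintegral (disc j) (fun z => dens z *: monomial_pair n m z) = 0.
Proof.
move=> nm; pose F z := dens z *: monomial_pair n m z.
(* The total angle is a quarter turn; [cos a != -1] is required by
   [rotation_preserving]. *)
have [a [c1 u1]] : exists a, cos a != -1 /\ cis I (a *+ m - a *+ n) != 1.
  have p2 : 0 < (pi : R) / 2 < pi *+ 2.
    have := pi_gt0 R; move: (pi : R) => x x0.
    by rewrite [x *+ 2]mulr2n; apply/andP; split; lra.
  have hpos k : (0 < k)%N -> let a := (pi : R) / 2 / k%:R in
      cos a != -1 /\ a *+ k = pi / 2.
    move=> k0 a; split.
      rewrite gt_eqF// (lt_le_trans (ltrN10 R))//; apply: cos_ge0_pihalf.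
      have a0 : 0 <= a by rewrite divr_ge0// divr_ge0// pi_ge0.
      rewrite (le_trans _ a0) ?oppr_le0 ?divr_ge0 ?pi_ge0//=.
      by rewrite ler_pdivrMr ?ltr0n// ler_peMr ?divr_ge0 ?pi_ge0// ler1n.
    by rewrite -mulr_natr divfK// pnatr_eq0 -lt0n.
  have [nm'|mn'|/eqP] := ltngtP n m; last by rewrite (negPf nm).
  - have k0 : (0 < m - n)%N by rewrite subn_gt0.
    have [h1 h2] := hpos _ k0; exists (pi / 2 / (m - n)%:R); split => //.
    by rewrite -mulrnBr 1?ltnW// h2; exact: cis_neq1.
  - have k0 : (0 < n - m)%N by rewrite subn_gt0.
    have [h1 h2] := hpos _ k0; exists (pi / 2 / (n - m)%:R); split => //.
    rewrite -opprB -mulrnBr 1?ltnW// h2; apply: contra (cis_neq1 hI p2) => /eqP h.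
    by have := cisNK (pi / 2) hI; rewrite h mulr1 => ->.
set U := cis I _ in u1.
have FU : F \o rotation (cos a) (sin a) = (fun q => U * q) \o F.
  apply/funext => z; rewrite /F /= monomial_pair_rotation -/U.
  by rewrite /wdensity sqnorm_rotation scalerAr.
have iF : qintegrable (disc j) F by exact: qintegrable_monomial_pair.
have e : qintegral (disc j) F = U * qintegral (disc j) F.
  rewrite -(qintegral_linear (measurable_wdisc _ _) (linear_mulql U) iF) -FU.
  apply/esym; apply: qintegral_preserving.
  - exact: measurable_wdisc.
  - by apply: rotation_preserving => //; exact: cos2Dsin2.
  - by apply/seteqP; split => z; rewrite /wdisc /= sqnorm_rotation.
  - apply: qmeasurableZ; first exact: (measurable_wdensity hw).
    exact: qmeasurable_monomial_pair.
  - rewrite FU; apply: (qintegrable_linear (measurable_wdisc _ _) (linear_mulql U)).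
    exact: iF.
apply/eqP; apply: contraT => /qmod_gt0 x0.
have : qmod ((U - 1) * qintegral (disc j) F) = 0.
  by rewrite mulrBl mul1r -e subrr qmod0.
rewrite qmodM => /eqP; rewrite mulf_eq0 [qmod (qintegral _ _) == 0]gt_eqF// orbF.
by rewrite gt_eqF// qmod_gt0// subr_eq0.
Qed.

Lemma monomial_norm j n :
  qintegral (disc j) (fun z => dens z *: monomial_pair n n z) =
  (nu * moment w n (T j))%:A.
Proof.
have monoE z : dens z *: monomial_pair n n z = (sqnorm z ^+ n * dens z)%:A.
  rewrite /monomial_pair -exprMn_comm; last exact: conj_slice_comm.
  by rewrite conj_slice_mul exprZn expr1n scalerA mulrC.
rewrite (eq_qintegral (G := fun z => (sqnorm z ^+ n * dens z)%:A)) => [|z _]; last exact: monoE.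
have mE : (\int[mu]_(z in disc j) (sqnorm z ^+ n * dens z) = nu * moment w n (T j))%R.
  by rewrite /Rintegral (wdisc_moment hw).
have im : mu.-integrable (disc j) (EFin \o (fun z => sqnorm z ^+ n * dens z)).
  apply: (integrableS (measurable_wplane hw) (measurable_wdisc _ _) (wdisc_sub hw (j := j))).
  exact: (wplane_moment_integrable hw n).
apply/rowP => l; rewrite mxE -mE quatZE -(RintegralZr _ (measurable_wdisc _ _) im).
by apply: eq_Rintegral => z _; rewrite quatZE.
Qed.

End Orthogonality.

(** * Taylor coefficients as integrals *)

Section CoefficientIntegral.
Context {R : realType}.
Local Notation plane := (measurableTypeR R * measurableTypeR R)%type.
Local Notation mu := ((@lebesgue_measure R \x @lebesgue_measure R)%E).
Variables (kap nu : R) (w v : R -> R).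
Hypothesis hw : radial_weight kap nu w v.
Local Notation T := (exh_radius kap).
Local Notation c := (kcoef kap nu).
Local Notation dens := (wdensity nu w).
Local Notation disc := (wdisc kap).
Local Notation dom := (wplane kap).
Variable I : quat R.
Hypothesis hI : imag_unit I.
Local Notation sl := (slice I).
Variables (f : R * R -> quat R) (a : nat -> quat R).
Hypothesis fa : forall z, dom z -> series (fun m => sl z ^+ m * a m) @ \oo --> f z.

Lemma taylor_qmeasurable : qmeasurable dom f.
Proof.
apply: (qmeasurable_cvg (F_ := fun K z => \sum_(m < K) sl z ^+ m * a m)) => [K|z /fa].
  apply: (@qmeasurable_sum _ _ K (fun m z => sl z ^+ m * a m)) => m.
  by apply: qmeasurableM; [apply: qmeasurableX; exact: qmeasurable_slice|exact: qmeasurable_cst].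
by rewrite /series /=; under eq_fun do rewrite big_mkord.
Qed.

(** The Taylor series converges absolutely, uniformly on each disc, because it
    converges at a real point outside of the disc. *)
Let coef_bound j : exists B : R, forall K,
  \sum_(m < K) Num.sqrt (T j) ^+ m * qmod (a m) <= B.
Proof.
pose s := Num.sqrt (T j); pose s' := Num.sqrt (T j.+1).
have s0 : 0 < s by rewrite sqrtr_gt0 (exh_radius_gt0 hw).
have ss' : s < s'.
  rewrite ltr_sqrt ?(exh_radius_gt0 hw)//.
  have hp i : 0 < kap + i.+1%:R^-1 by rewrite ltr_wpDl ?(rw_kap hw)// invr_gt0 ltr0n.
  by rewrite /exh_radius ltf_pV2 ?posrE// ltrD2l ltf_pV2 ?posrE ?ltr0n// ltr_nat.
have s'0 := lt_trans s0 ss'.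
have dom' : dom (s', 0).
  rewrite /wplane /= /sqnorm /= expr0n addr0 sqr_sqrtr; last first.
    by rewrite ltW// (exh_radius_gt0 hw).
  exact: (exh_radius_dom hw (lexx _)).
have cf : cvgn (series (fun m => sl (s', 0) ^+ m * a m)).
  by apply/cvg_ex; exists (f (s', 0)); exact: fa.
have [M hM] : exists M : R, forall m, s' ^+ m * qmod (a m) <= M.
  have := cvg_seq_bounded (cvgP _ (cvg_series_cvg_0 cf)).
  move=> [M [_ hM]]; exists (2 * (M + 1)) => m.
  have -> : s' ^+ m * qmod (a m) = qmod (sl (s', 0) ^+ m * a m).
    by rewrite qmodM qmodX /slice /= scale0r addr0 qmodZ qmod1 mulr1 gtr0_norm.
  rewrite (le_trans (qmod_le_norm _))// ler_pM2l//.
  by apply: hM => //; rewrite ltrDl.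
have M0 : 0 <= M by apply: le_trans (hM 0%N); rewrite expr0 mul1r.
have x01 : 0 <= s / s' < 1.
  by rewrite divr_ge0 ?ltW//= ltr_pdivrMr// mul1r.
exists (M * (1 / (1 - s / s'))) => K.
apply: (@le_trans _ _ (\sum_(m < K) M * (s / s') ^+ m)).
  apply: ler_sum => m _; rewrite expr_div_n mulrCA.
  apply: ler_wpM2l; first by rewrite exprn_ge0// ltW.
  by rewrite ler_pdivlMr ?exprn_gt0// mulrC.
rewrite -mulr_sumr; apply: ler_wpM2l => //.
have := geometric_tail_le 0 K x01; rewrite expr0 big_mkord; exact.
Qed.

Let coef_fun n z := qconj (sl z) ^+ n * f z.

Let mcoef_fun n : qmeasurable dom (coef_fun n).
Proof.
apply: qmeasurableM taylor_qmeasurable; apply: qmeasurableX; apply: qmeasurable_conj.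
exact: qmeasurable_slice.
Qed.

Let disc_dom j z : disc j z -> dom z.
Proof. by move=> zj; exact: (wdisc_sub hw zj). Qed.

Let disc_mass_integrable j (B : R) :
  mu.-integrable (disc j) (EFin \o (fun z => sqnorm z ^+ 0 * dens z * B)).
Proof.
apply: (integrableZr (measurable_wdisc _ _) B (f := EFin \o (fun z => sqnorm z ^+ 0 * dens z))).
apply: (integrableS (measurable_wplane hw) (measurable_wdisc _ _) (wdisc_sub hw (j := j))).
exact: (wplane_moment_integrable hw 0).
Qed.

(** Term-by-term integration: only the [n]-th term survives. *)
Lemma taylor_disc j n : qintegral (disc j) (fun z => dens z *: coef_fun n z) =
  (nu * moment w n (T j)) *: a n.
Proof.
have [B hB] := coef_bound j.
have s0 : 0 <= Num.sqrt (T j) by exact: sqrtr_ge0.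
pose term m z := dens z *: (monomial_pair I n m z * a m).
have linr m : linear (fun q : quat R => q * a m).
  by move=> k q q'; rewrite mulrDl scalerAl.
have termE m : term m = (fun q => q * a m) \o (fun z => dens z *: monomial_pair I n m z).
  by apply/funext => z; rewrite /term /= scalerAl.
have imp m := qintegrable_monomial_pair hw hI j n m.
have iterm m : qintegrable (disc j) (term m).
  by rewrite termE; exact: qintegrable_linear (measurable_wdisc _ _) (linr m) (imp m).
have sumE K z : \sum_(m < K) term m z =
    dens z *: (qconj (sl z) ^+ n * \sum_(m < K) sl z ^+ m * a m).
  rewrite mulr_sumr scaler_sumr; apply: eq_bigr => m _.
  by rewrite /term /monomial_pair -mulrA.
have cvgS : qintegral (disc j) (fun z => \sum_(m < K) term m z) @[K --> \oo] -->
    qintegral (disc j) (fun z => dens z *: coef_fun n z).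
  apply: (qintegral_cvg (g := fun z => sqnorm z ^+ 0 * dens z * (Num.sqrt (T j) ^+ n * B))).
  - exact: measurable_wdisc.
  - move=> K; apply: qmeasurable_sum => m; apply: qmeasurableZ.
      exact: (measurable_wdensity hw).
    by apply: qmeasurableM; [exact: qmeasurable_monomial_pair|exact: qmeasurable_cst].
  - move=> z zj; have cz := fa (disc_dom zj).
    under eq_fun do rewrite sumE.
    apply: cvgZl_tmp; apply: cvg_qM; first exact: cvg_cst.
    by move: cz; rewrite /series /=; under eq_fun do rewrite big_mkord.
  - exact: disc_mass_integrable.
  - move=> K z zj; rewrite sumE qmodZ ger0_norm ?(wdensity_ge0 hw)// expr0 mul1r.
    apply: ler_wpM2l; first exact: (wdensity_ge0 hw).
    have zs := qmod_slice_wdisc hI zj.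
    rewrite qmodM qmodX qmod_conj; apply: ler_pM => //; first by rewrite exprn_ge0.
      by rewrite lerXn2r// nnegrE.
    rewrite (le_trans (qmod_sum _))// (le_trans _ (hB K))//; apply: ler_sum => m _.
    by rewrite qmodM qmodX ler_wpM2r// lerXn2r// nnegrE.
apply: (cvg_unique _ cvgS) => //; apply: cvg_near_cst; near=> K.
have nK : (n < K)%N by near: K; exact: nbhs_infty_gt.
rewrite (qintegral_sum K (measurable_wdisc _ _) iterm) (bigD1 (Ordinal nK))//=.
rewrite big1 ?addr0 => [|m mn].
  rewrite termE (qintegral_linear (measurable_wdisc _ _) (linr n) (imp n)).
  by rewrite (monomial_norm hw hI) -scalerAl mul1r.
rewrite termE (qintegral_linear (measurable_wdisc _ _) (linr m) (imp m)).
rewrite (monomial_orthogonal hw hI) ?mul0r//.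
by apply: contra mn => /eqP e; apply/eqP/val_inj.
Unshelve. all: by end_near. Qed.

Hypothesis f2 : mu.-integrable dom (EFin \o (fun z => qmod (f z) ^+ 2 * dens z)).

(** The integrand is dominated by means of [2 x y <= x ^+ 2 + y ^+ 2]. *)
Lemma coef_fun_dominated n :
  let g z := sqnorm z ^+ n * dens z + qmod (f z) ^+ 2 * dens z in
  mu.-integrable dom (EFin \o g) /\
  forall z, qmod (dens z *: coef_fun n z) <= g z.
Proof.
split; first exact: (integrableD (measurable_wplane hw) (wplane_moment_integrable hw n) f2).
move=> z; have d0 := wdensity_ge0 hw z.
rewrite qmodZ ger0_norm// -mulrDl mulrC; apply: ler_wpM2r => //.
rewrite qmodM qmodX qmod_conj -(qmod_slice_sqnorm hI) -exprM mulnC exprM.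
move: (qmod (sl z) ^+ n) (qmod (f z)) => x y.
by have := sqr_ge0 (x - y); have := sqr_ge0 x; have := sqr_ge0 y; nra.
Qed.

(** By exhaustion of the domain by discs: the orthogonality relations give
    [taylor_disc], and the moments tend to [(c n)^-1]. *)
Lemma taylor_plane n : qintegral dom (fun z => dens z *: coef_fun n z) =
  (c n)^-1 *: a n.
Proof.
have [ig gP] := coef_fun_dominated n.
pose F z := dens z *: coef_fun n z.
have mF : qmeasurable dom F by apply: qmeasurableZ (mcoef_fun n); exact: (measurable_wdensity hw).
have restrE j : qintegral dom (fun z => \1_(disc j) z *: F z) = qintegral (disc j) F.
  apply/rowP => l; rewrite !mxE -[in RHS](setIidr (wdisc_sub hw (j := j))).
  rewrite Rintegral_mkcondr; apply: eq_Rintegral => z _.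
  by rewrite patchE quatZE indicE; case: ifPn => _; rewrite ?mul1r ?mul0r.
have cv : qintegral dom (fun z => \1_(disc j) z *: F z) @[j --> \oo] --> qintegral dom F.
  apply: (qintegral_cvg (measurable_wplane hw) _ _ ig).
  - move=> j; apply: qmeasurableZ mF; apply: measurable_indic.
    exact: measurable_wdisc.
  - move=> z zd; apply: cvg_near_cst.
    apply: filterS (exh_radius_near hw zd) => j zj.
    by rewrite indicE mem_set ?scale1r//; exact: ltW.
  - move=> j z _; apply: (le_trans _ (gP z)); rewrite -/(F z) qmodZ indicE.
    by case: (z \in disc j); rewrite ?normr1 ?normr0 ?mul1r ?mul0r// qmod_ge0.
apply: (cvg_unique _ cv) => //.
rewrite (_ : (fun j => _) = (fun j => (nu * moment w n (T j)) *: a n)); last first.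
  by apply/funext => j; rewrite restrE taylor_disc.
by apply: cvgZr_tmp; exact: moment_cvg hw n.
Qed.

End CoefficientIntegral.

(** * The kernel of a radial weight *)

Section Kernel.
Context {R : realType}.
Local Notation plane := (measurableTypeR R * measurableTypeR R)%type.
Local Notation mu := ((@lebesgue_measure R \x @lebesgue_measure R)%E).
Variables (kap nu : R) (w v : R -> R).
Hypothesis hw : radial_weight kap nu w v.
Let kap0 := rw_kap hw.
Let nu0 := rw_nu hw.
Local Notation T := (exh_radius kap).
Local Notation c := (kcoef kap nu).
Local Notation dens := (wdensity nu w).
Local Notation dom := (wplane kap).
Local Notation Om := (wdomain kap).
Implicit Types (q p : quat R) (z : R * R).

Definition wweight q : R := nu / pi * w (qmod q ^+ 2).

Definition wkernel q p : quat R := power_series (fun n => c n *: qconj p ^+ n) q.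

Let c_gt0 n : 0 < c n. Proof. exact: kcoef_gt0. Qed.

Lemma wweight_slice I z : imag_unit I -> wweight (slice I z) = dens z.
Proof. by move=> hI; rewrite /wweight /wdensity qmod_slice. Qed.

Lemma open_wdomain : open (@wdomain R kap).
Proof.
rewrite (_ : wdomain kap = (fun q => kap * qmod q ^+ 2) @^-1` [set x : R | x < 1])//.
apply: open_comp => [q _|]; last exact: open_lt.
have h : qmod x @[x --> q] --> qmod q.
  by apply: (@cvg_qmod _ _ (nbhs q) _ id); exact: cvg_id.
have h2 := cvgMl_tmp (a := kap) (cvgM h h); exact: h2.
Qed.

Lemma wdomain_ball q : Om q -> exists2 r, qmod q < r & qball r `<=` Om.
Proof.
move=> /(exh_radius_near hw)[j _ /(_ j (leqnn j)) /= qj].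
exists (Num.sqrt (T j)).
  by rewrite -(ger0_norm (qmod_ge0 q)) -sqrtr_sqr ltr_sqrt// (exh_radius_gt0 hw).
move=> p /= pj; apply: (exh_radius_dom hw (j := j)).
have T0 : 0 <= T j by rewrite ltW// (exh_radius_gt0 hw).
rewrite -[leRHS]sqr_sqrtr// lerXn2r// ?nnegrE ?sqrtr_ge0//; exact: ltW.
Qed.

Lemma wdomain0 : Om 0.
Proof. by rewrite /wdomain /= qmod0 expr0n mulr0. Qed.

Lemma wdomain_mul q p : Om q -> Om p -> kap * (qmod q * qmod p) < 1.
Proof.
rewrite /wdomain /= => hq hp; have := mulr_ge0 kap0 (sqr_ge0 (qmod q - qmod p)).
by move: hq hp; rewrite !expr2; lra.
Qed.

(** The series in [q] converges beyond [qmod q], because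
    [kap * (qmod q * qmod p) < 1] is a strict inequality. *)
Lemma wkernel_coef_bounded q p : Om q -> Om p -> exists rho M : R,
  qmod q < rho /\ forall n, qmod (c n *: qconj p ^+ n) * rho ^+ n <= M.
Proof.
move=> hq hp; have kqp := wdomain_mul hq hp.
pose m := kap * qmod p.
have m0 : 0 <= m by exact: mulr_ge0.
have mq : m * qmod q < 1 by rewrite /m -mulrA [qmod p * _]mulrC.
pose d := (1 - m * qmod q) / (2 * (m + 1)).
have m1 : 0 < m + 1 by rewrite ltr_wpDl.
have d0 : 0 < d by rewrite divr_gt0// ?subr_gt0// mulr_gt0.
have md : m * d < 1 - m * qmod q.
  have -> : m * d = (1 - m * qmod q) * (m / (2 * (m + 1))).
    by rewrite /d; field; rewrite gt_eqF.
  rewrite gtr_pMr ?subr_gt0// ltr_pdivrMr ?mulr_gt0// mul1r; lra.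
pose rho := qmod q + d.
have rho0 : 0 <= rho by apply: addr_ge0 => //; exact: ltW.
have kr : kap * (qmod p * rho) < 1.
  by rewrite mulrA -/m /rho mulrDr -ltrBrDl.
have [y [M [y0 y1 hM]]] := kcoef_geometric kap0 nu0 (mulr_ge0 (qmod_ge0 p) rho0) kr.
exists rho, M; split; first by rewrite ltrDl.
move=> n; rewrite qmodZ qmodX qmod_conj gtr0_norm// -mulrA -exprMn.
apply: (le_trans (hM n)).
have M0 : 0 <= M.
  by have := hM 0%N; rewrite !expr0 kcoef0 !mulr1; exact: le_trans.
by rewrite ler_piMr// exprn_ile1// ltW.
Qed.

Lemma cvg_wkernel q p : Om q -> Om p ->
  series (fun n => q ^+ n * (c n *: qconj p ^+ n)) @ \oo --> wkernel q p.
Proof.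
move=> hq hp; have [rho [M [qr bM]]] := wkernel_coef_bounded hq hp.
exact: (cvg_power_series bM qr).
Qed.

Lemma wkernel_slice_regular p : Om p -> slice_regular Om (wkernel^~ p).
Proof.
move=> hp; apply: power_series_slice_regular; first exact: open_wdomain.
by move=> q hq; exact: wkernel_coef_bounded.
Qed.

Lemma wkernel_conj q p : Om q -> Om p -> qconj (wkernel q p) = wkernel p q.
Proof.
move=> hq hp; pose u := series (fun n => q ^+ n * (c n *: qconj p ^+ n)).
have h : qconj (u N) @[N --> \oo] --> qconj (wkernel q p).
  by apply: (@cvg_qconj _ _ \oo _ u); exact: cvg_wkernel.
apply: (cvg_unique _ h) => //.
rewrite (_ : (fun _ => _) = series (fun n => p ^+ n * (c n *: qconj q ^+ n))).
  exact: cvg_wkernel.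
apply/funext => N; rewrite /u /series /= !big_mkord; elim: N => [|N ih].
  by rewrite !big_ord0; apply: quatP; rewrite !quatE ?oppr0.
rewrite !big_ord_recr /= qconjD ih; congr (_ + _).
by rewrite qconjM qconjZ !qconjX qconjK -scalerAl scalerAr.
Qed.


(** Cauchy--Schwarz splits the kernel at [q] into a factor that depends only on
    [q] and the majorant [S], which is integrable against the weight: the
    auxiliary [th], strictly between [kap * qmod q ^+ 2] and 1, makes the series
    of both factors converge. *)
Lemma wkernel_dominated q : Om q -> exists (C : R) (S : R * R -> R),
  [/\ mu.-integrable dom (EFin \o (fun z => S z * dens z)),
      measurable_fun dom (S : plane -> R) &
      forall z N, dom z ->
       (\sum_(n < N) c n * qmod q ^+ n * Num.sqrt (sqnorm z) ^+ n) ^+ 2 <= C * S z].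
Proof.
rewrite /wdomain /= => hq; pose x := qmod q ^+ 2.
have x0 : 0 <= x by exact: sqr_ge0.
have kx0 : 0 <= kap * x by exact: mulr_ge0.
pose th := (1 + kap * x) / 2.
have kxth : kap * x < th by rewrite /th; move: hq; rewrite -/x; lra.
have th1 : th < 1 by rewrite /th; move: hq; rewrite -/x; lra.
have th0 : 0 < th by exact: le_lt_trans kxth.
have c1 : cvgn (series (fun n => c n * (x / th) ^+ n)).
  apply: cvg_kcoef_series => //; first by apply: divr_ge0 => //; exact: ltW.
  by rewrite mulrA ltr_pdivrMr// mul1r.
have c2 z : dom z -> cvgn (series (fun n => c n * (th * sqnorm z) ^+ n)).
  move=> hz; apply: cvg_kcoef_series => //.
    by apply: mulr_ge0; [exact: ltW|exact: sqnorm_ge0].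
  rewrite mulrCA; apply: le_lt_trans hz.
  by rewrite ler_piMl ?(ltW th1)//; apply: mulr_ge0 => //; exact: sqnorm_ge0.
pose C := limn (series (fun n => c n * (x / th) ^+ n)).
pose S z := limn (series (fun n => c n * (th * sqnorm z) ^+ n)).
have t1pos n : 0 <= c n * (x / th) ^+ n.
  apply: mulr_ge0; first exact: ltW.
  by apply: exprn_ge0; apply: divr_ge0 => //; exact: ltW.
have t2pos z n : 0 <= c n * (th * sqnorm z) ^+ n.
  apply: mulr_ge0; first exact: ltW.
  by apply: exprn_ge0; apply: mulr_ge0; [exact: ltW|exact: sqnorm_ge0].
have t1le N : \sum_(n < N) c n * (x / th) ^+ n <= C.
  have := nondecreasing_cvgn_le (u_ := series (fun n => c n * (x / th) ^+ n)) _ c1 N.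
  rewrite /series /= big_mkord; apply.
  by apply/nondecreasing_seqP => n; rewrite /series /= big_nat_recr//= lerDl.
have t2le z N : dom z -> \sum_(n < N) c n * (th * sqnorm z) ^+ n <= S z.
  move=> hz.
  have := nondecreasing_cvgn_le (u_ := series (fun n => c n * (th * sqnorm z) ^+ n)) _ (c2 z hz) N.
  rewrite /series /= big_mkord; apply.
  by apply/nondecreasing_seqP => n; rewrite /series /= big_nat_recr//= lerDl.
have mterm n : measurable_fun dom (fun z : plane => c n * (th * sqnorm z) ^+ n).
  apply: measurable_funM; first exact: measurable_cst.
  apply: measurable_funX; apply: measurable_funM; first exact: measurable_cst.
  by apply: measurable_funTS; exact: measurable_sqnorm.
have mS : measurable_fun dom (S : plane -> R).
  apply: (measurable_fun_cvg (h := fun N (z : plane) => \sum_(n < N) c n * (th * sqnorm z) ^+ n)).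
    by move=> N; apply: measurable_sum => n; exact: mterm.
  move=> z hz; rewrite (_ : (fun N => _) = series (fun n => c n * (th * sqnorm z) ^+ n)).
    exact: c2.
  by apply/funext => N; rewrite /series /= big_mkord.
have SdensE z : dom z -> ((S z * dens z)%:E =
    \sum_(n <oo) (th ^+ n * c n * (sqnorm z ^+ n * dens z))%:E)%E.
  move=> hz; have h : cvgn (series (fun n => th ^+ n * c n * (sqnorm z ^+ n * dens z))) /\
     limn (series (fun n => th ^+ n * c n * (sqnorm z ^+ n * dens z))) = S z * dens z.
    have e : series (fun n => th ^+ n * c n * (sqnorm z ^+ n * dens z)) =
        (fun N => series (fun n => c n * (th * sqnorm z) ^+ n) N * dens z).
      apply/funext => N; rewrite /series /= mulr_suml; apply: eq_bigr => n _.
      by rewrite [(th * _) ^+ n]exprMn; move: (th ^+ n) => y; ring.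
    have h' : series (fun n => th ^+ n * c n * (sqnorm z ^+ n * dens z)) @ \oo --> S z * dens z.
      by rewrite e; apply: cvgMr_tmp; exact: c2.
    by split; [apply/cvg_ex; eexists; exact: h'|exact: cvg_lim].
  case: h => h1 h2; rewrite -h2 -EFin_lim//; congr (limn _).
  by apply/funext => N; rewrite /= /series /= sumEFin.
exists C, S; split => //; last first.
  move=> z N hz; set P := \sum_(n < N) _.
  have C1 : 0 < C.
    by apply: lt_le_trans (t1le 1%N); rewrite big_ord1 expr0 mulr1.
  (* Weighted means; the best choice is e = P / C. *)
  have AB (e : R) : 0 < e -> 2 * e * P <= e ^+ 2 * C + S z.
    move=> e0; apply: (@le_trans _ _ (\sum_(n < N) (e ^+ 2 * (c n * (x / th) ^+ n) +
        c n * (th * sqnorm z) ^+ n))).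
      rewrite mulr_sumr; apply: ler_sum => n _.
      set X := (x / th) ^+ n; set Y := (th * sqnorm z) ^+ n.
      set Z := qmod q ^+ n * Num.sqrt (sqnorm z) ^+ n.
      have Z2 : Z ^+ 2 = X * Y.
        rewrite /Z /X /Y exprMn -!exprM [(n * 2)%N]mulnC !exprM -/x.
        rewrite sqr_sqrtr ?sqnorm_ge0// -!exprMn; congr (_ ^+ _).
        by field; rewrite gt_eqF.
      have X0 : 0 <= X by apply: exprn_ge0; apply: divr_ge0 => //; exact: ltW.
      have Y0 : 0 <= Y by apply: exprn_ge0; apply: mulr_ge0; [exact: ltW|exact: sqnorm_ge0].
      have Z0 : 0 <= Z by apply: mulr_ge0; apply: exprn_ge0 => //; exact: sqrtr_ge0.
      rewrite -[c n * _ * _]mulrA -/Z.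
      have -> : 2 * e * (c n * Z) = c n * (2 * e * Z) by ring.
      have -> : e ^+ 2 * (c n * X) + c n * Y = c n * (e ^+ 2 * X + Y) by ring.
      rewrite ler_pM2l// -(ler_pXn2r (_ : (0 < 2)%N))// ?nnegrE; last 2 first.
      - by apply: mulr_ge0 => //; apply: mulr_ge0 => //; exact: ltW.
      - by apply: addr_ge0 => //; apply: mulr_ge0 => //; exact: sqr_ge0.
      have -> : (2 * e * Z) ^+ 2 = (e ^+ 2 * X + Y) ^+ 2 - (e ^+ 2 * X - Y) ^+ 2.
        by rewrite exprMn Z2; ring.
      by rewrite gerBl sqr_ge0.
    rewrite big_split /= -mulr_sumr; apply: lerD; last exact: t2le.
    by apply: ler_wpM2l; [exact: sqr_ge0|exact: t1le].
  have [P0|P0] := leP P 0.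
    have -> : P = 0.
      apply/eqP; rewrite eq_le P0 sumr_ge0// => n _; apply: mulr_ge0.
        by apply: mulr_ge0; [exact: ltW|exact: exprn_ge0].
      by apply: exprn_ge0; exact: sqrtr_ge0.
    rewrite expr0n; apply: mulr_ge0; first exact: ltW.
    by apply: le_trans (t2le z 0%N hz); rewrite big_ord0.
  have := AB (P / C) (divr_gt0 P0 C1).
  have -> : (P / C) ^+ 2 * C = P ^+ 2 / C by field; rewrite gt_eqF.
  have -> : 2 * (P / C) * P = 2 * (P ^+ 2 / C) by field; rewrite gt_eqF.
  move=> h; have : P ^+ 2 / C <= S z by move: h; lra.
  by rewrite ler_pdivrMr// mulrC.
apply/integrableP; split.
  apply/measurable_EFinP; apply: measurable_funM => //.
  exact: (measurable_wdensity hw).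
have S0 z : dom z -> 0 <= S z * dens z.
  move=> hz; apply: mulr_ge0; last exact: (wdensity_ge0 hw).
  by apply: le_trans (t2le z 0%N hz); rewrite big_ord0.
under eq_integral => z /[!inE] hz do rewrite /= (ger0_norm (S0 z hz)) (SdensE z hz).
rewrite integral_nneseries//; last 3 first.
- exact: (measurable_wplane hw).
- move=> n; apply/measurable_EFinP; apply: measurable_funM; first exact: measurable_cst.
  exact: (measurable_moment_fun hw).
- move=> n z hz; rewrite lee_fin; apply: mulr_ge0; last exact: (moment_fun_ge0 hw).
  by apply: mulr_ge0; [apply: exprn_ge0|]; exact: ltW.
rewrite (eq_eseriesr (g := fun n => (th ^+ n)%:E)); last first.
  move=> n _; under eq_integral do rewrite EFinM.
  rewrite ge0_integralZl//; last 4 first.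
  - exact: (measurable_wplane hw).
  - by apply/measurable_EFinP; exact: (measurable_moment_fun hw).
  - by move=> z _; rewrite lee_fin (moment_fun_ge0 hw).
  - by rewrite lee_fin; apply: mulr_ge0; [apply: exprn_ge0|]; exact: ltW.
  by rewrite (wplane_moment hw) -EFinM mulfK// gt_eqF.
have g : cvgn (series (fun n => th ^+ n)).
  rewrite (_ : (fun n => th ^+ n) = geometric 1 th); last first.
    by apply/funext => n; rewrite /= mul1r.
  by apply: is_cvg_geometric_series; rewrite gtr0_norm.
rewrite (_ : (fun n => _) = EFin \o series (fun n => th ^+ n)); last first.
  by apply/funext => N; rewrite /series /= sumEFin.
by rewrite EFin_lim// ltry.
Qed.

End Kernel.

(** * The reproducing property *)

Section Reproducing.
Context {R : realType}.
Local Notation plane := (measurableTypeR R * measurableTypeR R)%type.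
Local Notation mu := ((@lebesgue_measure R \x @lebesgue_measure R)%E).
Variables (kap nu : R) (w v : R -> R).
Hypothesis hw : radial_weight kap nu w v.
Let kap0 := rw_kap hw.
Let nu0 := rw_nu hw.
Local Notation c := (kcoef kap nu).
Local Notation dens := (wdensity nu w).
Local Notation dom := (wplane kap).
Local Notation Om := (wdomain kap).
Local Notation rho := (wweight nu w).
Local Notation K := (wkernel kap nu).
Implicit Types (q p : quat R) (z : R * R).

Let c_gt0 n : 0 < c n. Proof. exact: kcoef_gt0. Qed.

Lemma slice_wdomain_point I z : imag_unit I -> dom z -> Om (slice I z).
Proof. by move=> hI; rewrite -(slice_wdomain kap hI). Qed.

Lemma slice_L2_taylor f : slice_L2 Om rho f -> exists a : nat -> quat R,
  forall q, Om q -> series (fun n => q ^+ n * a n) @ \oo --> f q.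
Proof.
move=> [rf _]; apply: slice_regular_taylor rf; last exact: (wdomain_ball hw).
have [r r0 rO] := wdomain_ball hw (wdomain0 kap); exists r => //.
by apply: le_lt_trans r0; rewrite qmod0.
Qed.

Lemma slice_L2_integrable f I : imag_unit I -> slice_L2 Om rho f ->
  mu.-integrable dom (EFin \o (fun z => qmod (f (slice I z)) ^+ 2 * dens z)).
Proof.
move=> hI [_ /(_ I hI)]; rewrite slice_wdomain//.
by under eq_fun do rewrite wweight_slice//.
Qed.

Lemma wkernel_L2 p : Om p -> slice_L2 Om rho (K ^~ p).
Proof.
move=> hp; split; first exact: (wkernel_slice_regular hw).
move=> I hI; rewrite slice_wdomain//.
under eq_fun do rewrite wweight_slice//.
have [C [S [iS mS CS]]] := wkernel_dominated hw hp.
have mD := measurable_wplane hw.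
pose u z := series (fun n => slice I z ^+ n * (c n *: qconj p ^+ n)).
have cu z : dom z -> u z @ \oo --> K (slice I z) p.
  by move=> hz; apply: (cvg_wkernel hw) => //; exact: slice_wdomain_point.
have mK : qmeasurable dom (fun z => K (slice I z) p).
  exact: (taylor_qmeasurable cu).
apply: (le_integrable mD _ _ (integrableZl mD C iS)).
  apply/measurable_EFinP; apply: measurable_funM; last exact: (measurable_wdensity hw).
  exact: measurable_qmod2.
move=> z hz; rewrite /= lee_fin [C * _]mulrA.
have d0 := wdensity_ge0 hw z.
have KS : qmod (K (slice I z) p) ^+ 2 <= C * S z.
  have h : qmod (u z N) ^+ 2 @[N --> \oo] --> qmod (K (slice I z) p) ^+ 2.
    have h1 : qmod (u z N) @[N --> \oo] --> qmod (K (slice I z) p).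
      by apply: (@cvg_qmod _ _ \oo _ (u z)); exact: cu.
    exact: (cvgM h1 h1).
  apply: (cvgr_to_le h); near=> N => /=.
  apply: le_trans (CS z N hz); apply: lerXn2r; rewrite ?nnegrE//.
    apply: sumr_ge0 => n _; apply: mulr_ge0; last by apply: exprn_ge0; exact: sqrtr_ge0.
      by apply: mulr_ge0; [exact: ltW|exact: exprn_ge0].
  rewrite /u /series /= big_mkord (le_trans (qmod_sum _))//; apply: ler_sum => n _.
  rewrite qmodM qmodX qmodZ qmodX qmod_conj gtr0_norm//.
  by rewrite mulrC -(qmod_slice_sqnorm hI) sqrtr_sqr ger0_norm.
rewrite !ger0_norm//.
- exact: ler_wpM2r.
- by apply: mulr_ge0 => //; apply: le_trans KS; exact: sqr_ge0.
- by apply: mulr_ge0 => //; exact: sqr_ge0.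
Unshelve. all: by end_near. Qed.

(** Integrate the kernel series term by term, which [wkernel_dominated] allows:
    the [n]-th term gives [q ^+ n] times the [n]-th Taylor coefficient of [f],
    the factor [c n] being cancelled by [taylor_plane]. *)
Lemma wkernel_reproducing f q I : slice_L2 Om rho f -> Om q -> imag_unit I ->
  let F z := dens z *: (K q (slice I z) * f (slice I z)) in
  qintegrable dom F /\ qintegral dom F = f q.
Proof.
move=> Lf hq hI F; have [a fa] := slice_L2_taylor Lf.
have mD := measurable_wplane hw.
have f2 := slice_L2_integrable hI Lf.
have fa' z : dom z -> series (fun m => slice I z ^+ m * a m) @ \oo --> f (slice I z).
  by move=> hz; apply: fa; exact: slice_wdomain_point.
have mf := taylor_qmeasurable fa'.
have [C [S [iS mS CS]]] := wkernel_dominated hw hq.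
pose G n z := dens z *: (qconj (slice I z) ^+ n * f (slice I z)).
have mG n : qmeasurable dom (G n).
  apply: qmeasurableZ; first exact: (measurable_wdensity hw).
  apply: qmeasurableM mf; apply: qmeasurableX; apply: qmeasurable_conj.
  exact: qmeasurable_slice.
have iG n : qintegrable dom (G n).
  have [ig gP] := coef_fun_dominated hw hI f2 n.
  by apply: (qintegrable_le mD (mG n) ig) => z _; exact: gP.
pose FN N z := \sum_(n < N) (c n *: q ^+ n) * G n z.
have FNE N z : FN N z = dens z *:
    (\sum_(n < N) q ^+ n * (c n *: qconj (slice I z) ^+ n) * f (slice I z)).
  rewrite scaler_sumr; apply: eq_bigr => n _.
  by rewrite /G -scalerAr mulrA -!scalerAl -scalerAr -scalerAl.
have FNF z : dom z -> FN N z @[N --> \oo] --> F z.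
  move=> hz; under eq_fun do rewrite FNE.
  apply: cvgZl_tmp; under eq_fun do rewrite -mulr_suml.
  apply: cvg_qM; last exact: cvg_cst.
  have := cvg_wkernel hw hq (slice_wdomain_point hI hz).
  by rewrite /series /=; under eq_fun do rewrite big_mkord.
pose g z := C * (S z * dens z) + qmod (f (slice I z)) ^+ 2 * dens z.
have ig : mu.-integrable dom (EFin \o g).
  exact: (integrableD mD (integrableZl mD C iS) f2).
have FNg N z : dom z -> qmod (FN N z) <= g z.
  move=> hz; have d0 := wdensity_ge0 hw z.
  rewrite FNE -mulr_suml qmodZ ger0_norm// qmodM /g mulrA -mulrDl mulrC.
  apply: ler_wpM2r => //.
  set x := qmod (\sum_(n < N) _); set y := qmod _.
  have x2 : x ^+ 2 <= C * S z.
    apply: le_trans (CS z N hz); apply: lerXn2r; rewrite ?nnegrE.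
    - exact: qmod_ge0.
    - apply: sumr_ge0 => n _; apply: mulr_ge0; last by apply: exprn_ge0; exact: sqrtr_ge0.
      by apply: mulr_ge0; [exact: ltW|exact: exprn_ge0].
    rewrite (le_trans (qmod_sum _))//; apply: ler_sum => n _.
    rewrite qmodM qmodX qmodZ qmodX qmod_conj gtr0_norm//.
    by rewrite mulrA [qmod q ^+ n * _]mulrC -(qmod_slice_sqnorm hI) sqrtr_sqr ger0_norm.
  have := sqr_ge0 (x - y); have := sqr_ge0 x; have := sqr_ge0 y.
  by move: x2; nra.
have mFN N : qmeasurable dom (FN N).
  apply: (qmeasurable_sum N (F_ := fun n z => (c n *: q ^+ n) * G n z)) => n.
  by apply: qmeasurableM (mG n); exact: qmeasurable_cst.
split.
  apply: (qintegrable_le mD _ ig); first exact: qmeasurable_cvg mFN FNF.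
  move=> z hz; apply: (@cvgr_to_le _ \oo _ _ (fun N => qmod (FN N z)) (qmod (F z))).
    by apply: (@cvg_qmod _ _ \oo _ (FN ^~ z)); exact: FNF.
  by apply: nearW => N; exact: FNg.
have cv := qintegral_cvg mD mFN FNF ig FNg.
apply/esym; apply: (cvg_unique _ _ cv) => //.
rewrite (_ : (fun N => _) = series (fun n => q ^+ n * a n)); first exact: fa.
apply/funext => N; rewrite /series /= big_mkord.
rewrite (qintegral_sum N mD (F_ := fun n z => (c n *: q ^+ n) * G n z)); last first.
  move=> n; exact: (qintegrable_linear mD (linear_mulql _) (iG n)).
apply: eq_bigr => n _.
rewrite (qintegral_linear mD (linear_mulql _) (iG n)) (taylor_plane hw hI fa' f2 n).
by rewrite -scalerAl -scalerAr scalerA mulfV ?scale1r// gt_eqF.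
Qed.

Lemma imag_unit_exists : exists I : quat R, imag_unit I.
Proof.
by exists (mkquat 0 1 0 0); rewrite /imag_unit /=; apply: quatP; rewrite !quatE; ring.
Qed.

Lemma linear_qconj : linear (@qconj R).
Proof. by move=> k q p; rewrite qconjD qconjZ. Qed.

(** Uniqueness: [K' q p] is obtained by applying [K] to [K' ^~ p], while
    [K p q] is obtained by applying [K'] to [K ^~ q]; by hermitian symmetry the
    two integrands are conjugate. *)
Theorem wkernel_is_reproducing : is_reproducing_kernel Om rho K.
Proof.
have spec : reproducing_kernel_spec Om rho K.
  split; [exact: wkernel_L2|exact: (wkernel_conj hw)|].
  move=> f Lf q I hq hI; have [_ <-] := wkernel_reproducing Lf hq hI.
  rewrite slice_wdomain//; apply: eq_qintegral => z _.
  by rewrite wweight_slice.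
split=> // K' [L' conj' repr'] q p hq hp.
have [I hI] := imag_unit_exists.
have [_ _ repr] := spec.
have [iF FE] := wkernel_reproducing (L' p hp) hq hI.
rewrite -[LHS]qconjK -[RHS]qconjK; congr qconj.
rewrite (wkernel_conj hw hq hp) -FE -(qintegral_linear (measurable_wplane hw) linear_qconj iF).
rewrite (repr' _ (wkernel_L2 hq) p I hp hI) slice_wdomain//.
apply: eq_qintegral => z hz /=; have hO := slice_wdomain_point hI hz.
by rewrite wweight_slice// qconjZ qconjM conj'// (wkernel_conj hw hq hO).
Qed.

End Reproducing.

(** * Gaussian and Bergman weights *)

Section Instances.
Context {R : realType}.
Variable nu : R.
Hypothesis nu0 : 0 < nu.

Lemma is_derive_mull (a t : R) : is_derive t (1 : R) (fun t : R => a * t) a.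
Proof.
apply: (is_derive_eq (is_deriveZ a (is_derive_id t (1 : R)))).
by rewrite /GRing.scale /= mulr1.
Qed.

(** The boundary term decays since [expR] dominates every power. *)
Lemma radial_weight_expR :
  radial_weight 0 nu (fun t : R => expR (- nu * t)) (fun t => expR (- nu * t)).
Proof.
have ce : continuous (fun t : R => expR (- nu * t)).
  move=> t; apply: (@continuous_comp _ _ _ (fun t : R => - nu * t) expR).
    by apply: cvgMl_tmp; exact: cvg_id.
  exact: continuous_expR.
split => //.
- exact: continuous_measurable_fun.
- by move=> t _; exact: ce.
- move=> t _; apply: (is_derive_eq (is_derive1_comp _ (is_derive_mull (- nu) t))).
  by rewrite mulrC.
- by move=> t _; rewrite mul0r subr0 mul1r.
- by rewrite mulr0 expR0.
move=> n; under eq_fun do rewrite add0r invrK.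
pose C := n.+1`!%:R / nu ^+ n.+1.
apply: (@squeeze_cvgr _ _ _ _ (fun=> 0) (fun j => C * j.+1%:R^-1)); last 2 first.
- exact: cvg_cst.
- rewrite -[X in _ --> X](mulr0 C); apply: cvgMl_tmp; exact: cvg_harmonic.
apply: nearW => j; apply/andP; split; first by rewrite mulr_ge0// expR_ge0.
rewrite mulNr expRN.
set x : R := j.+1%:R; have x0 : 0 < x by rewrite ltr0n.
have nx : 0 <= nu * x by apply: mulr_ge0; exact: ltW.
have h := expR_ge1Dxn n nx.
have h' : (nu * x) ^+ n.+1 / n.+1`!%:R <= expR (nu * x).
  by apply: le_trans h; rewrite lerDr.
rewrite ler_pdivrMr ?expR_gt0//.
have C0 : 0 <= C / x.
  by apply: divr_ge0; [apply: divr_ge0 => //; apply: exprn_ge0|]; exact: ltW.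
apply: (le_trans _ (ler_wpM2l C0 h')).
rewrite /C exprMn [x ^+ n.+1]exprSr le_eqVlt; apply/orP; left; apply/eqP.
field; rewrite !gt_eqF ?exprn_gt0// ?ltr0n ?fact_gt0//.
Qed.

Lemma radial_weight_powR (r : R) : 0 < r ->
  radial_weight (r ^- 2) nu (fun t => (1 - r ^- 2 * t) `^ (nu * r ^+ 2 - 1))
    (fun t => (1 - r ^- 2 * t) `^ (nu * r ^+ 2)).
Proof.
move=> r0; set k := r ^- 2; set al := nu * r ^+ 2.
have k0 : 0 < k by rewrite invr_gt0 exprn_gt0.
have al0 : 0 < al by rewrite mulr_gt0// exprn_gt0.
have kal : k * al = nu by rewrite /al mulrCA mulVf ?mulr1// expf_neq0// gt_eqF.
have dpow (b t : R) : k * t < 1 ->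
    is_derive t (1 : R) (fun t => (1 - k * t) `^ b) (- (k * b) * (1 - k * t) `^ (b - 1)).
  move=> kt; have kt0 : 0 < 1 - k * t by rewrite subr_gt0.
  have h1 := is_derive1_powR b kt0.
  have h2 : is_derive t (1 : R) (fun t : R => 1 - k * t) (- k).
    apply: (is_derive_eq (is_deriveB (is_derive_cst (1 : R) t (1 : R)) (is_derive_mull k t))).
    by rewrite sub0r.
  have h3 := @is_derive1_comp _ (@powR R ^~ b) (fun t : R => 1 - k * t) t _ _ h1 h2.
  apply: (is_derive_eq h3).
  by rewrite /GRing.scale /=; ring.
split => //.
- exact: ltW.
- apply: (measurableT_comp (measurable_powR _)).
  by apply: measurable_funB; [exact: measurable_cst|exact: mulrl_measurable].
- by move=> t; exact: powR_ge0.
- move=> t /(dpow (al - 1))[d _].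
  by apply: differentiable_continuous; exact/derivable1_diffP.
- by move=> t /(dpow al); rewrite kal.
- move=> t kt; have kt0 : 0 < 1 - k * t by rewrite subr_gt0.
  by rewrite -{2}(powRr1 (ltW kt0)) -powRD ?gt_eqF ?implybT// addrCA subrr addr0.
- by rewrite mulr0 subr0 powR1.
move=> n; set u := fun j : nat => (k + j.+1%:R^-1)^-1.
have up j : 0 < u j by rewrite invr_gt0 addr_gt0// invr_gt0 ltr0n.
have uk j : u j <= k^-1 by rewrite lef_pV2 ?posrE// ?lerDl ?addr_gt0// ?invr_gt0 ?ltr0n.
have hv j : 1 - k * u j = u j * j.+1%:R^-1.
  have d0 : k + j.+1%:R^-1 != 0 by rewrite gt_eqF// addr_gt0// invr_gt0 ltr0n.
  by rewrite /u -[X in X - _](mulfV d0) -mulrBl addrAC subrr add0r mulrC.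
have v0 : 1 - k * u j @[j --> \oo] --> (0 : R).
  apply: (@squeeze_cvgr _ _ _ _ (fun=> 0) (fun j => k^-1 * j.+1%:R^-1)); last 2 first.
  - exact: cvg_cst.
  - by rewrite -[X in _ --> X](mulr0 k^-1); apply: cvgMl_tmp; exact: cvg_harmonic.
  apply: nearW => j; rewrite hv; apply/andP; split.
    by apply: mulr_ge0; [exact: ltW|rewrite invr_ge0].
  by apply: ler_wpM2r => //; rewrite invr_ge0.
have cz : (1 - k * u j) `^ al @[j --> \oo] --> (0 : R).
  apply: (@cvg_comp _ _ _ (fun j => 1 - k * u j) (fun x : R => x `^ al) _ _ _ _ (powR_cvg0 al0)).
  move=> P hP; have h : \forall j \near \oo, 0 < 1 - k * u j -> P (1 - k * u j) := v0 _ hP.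
  suff : \forall j \near \oo, P (1 - k * u j) by [].
  apply: filterS h => j; apply.
  by rewrite hv; apply: mulr_gt0 => //; rewrite invr_gt0 ltr0n.
apply: (@squeeze_cvgr _ _ _ _ (fun=> 0) (fun j => k^-1 ^+ n * (1 - k * u j) `^ al)); last 2 first.
- exact: cvg_cst.
- by rewrite -[X in _ --> X](mulr0 (k^-1 ^+ n)); apply: cvgMl_tmp; exact: cz.
apply: nearW => j; apply/andP; split.
  by apply: mulr_ge0; [apply: exprn_ge0; exact: ltW (up j)|exact: powR_ge0].
apply: ler_wpM2r; first exact: powR_ge0.
apply: lerXn2r; rewrite ?nnegrE; [exact: ltW (up j)| |exact: uk].
by rewrite invr_ge0 ltW.
Qed.

End Instances.

(** * Comparison of the kernels *)

Section Limit.
Context {R : realType}.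
Variable nu : R.
Hypothesis nu0 : 0 < nu.
Implicit Types q p : quat R.

Lemma kcoef_le (k : R) n : 0 <= k -> kcoef 0 nu n <= kcoef k nu n.
Proof.
move=> k0; apply: ler_wpM2r; first by rewrite invr_ge0.
apply: ler_prod => j _; rewrite mulr0 addr0 (ltW nu0) lerDl.
by apply: mulr_ge0.
Qed.

(** As a polynomial in [kap] with nonnegative coefficients, [kcoef kap nu n] is
    increasing and convex, hence below its chord from [0]. *)
Lemma kcoef_chord (k t : R) n : 0 <= k -> 0 <= t <= 1 ->
  0 <= kcoef (t * k) nu n - kcoef 0 nu n <= t * (kcoef k nu n - kcoef 0 nu n).
Proof.
move=> k0 /andP[t0 t1]; elim: n => [|n /andP[ih1 ih2]].
  by rewrite !kcoef0 !subrr mulr0 lexx.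
set m : R := n.+1%:R.
have m0 : 0 < m by rewrite ltr0n.
have tk0 : 0 <= t * k by exact: mulr_ge0.
have cS (x : R) : kcoef x nu n.+1 - kcoef 0 nu n.+1 =
    (nu * (kcoef x nu n - kcoef 0 nu n) + m * (x * kcoef x nu n)) / m.
  by rewrite !kcoefS -/m; field; rewrite gt_eqF.
have c0 (x : R) : 0 <= x -> 0 <= kcoef x nu n.
  by move=> x0; apply: ltW; exact: kcoef_gt0.
have ck : kcoef (t * k) nu n <= kcoef k nu n.
  have h : 0 <= kcoef k nu n - kcoef 0 nu n by rewrite subr_ge0 kcoef_le.
  have : t * (kcoef k nu n - kcoef 0 nu n) <= kcoef k nu n - kcoef 0 nu n.
    by rewrite ler_piMl.
  by move: ih2; lra.
rewrite !cS; apply/andP; split.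
  apply: divr_ge0; last exact: ltW.
  apply: addr_ge0; first by apply: mulr_ge0 => //; exact: ltW.
  by apply: mulr_ge0; [exact: ltW|apply: mulr_ge0 => //; exact: c0].
rewrite [leRHS]mulrA ler_pM2r ?invr_gt0// [leRHS]mulrDr; apply: lerD.
  by rewrite mulrCA ler_pM2l.
by rewrite [leRHS]mulrCA ler_pM2l// [leRHS]mulrA; apply: ler_wpM2l.
Qed.

(** The chord bound is summable, which yields uniform control of the kernels. *)
Lemma wkernel_chord w v w0 v0 (k : R) q p :
  radial_weight k nu w v -> radial_weight 0 nu w0 v0 ->
  wdomain k q -> wdomain k p ->
  exists C : R, forall t w' v', 0 <= t <= 1 -> radial_weight (t * k) nu w' v' ->
  qmod (wkernel (t * k) nu q p - wkernel 0 nu q p) <= t * C.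
Proof.
move=> hw hw0 hq hp; have k0 := rw_kap hw.
pose x := qmod q * qmod p; have x0 : 0 <= x by exact: mulr_ge0.
have cx := cvg_kcoef_series k0 nu0 x0 (wdomain_mul hw hq hp).
exists (limn (series (fun n => kcoef k nu n * x ^+ n))) => t w' v' t01 hw'.
have /andP[t0 t1] := t01.
have sub (k' : R) y : 0 <= k' <= k -> wdomain k y -> wdomain k' (y : quat R).
  move=> /andP[k'0 k'k]; rewrite /wdomain /=; apply: le_lt_trans.
  by apply: ler_wpM2r => //; exact: sqr_ge0.
have tk : 0 <= t * k <= k by rewrite mulr_ge0//= ler_piMl.
have zk : (0 : R) <= 0 <= k by rewrite lexx.
have c1 := cvg_wkernel hw' (sub _ _ tk hq) (sub _ _ tk hp).
have c2 := cvg_wkernel hw0 (sub _ _ zk hq) (sub _ _ zk hp).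
pose u n := q ^+ n * ((kcoef (t * k) nu n - kcoef 0 nu n) *: qconj p ^+ n).
have uE : series u @ \oo --> wkernel (t * k) nu q p - wkernel 0 nu q p.
  have h := cvgB c1 c2.
  rewrite (_ : series u = series (fun n => q ^+ n * (kcoef (t * k) nu n *: qconj p ^+ n)) -
     series (fun n => q ^+ n * (kcoef 0 nu n *: qconj p ^+ n))); first exact: h.
  apply/funext => N; rewrite /series /= fctE -sumrB; apply: eq_bigr => n _.
  by rewrite /u scalerBl mulrBr.
rewrite -(cvg_lim _ uE)//.
have tcx : series (fun n => t * (kcoef k nu n * x ^+ n)) @ \oo -->
    t * limn (series (fun n => kcoef k nu n * x ^+ n)).
  rewrite (_ : series _ = (fun N => t * series (fun n => kcoef k nu n * x ^+ n) N)).
    by apply: cvgMl_tmp; exact: cx.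
  by apply/funext => N; rewrite /series /= mulr_sumr.
rewrite -(cvg_lim _ tcx)//; apply: qmod_lim_series; last first.
  by apply/cvg_ex; eexists; exact: tcx.
move=> n; have /andP[h1 h2] := kcoef_chord n k0 t01.
rewrite /u qmodM qmodX qmodZ qmodX qmod_conj ger0_norm// mulrCA -exprMn -/x mulrA.
apply: ler_wpM2r; first exact: exprn_ge0.
apply: (le_trans h2); apply: ler_wpM2l => //.
by rewrite gerBl ltW// kcoef_gt0.
Qed.

End Limit.

Lemma reproducing_kernelP {R : realType} (Om : set (quat R)) (rho : quat R -> R)
    (K : quat R -> quat R -> quat R) : is_reproducing_kernel Om rho K ->
  is_reproducing_kernel Om rho (reproducing_kernel Om rho) /\
  forall q p, Om q -> Om p -> reproducing_kernel Om rho q p = K q p.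
Proof.
move=> hK; have h : is_reproducing_kernel Om rho (reproducing_kernel Om rho).
  exact: (xgetPex (fun _ _ => 0) (ex_intro _ K hK)).
by split=> //; exact: hK.2 h.1.
Qed.


Section Kernels.
Context {R : realType}.
Variable nu : R.
Hypothesis nu0 : 0 < nu.
Implicit Types q p : quat R.

Lemma wdomain_whole : wdomain 0 = [set: quat R].
Proof. by apply/seteqP; split => q // _; rewrite /wdomain /= mul0r ltr01. Qed.

Lemma wdomain_qball (r : R) : 0 < r -> wdomain (r ^- 2) = qball r.
Proof.
move=> r0; apply/seteqP; split => q; rewrite /wdomain /qball /= mulrC ltr_pdivrMr ?exprn_gt0// mul1r.
  by rewrite ltr_pXn2r// nnegrE// ltW.
by move=> h; rewrite ltr_pXn2r// nnegrE// ltW.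
Qed.

Lemma fock_weightE : fock_weight nu = wweight nu (fun t => expR (- nu * t)).
Proof. by []. Qed.

Lemma bergman_weightE (r : R) : 0 < r -> bergman_weight (nu * r ^+ 2) r =
  wweight nu (fun t => (1 - r ^- 2 * t) `^ (nu * r ^+ 2 - 1)).
Proof.
move=> r0; apply/funext => q; rewrite /bergman_weight /wweight.
congr (_ * (_ - _) `^ _); last by rewrite mulrC.
by have := pi_gt0 R; move: pi => x x0; field; rewrite !gt_eqF.
Qed.

Lemma fock_kernelP : is_reproducing_kernel setT (fock_weight nu) (fock_kernel nu) /\
  forall q p, fock_kernel nu q p = wkernel 0 nu q p.
Proof.
have := wkernel_is_reproducing (radial_weight_expR nu0).
rewrite wdomain_whole -fock_weightE => /reproducing_kernelP[h e].
by split => // q p; exact: e.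
Qed.

Lemma bergman_kernelP (r : R) : 0 < r ->
  is_reproducing_kernel (qball r) (bergman_weight (nu * r ^+ 2) r)
    (bergman_kernel (nu * r ^+ 2) r) /\
  forall q p, qball r q -> qball r p ->
    bergman_kernel (nu * r ^+ 2) r q p = wkernel (r ^- 2) nu q p.
Proof.
move=> r0; have := wkernel_is_reproducing (radial_weight_powR nu0 r0).
by rewrite wdomain_qball// -bergman_weightE// => /reproducing_kernelP.
Qed.

Lemma star_exp_termE q p n :
  star_exp_term nu q p n = q ^+ n * (kcoef 0 nu n *: qconj p ^+ n).
Proof.
rewrite /star_exp_term -scalerAr; congr (_ *: _); rewrite /kcoef.
congr (_ / _); under eq_bigr do rewrite mulr0 addr0.
by rewrite prodr_const card_ord.
Qed.

Lemma cvg_star_exp q p : series (star_exp_term nu q p) @ \oo --> wkernel 0 nu q p.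
Proof.
rewrite (_ : star_exp_term nu q p = fun n => q ^+ n * (kcoef 0 nu n *: qconj p ^+ n)); last first.
  by apply/funext => n; exact: star_exp_termE.
by apply: (cvg_wkernel (radial_weight_expR nu0)); rewrite wdomain_whole.
Qed.

Lemma star_expE q p : star_exp nu q p = wkernel 0 nu q p.
Proof. by apply: cvg_lim => //; exact: cvg_star_exp. Qed.

(** Apply [wkernel_chord] with [k] given by a fixed radius [r0] beyond the
    moduli of [q] and [p], and with [t = (r0 / r) ^+ 2]. *)
Lemma bergman_kernel_cvg q p :
  bergman_kernel (nu * r ^+ 2) r q p @[r --> +oo] --> star_exp nu q p.
Proof.
rewrite star_expE; apply/(@cvg_qmodP _ _ (+oo : set_system R)).
pose r0 := qmod q + qmod p + 1.
have q0 := qmod_ge0 q; have p0 := qmod_ge0 p.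
have r1 : 1 <= r0 by rewrite /r0; lra.
have r0_gt0 : 0 < r0 by exact: lt_le_trans r1.
have qr (r : R) : r0 <= r -> qball r q by rewrite /qball /r0 /=; lra.
have pr (r : R) : r0 <= r -> qball r p by rewrite /qball /r0 /=; lra.
have := wkernel_chord nu0 (radial_weight_powR nu0 r0_gt0) (radial_weight_expR nu0) (q := q) (p := p).
rewrite wdomain_qball// => /(_ (qr _ (lexx _)) (pr _ (lexx _)))[C hC].
apply/cvgrPdist_le => e e0; near=> r.
have rr0 : r0 <= r by near: r; apply: nbhs_pinfty_ge; exact: num_real.
have rC : r0 ^+ 2 * C / e <= r by near: r; apply: nbhs_pinfty_ge; exact: num_real.
have r_gt0 : 0 < r by exact: lt_le_trans rr0.
have r2 : 0 < r ^+ 2 by rewrite exprn_gt0.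
have [_ ->] := bergman_kernelP r_gt0; [|exact: qr|exact: pr].
rewrite sub0r normrN ger0_norm//.
pose t := r0 ^+ 2 / r ^+ 2.
have tE : r ^- 2 = t * r0 ^- 2.
  by rewrite /t mulrAC mulfV ?mul1r// expf_neq0// gt_eqF.
have t01 : 0 <= t <= 1.
  apply/andP; split; first by apply: divr_ge0; exact: sqr_ge0.
  by rewrite ler_pdivrMr// mul1r lerXn2r// nnegrE ltW.
have hw := radial_weight_powR nu0 r_gt0.
rewrite tE in hw *; apply: (le_trans (hC t _ _ t01 hw)).
rewrite /t mulrAC ler_pdivrMr//.
move: rC; rewrite ler_pdivrMr// => /le_trans; apply.
by rewrite [leRHS]mulrC ler_pM2r// expr2 ler_peMl ?(ltW r_gt0) ?(le_trans r1 rr0).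
Unshelve. all: by end_near. Qed.

End Kernels.

Theorem theorem5p1 (R : realType) (nu : R) (hnu : 0 < nu) :
  [/\ forall q p : quat R, cvgn (series (star_exp_term nu q p)),
      is_reproducing_kernel setT (fock_weight nu) (fock_kernel nu),
      forall q p : quat R, fock_kernel nu q p = star_exp nu q p,
      forall r : R, 0 < r ->
        is_reproducing_kernel (qball r) (bergman_weight (nu * r ^+ 2) r)
          (bergman_kernel (nu * r ^+ 2) r) &
      forall q p : quat R,
        bergman_kernel (nu * r ^+ 2) r q p @[r --> +oo] --> star_exp nu q p].
Proof.
have [hF eF] := fock_kernelP hnu; split => //.
- by move=> q p; apply/cvg_ex; exists (wkernel 0 nu q p); exact: cvg_star_exp.
- by move=> q p; rewrite eF star_expE.
- by move=> r r0; have [] := bergman_kernelP hnu r0.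
- by move=> q p; exact: bergman_kernel_cvg.
Qed.
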